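(* Let $u^{e}$ be the weak solution of the boundary value problem, let $u^{e}_{h}\in V_h$ be its standard finite element approximation on the fine mesh, and let $u_{h}^{G}=u_h^p+u_h^s$ be the discrete MS-GFEM approximation (all defined in the context). Then $$\big\Vert u^{e} - u^{G}_{h} \big\Vert_{a} \leq \Vert u^{e} - u^{e}_{h} \Vert_{a} +\sqrt{\kappa\kappa^{\ast}}\Big(\max_{i=1,\cdots,M}\lambda^{-1/2}_{h,n_{i}+1}\Big)\Vert u^{e}_{h}\Vert_{a},$$ where, for each $i$, $\lambda_{h,n_{i}+1}$ is the $(n_i+1)$-th eigenvalue (in increasing order) of the local discrete eigenvalue problem: find $\lambda_h\in\mathbb{R}$ and $\phi_h\in W_h(\omega_i^\ast)$ with $a_{\omega^{\ast}_{i}}(\phi_{h},v) = \lambda_{h} \,a_{\omega_{i}}(\chi_{i}\phi_{h}, \chi_{i}v)$ for all $v\in W_{h}(\omega^{\ast}_i)$.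
   Context: Problem. $\Omega\subset\mathbb{R}^d$, $d=2,3$, is a bounded polygonal ($d=2$) or polyhedral ($d=3$) domain with Lipschitz boundary, $\partial\Omega_D\cap\partial\Omega_N=\emptyset$, $\overline{\partial\Omega_D}\cup\overline{\partial\Omega_N}=\partial\Omega$. $A\in (L^\infty(\Omega))^{d\times d}$ is pointwise symmetric and there are $0<\alpha<\beta$ with $\alpha|\xi|^2\le A(x)\xi\cdot\xi\le\beta|\xi|^2$ for all $\xi\in\mathbb{R}^d$, $x\in\Omega$; $f\in L^2(\Omega)$, $g\in H^{-1/2}(\partial\Omega_N)$, $q\in H^{1/2}(\partial\Omega_D)$. For $\omega\subset\Omega$ put $a_\omega(u,v)=\int_\omega A\nabla u\cdot\nabla v\,dx$, $\Vert u\Vert_{a,\omega}=\sqrt{a_\omega(u,u)}$, $F_\omega(v)=\int_{\partial\omega\cap\partial\Omega_N}gv\,ds+\int_\omega fv\,dx$; the subscript is dropped if $\omega=\Omega$. $H^1_D(\Omega)=\{v\in H^1(\Omega):v=0\text{ on }\partial\Omega_D\}$. The weak solution $u^e\in H^1(\Omega)$ satisfies $u^e=q$ on $\partial\Omega_D$ and $a(u^e,v)=F(v)$ for all $v\in H^1_D(\Omega)$; the problem is taken to be uniquely solvable. Cover and partition of unity. $\{\omega_i\}_{i=1}^M$ are open sets with $\omega_i\subset\Omega$, $\bigcup_i\omega_i=\Omega$; each $x\in\Omega$ belongs to at most $\kappa$ of the $\omega_i$. $\{\chi_i\}$ satisfies $0\le\chi_i\le1$, $\sum_i\chi_i=1$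 on $\Omega$, $\chi_i=0$ on $\Omega\setminus\omega_i$, $\chi_i\in C^1(\omega_i)$, $\max_{x\in\Omega}|\nabla\chi_i(x)|\le C_1/\mathrm{diam}(\omega_i)$. Oversampling domains $\omega_i^\ast$ satisfy $\omega_i\subset\omega_i^\ast\subset\Omega$; each $x\in\Omega$ belongs to at most $\kappa^\ast$ of the $\omega_i^\ast$. Discretization. $\tau_h$ is a shape-regular triangulation of $\Omega$ into triangles (tetrahedra), or rectangles if $\Omega$ is rectangular, with mesh size $h$ the maximal element diameter; $V_h\subset H^1(\Omega)$ is the lowest-order Lagrange finite element space on $\tau_h$. The $\omega_i^\ast$ are resolved by the mesh. Set $V_h(\omega_i^\ast)=\{v|_{\omega_i^\ast}:v\in V_h\}$, $V_{h,D}(\omega_i^\ast)=\{v\in V_h(\omega_i^\ast):v=0\text{ on }\partial\omega_i^\ast\cap\partial\Omega_D\}$, $V_{h,DI}(\omega_i^\ast)=\{v\in V_h(\omega_i^\ast):v=0\text{ on }(\partial\omega_i^\ast\cap\partial\Omega_D)\cup(\partial\omega_i^\ast\cap\Omega)\}$, $W_h(\omega_i^\ast)=\{u\in V_{h,D}(\omega_i^\ast):a_{\omega_i^\ast}(u,v)=0\ \forall v\in V_{h,DI}(\omega_i^\ast)\}$. Fine-scale solution: $u^e_h\in V_h$ with $u_h^e=q$ on $\partial\Omega_D$ and $a(u_h^e,v)=F(v)$ for all $v\in V_h$ with $v=0$ on $\partial\Omega_D$. (It is implicit that $q$ is the trace of a function in $V_h$, so that such functions exist.) Discrete MS-GFEM.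 Local particular function: $u^p_{h,i}=(\psi^r_{h,i}+\psi^d_{h,i})|_{\omega_i}$, where $\psi^r_{h,i}\in V_{h,DI}(\omega_i^\ast)$ satisfies $a_{\omega_i^\ast}(\psi^r_{h,i},v)=F_{\omega_i^\ast}(v)$ for all $v\in V_{h,DI}(\omega_i^\ast)$, and $\psi^d_{h,i}\in V_h(\omega_i^\ast)$ satisfies $\psi^d_{h,i}=q$ on $\partial\omega_i^\ast\cap\partial\Omega_D$ and $a_{\omega_i^\ast}(\psi^d_{h,i},v)=0$ for all $v\in V_{h,D}(\omega_i^\ast)$ ($\psi^d_{h,i}=0$ if $\partial\omega_i^\ast\cap\partial\Omega_D=\emptyset$). Local approximation space: $S_{h,n_i}(\omega_i)=\mathrm{span}\{\phi_{h,1}|_{\omega_i},\dots,\phi_{h,n_i}|_{\omega_i}\}$, where the $\phi_{h,j}\in W_h(\omega_i^\ast)$ are eigenfunctions for the $n_i$ smallest eigenvalues of the local discrete eigenvalue problem stated in the claim. Globally, $u_h^p=\sum_i\chi_iu^p_{h,i}$ and $S_h(\Omega)=\{\sum_i\chi_iv_i:v_i\in S_{h,n_i}(\omega_i)\}$. The discrete MS-GFEM approximation is $u_h^G=u_h^p+u_h^s$ with $u_h^s\in S_h(\Omega)$ satisfying $a(u_h^s,v)=F(v)-a(u_h^p,v)$ for all $v\in S_h(\Omega)$. *)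

(* Defs.v *)
From HB Require Import structures.
From mathcomp Require Import all_boot all_order all_algebra.
From mathcomp Require Import all_classical all_reals all_analysis.

Set Implicit Arguments.
Unset Strict Implicit.
Unset Printing Implicit Defensive.
Import Order.TTheory GRing.Theory Num.Theory.
Import numFieldNormedType.Exports.

Local Open Scope classical_set_scope.
Local Open Scope ring_scope.

(* R^d is 'rV[R]_d.  The norm and distance of the library on 'rV[R]_d are the
   maximum ones (same topology); the Euclidean norm is enorm below. *)

Section euclidean.
Context {R : realType} {d : nat}.
Implicit Types (u v : 'rV[R]_d) (D : set 'rV[R]_d).

Definition dotp u v : R := \sum_(j < d) u 0 j * v 0 j.

Definition enorm u : R := Num.sqrt (dotp u u).

(* The matrix-vector product "M v" for row vectors. *)
Definition mulmv (M : 'M[R]_d) v : 'rV[R]_d := v *m M^T.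

(* Only used for bounded D, where sup is the supremum. *)
Definition diam D : R :=
  sup [set r | exists x y, [/\ D x, D y & r = enorm (x - y)]].

Definition bd D : set 'rV[R]_d := closure D `\` interior D.

Definition gradient (f : 'rV[R]_d -> R) (x : 'rV[R]_d) : 'rV[R]_d :=
  \row_(j < d) 'D_(delta_mx 0 j) f x.

Definition C1_on D (f : 'rV[R]_d -> R) : Prop :=
  forall x, D x -> forall j : 'I_d,
    derivable f x (delta_mx 0 j) /\
    {for x, continuous (fun y => 'D_(delta_mx 0 j) f y)}.

End euclidean.

(* The Borel sigma-algebra of R^n, generated by the coordinate functions, and
   the n-dimensional Lebesgue measure, as an iterated product measure. *)

Definition rV_display : measure_display -> measure_display.
Proof. exact. Qed.

Section measurable_rV.
Context {R : realType} {n : nat}.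

Definition rV_coord (i : 'I_n) (x : 'rV[R]_n) : measurableTypeR R := x 0 i.

Let rV_set0 : g_sigma_preimage rV_coord set0.
Proof. exact: sigma_algebra0. Qed.

Let rV_setC A : g_sigma_preimage rV_coord A -> g_sigma_preimage rV_coord (~` A).
Proof. exact: sigma_algebraC. Qed.

Let rV_bigcup (F : (set 'rV[R]_n)^nat) :
  (forall i, g_sigma_preimage rV_coord (F i)) ->
  g_sigma_preimage rV_coord (\bigcup_i (F i)).
Proof. exact: sigma_algebra_bigcup. Qed.

HB.instance Definition _ := @isMeasurable.Build (rV_display default_measure_display)
  'rV[R]_n (g_sigma_preimage rV_coord) rV_set0 rV_setC rV_bigcup.

End measurable_rV.

Section lebesgue_rV.
Context {R : realType}.

Lemma measurable_rV_coord n (i : 'I_n) :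
  measurable_fun [set: 'rV[R]_n] (rV_coord i).
Proof.
move=> _ A mA; rewrite setTI; apply: sub_sigma_algebra.
case: n i => [[] []//|n i].
rewrite -bigcup_mkord_ord; exists i; first exact: ltn_ord.
by exists A => //; rewrite inord_val setTI.
Qed.

Lemma measurable_fun_rVP d (T : measurableType d) n (f : T -> 'rV[R]_n) :
  (forall i, measurable_fun [set: T] (rV_coord i \o f)) ->
  measurable_fun [set: T] f.
Proof.
move=> mf.
suff : g_sigma_preimage (fun i => rV_coord i \o f) `<=` measurable.
  rewrite g_sigma_preimage_comp => + _ A mA; apply.
  by exists A.
apply: smallest_sub; first exact: sigma_algebra_measurable.
case: n f mf => [|n] f mf; first by rewrite big_ord0.
rewrite -bigcup_mkord_ord; apply: bigcup_sub => i Ii.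
by move=> A [B mB <-]; exact: mf.
Qed.

Definition cons_rV n (p : 'rV[R]_n * measurableTypeR R) : 'rV[R]_n.+1 :=
  \row_(i < n.+1) oapp (fun j => p.1 0 j) p.2 (unlift ord0 i).

Lemma measurable_cons_rV n : measurable_fun setT (@cons_rV n).
Proof.
apply: measurable_fun_rVP => i.
case: (unliftP ord0 i) => [j ->|->].
  rewrite (_ : _ \o _ = rV_coord j \o fst); last first.
    by apply/funext => p; rewrite /= /rV_coord mxE liftK.
  by apply: measurableT_comp; [exact: measurable_rV_coord|exact: measurable_fst].
rewrite (_ : _ \o _ = snd); first exact: measurable_snd.
by apply/funext => p; rewrite /= /rV_coord mxE unlift_none.
Qed.

Section lebesgue_rV_succ.
Context {n : nat}.
Variable mu : {measure set 'rV[R]_n -> \bar R}.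

Definition lebesgue_rV_succ : set 'rV[R]_n.+1 -> \bar R :=
  pushforward (mu \x @lebesgue_measure R)%E (@cons_rV n).

Let mpush : {measure set 'rV[R]_n.+1 -> \bar R} :=
  measure_function_pushforward__canonical__measure_function_Measure
    (mu \x @lebesgue_measure R)%E (@measurable_cons_rV n).

HB.instance Definition _ := isMeasure.Build _ _ _ lebesgue_rV_succ
  (measure0 mpush) (measure_ge0 mpush) (@measure_semi_sigma_additive _ _ _ mpush).

End lebesgue_rV_succ.

Fixpoint lebesgue_rV (n : nat) : {measure set 'rV[R]_n -> \bar R} :=
  match n with
  | 0%N => dirac (0 : 'rV[R]_0)
  | n'.+1 => lebesgue_rV_succ (lebesgue_rV n')
  end.

Lemma lebesgue_rV_box n (A : 'I_n -> set (measurableTypeR R)) :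
  (forall i, measurable (A i)) ->
  lebesgue_rV n [set x : 'rV[R]_n | forall i, A i (x 0 i)] =
  (\prod_(i < n) lebesgue_measure (A i))%E.
Proof.
elim: n A => [|n IHn] A mA.
  rewrite big_ord0 /= diracE.
  by rewrite (_ : _ \in _) // inE => -[].
rewrite big_ord_recl /= /lebesgue_rV_succ /pushforward.
set B := [set x : 'rV[R]_n | forall i, A (lift ord0 i) (x 0 i)].
have mB : measurable B.
  rewrite (_ : B = \bigcap_(i in [set: 'I_n]) (rV_coord i @^-1` A (lift ord0 i))).
    apply: fin_bigcap_measurable => // i _; rewrite -[X in measurable X]setTI.
    exact: measurable_rV_coord.
  by apply/seteqP; split => [x Bx i _ //|x Bx i]; exact: Bx.
rewrite (_ : _ @^-1` _ = B `*` A ord0); last first.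
  apply/seteqP; split => [p pA|p [pB pA] i].
    split=> [i|]; first by have := pA (lift ord0 i); rewrite mxE liftK.
    by have := pA ord0; rewrite mxE unlift_none.
  rewrite mxE; case: (unliftP ord0 i) => [j ->|->] //=; exact: pB.
rewrite product_measure1E// muleC; congr (_ * _)%E.
exact: IHn.
Qed.

End lebesgue_rV.

(* The s-dimensional Hausdorff measure as an outer measure.  The sets C of a
   cover have diameter at most r <= delta and contribute r ^+ s; restricting to
   Borel covers is harmless since closing a set keeps its diameter.  The usual
   normalizing constant is omitted: only null sets and convergence to 0 of
   integrals matter below. *)

Section hausdorff.
Context {R : realType} {d : nat}.
Variable s : nat.
Local Open Scope ereal_scope.
Implicit Types (C : set 'rV[R]_d) (delta : R).

Definition hausdorff_gauge delta C : \bar R :=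
  if `[< C = set0 >] then 0 else
  ereal_inf [set (r ^+ s)%:E | r in
    [set r : R | (0 <= r <= delta)%R /\
                 forall x y, C x -> C y -> (enorm (x - y) <= r)%R]].

Lemma hausdorff_gauge0 delta : hausdorff_gauge delta set0 = 0.
Proof. by rewrite /hausdorff_gauge asboolT. Qed.

Lemma hausdorff_gauge_ge0 delta C : 0 <= hausdorff_gauge delta C.
Proof.
rewrite /hausdorff_gauge; case: ifP => // _.
apply: le_ereal_inf_tmp => _ [r [/andP[r0 _] _] <-].
by rewrite lee_fin exprn_ge0.
Qed.

Definition hausdorff (A : set 'rV[R]_d) : \bar R :=
  ereal_sup [set mu_ext (hausdorff_gauge delta) A | delta in
    [set delta : R | (0 < delta)%R]].

Let hausdorff0 : hausdorff set0 = 0.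
Proof.
rewrite /hausdorff; apply/eqP; rewrite eq_le; apply/andP; split.
  apply: ge_ereal_sup => _ [delta _ <-].
  by rewrite mu_ext0//; [exact: hausdorff_gauge0|exact: hausdorff_gauge_ge0].
apply: ereal_sup_ubound; exists 1%R => //=.
by rewrite mu_ext0//; [exact: hausdorff_gauge0|exact: hausdorff_gauge_ge0].
Qed.

Let hausdorff_ge0 A : 0 <= hausdorff A.
Proof.
apply: (@le_trans _ _ (mu_ext (hausdorff_gauge 1%R) A)).
  exact: mu_ext_ge0 (hausdorff_gauge_ge0 1%R) A.
by apply: ereal_sup_ubound; exists 1%R => /=.
Qed.

Let le_hausdorff : {homo hausdorff : A B / A `<=` B >-> A <= B}.
Proof.
move=> A B AB; apply: ge_ereal_sup => _ [delta delta0 <-].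
apply: le_trans (le_mu_ext (hausdorff_gauge delta) AB) _.
by apply: ereal_sup_ubound; exists delta.
Qed.

Let hausdorff_sigma_subadditive : sigma_subadditive hausdorff.
Proof.
move=> F; apply: ge_ereal_sup => _ [delta delta0 <-].
apply: (le_trans (mu_ext_sigma_subadditive (hausdorff_gauge_ge0 delta) F)).
apply: lee_nneseries => [i *|i *].
  exact: (@mu_ext_ge0 _ _ _ _ (hausdorff_gauge_ge0 delta)).
by apply: ereal_sup_ubound; exists delta.
Qed.

HB.instance Definition _ := isOuterMeasure.Build R 'rV[R]_d hausdorff
  hausdorff0 hausdorff_ge0 le_hausdorff hausdorff_sigma_subadditive.

End hausdorff.

Section domains.
Context {R : realType} {d : nat}.
Implicit Types (Omega : set 'rV[R]_d).

Definition conv_hull (I : finType) (p : I -> 'rV[R]_d) : set 'rV[R]_d :=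
  [set x | exists w : I -> R,
    [/\ forall i, 0 <= w i, \sum_i w i = 1 & x = \sum_i w i *: p i]].

(* The boundary is a finite union of segments (d = 2), triangles (d = 3). *)
Definition polytopal Omega : Prop :=
  exists (N : nat) (p : 'I_N -> 'I_d -> 'rV[R]_d),
    bd Omega = \bigcup_(k in [set: 'I_N]) conv_hull (p k).

(* Near each boundary point, Omega lies strictly above the graph of a Lipschitz
   function gam of the component of y orthogonal to the unit vector nu. *)
Definition lipschitz_boundary Omega : Prop :=
  forall x, bd Omega x ->
  exists (nu : 'rV[R]_d) (gam : 'rV[R]_d -> R) (L r : R),
    [/\ enorm nu = 1, 0 < r,
        forall y z, `|gam y - gam z| <= L * enorm (y - z) &
        forall y, enorm (y - x) < r ->
          (Omega y <-> gam (y - dotp y nu *: nu) < dotp y nu)].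

Definition polytopal_lipschitz_domain Omega : Prop :=
  [/\ open Omega, connected Omega & Omega !=set0] /\
  [/\ bounded_set Omega, polytopal Omega & lipschitz_boundary Omega].

End domains.

Section sobolev.
Context {R : realType} {d : nat}.
Implicit Types (O Gam : set 'rV[R]_d) (u v f : 'rV[R]_d -> R).
Implicit Types (G : 'rV[R]_d -> 'rV[R]_d).

Let leb : {measure set 'rV[R]_d -> \bar R} := lebesgue_rV d.

Definition L2 O f : Prop :=
  measurable_fun O f /\ (\int[leb]_(x in O) ((f x) ^+ 2)%:E < +oo)%E.

Definition Linfty O f : Prop :=
  measurable_fun O f /\
  exists C : R, {ae leb, forall x, O x -> `|f x| <= C}.

(* Test functions are C^1 with compact support in O; this is the usual class
   for first-order weak derivatives, and gives the same ones as C^infty. *)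
Definition test_function O f : Prop :=
  C1_on setT f /\
  exists K, [/\ compact K, K `<=` O & forall x, ~ K x -> f x = 0].

Definition is_weak_gradient O u G : Prop :=
  (forall j : 'I_d, L2 O (fun x => G x 0 j)) /\
  forall f, test_function O f -> forall j : 'I_d,
    \int[leb]_(x in O) (u x * gradient f x 0 j) =
    - \int[leb]_(x in O) (G x 0 j * f x).

Definition H1 O u : Prop := L2 O u /\ exists G, is_weak_gradient O u G.

(* Unique up to a null set of O when u is in H1 O. *)
Definition wgrad O u : 'rV[R]_d -> 'rV[R]_d :=
  xget (fun=> 0) [set G | is_weak_gradient O u G].

Definition H1norm O u : R :=
  Num.sqrt (\int[leb]_(x in O) (u x ^+ 2) +
            \int[leb]_(x in O) (enorm (wgrad O u x) ^+ 2)).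

(* Surface measure, on its Caratheodory sigma-algebra. *)
Let surf := @hausdorff R d d.-1.

(* The trace of u on Gam (a part of the boundary of O) is t: the trace operator
   is the continuous extension, from H^1(O) to L^2(Gam), of the restriction to
   Gam of the functions in H^1(O) that are continuous on the closure of O. *)
Definition has_trace O Gam u (t : 'rV[R]_d -> R) : Prop :=
  measurable_fun (Gam : set (caratheodory_type surf)) t /\
  exists p : nat -> 'rV[R]_d -> R,
    [/\ forall n, H1 O (p n) /\ {within closure O, continuous (p n)},
        (fun n => H1norm O (fun x => p n x - u x)) @ \oo --> (0 : R) &
        (fun n => \int[surf]_(x in (Gam : set (caratheodory_type surf)))
                    ((p n x - t x) ^+ 2)%:E)%E @ \oo --> (0%R)%:E].

Definition trace O Gam u : 'rV[R]_d -> R := xget (fun=> 0) [set t | has_trace O Gam u t].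

(* H^{1/2}(Gam), as the space of traces on Gam of functions in H^1(O). *)
Definition H_half O Gam (q : 'rV[R]_d -> R) : Prop :=
  exists2 u, H1 O u & has_trace O Gam u q.

Definition H1D O GamD v : Prop := H1 O v /\ has_trace O GamD v (fun=> 0).

(* H^{-1/2}(GamN): the bounded linear functionals on the traces on GamN of
   functions in H^1_D(O), normed as a quotient of H^1_D(O).  Functionals on all
   of the traces on GamN of functions in H^1(O) are a special case. *)
Definition H_minus_half O GamD GamN (g : ('rV[R]_d -> R) -> R) : Prop :=
  (forall (c : R) v w s t, H1D O GamD v -> H1D O GamD w ->
     has_trace O GamN v s -> has_trace O GamN w t ->
     g (fun x => c * s x + t x) = c * g s + g t) /\
  exists C : R, forall v t, H1D O GamD v -> has_trace O GamN v t ->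
    `|g t| <= C * H1norm O v.

End sobolev.

Section variational_problem.
Context {R : realType} {d : nat}.
Variables (Omega GamD GamN : set 'rV[R]_d) (A : 'rV[R]_d -> 'M[R]_d).
Variables (f : 'rV[R]_d -> R) (g : ('rV[R]_d -> R) -> R) (q : 'rV[R]_d -> R).
Implicit Types (O : set 'rV[R]_d) (u v : 'rV[R]_d -> R).

Let leb : {measure set 'rV[R]_d -> \bar R} := lebesgue_rV d.

Definition coefficient (alpha beta : R) : Prop :=
  [/\ 0 < alpha < beta,
      forall i j, Linfty Omega (fun x => A x i j),
      forall x, Omega x -> (A x)^T = A x &
      forall x, Omega x -> forall xi,
        alpha * enorm xi ^+ 2 <= dotp (mulmv (A x) xi) xi <= beta * enorm xi ^+ 2].

Definition aform O u v : R :=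
  \int[leb]_(x in O) (dotp (mulmv (A x) (wgrad O u x)) (wgrad O v x)).

Definition anorm O u : R := Num.sqrt (aform O u u).

Definition ext0 O v : 'rV[R]_d -> R := fun x => if x \in closure O then v x else 0.

(* The boundary term is the duality pairing of g with the trace on GamN of the
   extension of v by zero outside O. *)
Definition load O v : R :=
  g (trace Omega GamN (ext0 O v)) + \int[leb]_(x in O) (f x * v x).

Definition weak_solution u : Prop :=
  [/\ H1 Omega u, has_trace Omega GamD u q &
      forall v, H1D Omega GamD v -> aform Omega u v = load Omega v].

End variational_problem.

(* Simplices or rectangles (boxes), as affine images of a reference cell. *)
Inductive cell_kind := Simplicial | Rectangular.

Section meshes.
Context {R : realType} {d : nat}.
Implicit Types (k : cell_kind) (Omega O T : set 'rV[R]_d).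

Record cell := Cell { cell_base : 'rV[R]_d; cell_edges : 'M[R]_d }.

Definition cell_map (c : cell) (s : 'rV[R]_d) : 'rV[R]_d :=
  cell_base c + s *m cell_edges c.

Definition ref_cell k : set 'rV[R]_d :=
  match k with
  | Simplicial => [set s | (forall j, 0 <= s 0 j) /\ \sum_j s 0 j <= 1]
  | Rectangular => [set s | forall j, 0 <= s 0 j <= 1]
  end.

Definition cell_set k (c : cell) : set 'rV[R]_d := cell_map c @` ref_cell k.

(* The edges at the base vertex are independent, and orthogonal for boxes. *)
Definition cell_wf k (c : cell) : Prop :=
  cell_edges c \in unitmx /\
  (k = Rectangular -> is_diag_mx (cell_edges c *m (cell_edges c)^T)).

(* P_1, resp. Q_1, on the reference cell. *)
Definition shape_function k (p : 'rV[R]_d -> R) : Prop :=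
  match k with
  | Simplicial => exists (a : R) (b : 'I_d -> R),
      forall s, p s = a + \sum_j b j * s 0 j
  | Rectangular => exists a : {set 'I_d} -> R,
      forall s, p s = \sum_(J : {set 'I_d}) a J * \prod_(j in J) s 0 j
  end.

(* G is a (nonempty) face of the convex polytope T: the set where a linear
   functional attains its maximum over T. *)
Definition is_face T G : Prop :=
  exists l : 'rV[R]_d, G = [set x | T x /\ forall y, T y -> dotp l y <= dotp l x].

Definition shape_regular (sigma : R) T : Prop :=
  exists (x : 'rV[R]_d) (rho : R),
    [/\ 0 < rho, [set y | enorm (y - x) <= rho] `<=` T & diam T <= sigma * rho].

Definition triangulation k Omega (sigma h : R) (N : nat) (tau : 'I_N -> cell) : Prop :=
  [/\ forall i, cell_wf k (tau i),
      \bigcup_(i in [set: 'I_N]) cell_set k (tau i) = closure Omega &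
      forall i j, i != j ->
        let Ti := cell_set k (tau i) in let Tj := cell_set k (tau j) in
        interior Ti `&` interior Tj = set0 /\
        (Ti `&` Tj = set0 \/ is_face Ti (Ti `&` Tj) /\ is_face Tj (Ti `&` Tj))] /\
  [/\ forall i, shape_regular sigma (cell_set k (tau i)),
      h = \big[Num.max/0]_(i < N) diam (cell_set k (tau i)) &
      k = Rectangular -> exists c, cell_wf k c /\ Omega = interior (cell_set k c)].

Definition resolved k (N : nat) (tau : 'I_N -> cell) O : Prop :=
  exists S : set 'I_N, closure O = \bigcup_(i in S) cell_set k (tau i).

End meshes.

(* Finite element functions are represented pointwise, including their values
   on the boundary of the set on which they live. *)
Section finite_elements.
Context {R : realType} {d : nat}.
Variables (Omega GamD : set 'rV[R]_d) (A : 'rV[R]_d -> 'M[R]_d).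
Variables (k : cell_kind) (N : nat) (tau : 'I_N -> @cell R d).
Implicit Types (O : set 'rV[R]_d) (u v : 'rV[R]_d -> R).

Definition Vh v : Prop :=
  {within closure Omega, continuous v} /\
  forall i, exists2 p, shape_function k p &
    forall s, ref_cell k s -> v (cell_map (tau i) s) = p s.

Definition Vh_loc O v : Prop := exists2 w, Vh w & forall x, closure O x -> v x = w x.

Definition VhD O v : Prop :=
  Vh_loc O v /\ forall x, bd O x -> GamD x -> v x = 0.

Definition VhDI O v : Prop :=
  Vh_loc O v /\ forall x, bd O x -> GamD x \/ Omega x -> v x = 0.

Definition Wh O u : Prop := VhD O u /\ forall v, VhDI O v -> aform A O u v = 0.

End finite_elements.

Section msgfem.
Context {R : realType} {d : nat}.
Implicit Types (O : set 'rV[R]_d) (u v : 'rV[R]_d -> R).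

Definition overlap_le (M : nat) (omega : 'I_M -> set 'rV[R]_d)
    (Omega : set 'rV[R]_d) (kappa : nat) : Prop :=
  forall x, Omega x -> (#|[set i | x \in omega i]%SET| <= kappa)%N.

Definition open_cover (M : nat) (Omega : set 'rV[R]_d)
    (omega : 'I_M -> set 'rV[R]_d) : Prop :=
  (forall i, open (omega i)) /\ \bigcup_(i in [set: 'I_M]) omega i = Omega.

Definition partition_of_unity (M : nat) (Omega : set 'rV[R]_d)
    (omega : 'I_M -> set 'rV[R]_d) (C1 : R) (chi : 'I_M -> 'rV[R]_d -> R) : Prop :=
  [/\ forall i x, Omega x -> 0 <= chi i x <= 1,
      forall x, Omega x -> \sum_(i < M) chi i x = 1,
      forall i x, Omega x -> ~ omega i x -> chi i x = 0,
      forall i, C1_on (omega i) (chi i) &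
      forall i x, omega i x -> enorm (gradient (chi i) x) <= C1 / diam (omega i)].

(* All the eigenvalues of "a u v = lam * b u v for all v in W", u in W,
   counted with multiplicity and in increasing order, as lam_0, ..., lam_{m-1},
   with eigenfunctions phi_0, ..., phi_{m-1}: independent (as functions on O),
   and such that each eigenspace is spanned by those with that eigenvalue. *)
Definition eigensystem O (W : set ('rV[R]_d -> R))
    (a b : ('rV[R]_d -> R) -> ('rV[R]_d -> R) -> R)
    (m : nat) (lam : nat -> R) (phi : nat -> 'rV[R]_d -> R) : Prop :=
  [/\ forall j, (j < m)%N ->
        W (phi j) /\ forall v, W v -> a (phi j) v = lam j * b (phi j) v,
      forall i j, (i <= j < m)%N -> lam i <= lam j,
      forall c : nat -> R, (forall x, O x -> \sum_(j < m) c j * phi j x = 0) ->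
        forall j, (j < m)%N -> c j = 0 &
      forall (mu : R) u, W u -> (forall v, W v -> a u v = mu * b u v) ->
        exists c : nat -> R, forall x, O x ->
          u x = \sum_(j < m | lam j == mu) c j * phi j x].

Definition span_on O (n : nat) (phi : nat -> 'rV[R]_d -> R) v : Prop :=
  exists c : nat -> R, forall x, O x -> v x = \sum_(j < n) c j * phi j x.

Definition pou_sum (M : nat) (chi v : 'I_M -> 'rV[R]_d -> R) : 'rV[R]_d -> R :=
  fun x => \sum_(i < M) chi i x * v i x.

Definition Sh (M : nat) (Omega : set 'rV[R]_d) (omega : 'I_M -> set 'rV[R]_d)
    (chi : 'I_M -> 'rV[R]_d -> R) (n : 'I_M -> nat)
    (phi : 'I_M -> nat -> 'rV[R]_d -> R) v : Prop :=
  exists w : 'I_M -> 'rV[R]_d -> R,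
    (forall i, span_on (omega i) (n i) (phi i) (w i)) /\
    forall x, Omega x -> v x = pou_sum chi w x.

End msgfem.

(* Main.v *)
Require Import Defs.
From mathcomp Require Import all_boot all_order all_algebra.
From mathcomp Require Import all_classical all_reals all_analysis.
From mathcomp Require Import measurable_realfun ring lra.
Set Implicit Arguments.
Unset Strict Implicit.
Unset Printing Implicit Defensive.
Import Order.TTheory GRing.Theory Num.Theory.
Import numFieldNormedType.Exports.
Local Open Scope classical_set_scope.
Local Open Scope ring_scope.

(** The estimate combines Galerkin orthogonality with optimal approximation on
    each patch.

    The error ue - (uhp + uhs) is a-orthogonal to S_h, so that uhs may be
    replaced by any function of S_h without decreasing the energy error.  Take
    the sum of the chi_i v_i, with v_i in the span of the first n_i
    eigenfunctions.  By the triangle inequality through uhe it then remains to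
    bound the energy of the sum of the chi_i (w_i - v_i), where
    w_i = uhe - psir_i - psid_i on the oversampling domain.  The remainder w_i
    lies in W_h (remainder_Wh) and is orthogonal to both particular functions,
    hence has at most the local energy of uhe (remainder_energy).  For v_i take
    the b-projection of w_i, b(u, v) being the energy product of chi_i u and
    chi_i v: by the Rayleigh principle (rayleigh_lower_bound), the energy of
    chi_i (w_i - v_i) is at most the energy of w_i over the (n_i + 1)-th
    eigenvalue (eigenfunction_approximation).  Summing up costs a factor kappa
    for the overlap of the patches and a factor kappas for that of the
    oversampling domains (overlap_sum_energy, overlap_restrict_energy).

    The rest is analysis that this argument takes for granted.

    Test functions.  The local equations of uhe come from testing the global
    problem with zero extensions of local functions.  The zero extension of a
    finite element function that vanishes on the interior boundary of a
    resolved subdomain is again one (ext0_Vh).  Continuity at a point where the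
    interior boundary meets the boundary of the domain is the delicate part; it
    follows because nearby points of a Lipschitz domain are joined by short
    paths inside it (lipschitz_path).

    Weak gradients.  They are unique almost everywhere, by the fundamental
    lemma (test_orthogonal_ae0).  A function that is Lipschitz along segments
    and differentiable off a null set has its classical gradient as weak
    gradient (lipschitz_is_weak_gradient); this covers finite element functions,
    since the boundaries of cells are null.  The products chi_i u need more
    care, as chi_i is C^1 in omega_i only and the boundary of omega_i may have
    positive measure.  Being Lipschitz along segments, chi_i becomes C^1 in the
    whole domain after composition with s |-> s (n s^2) / (1 + n s^2), which
    tends to the identity (chi_mul_weak_gradient).

    Traces.  Functions of S_h are admissible test functions for ue because they
    extend continuously to the closure of the domain, again by short paths, and
    the extension vanishes on the Dirichlet boundary (pou_H1D). *)

(** * Lebesgue measure on row vectors *)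

Section rowvectors.
Context {R : realType} {d : nat}.
Implicit Types (x y : 'rV[R]_d).

Lemma coord_le_norm x j : `|x 0 j| <= `|x|.
Proof.
rewrite [leRHS]/Num.norm /= mx_normrE; apply/bigmax_geP; right => /=.
by exists (0, j).
Qed.

Lemma norm_le_coord x (e : R) : 0 <= e -> (forall j, `|x 0 j| <= e) -> `|x| <= e.
Proof.
move=> e0 xe; rewrite [leLHS]/Num.norm /= mx_normrE; apply/bigmax_leP; split=> //.
by move=> [i j] _ /=; rewrite ord1.
Qed.

Lemma norm_lt_coord x (e : R) : 0 < e -> (forall j, `|x 0 j| < e) -> `|x| < e.
Proof.
move=> e0 xe; rewrite [ltLHS]/Num.norm /= mx_normrE; apply/bigmax_ltP; split=> //.
by move=> [i j] _ /=; rewrite ord1.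
Qed.

Definition unitv (j : 'I_d) : 'rV[R]_d := delta_mx 0 j.

Lemma unitvE j i : unitv j 0 i = (i == j)%:R.
Proof. by rewrite mxE eqxx. Qed.

Lemma norm_unitv j : `|unitv j| <= 1.
Proof.
apply: norm_le_coord => // i; rewrite unitvE.
by case: eqP; rewrite ?normr1 ?normr0.
Qed.

Lemma norm_scale_unitv (t : R) j : `|t *: unitv j| <= `|t|.
Proof. by rewrite normrZ ler_piMr// norm_unitv. Qed.

(** Open boxes form a pi-system that generates the Borel sets; they are the
    sets on which the iterated product measure is known explicitly. *)
Definition obox (a b : 'I_d -> R) : set 'rV[R]_d :=
  [set x | forall i, a i < x 0 i < b i].

Lemma measurable_obox a b : measurable (obox a b).
Proof.
rewrite (_ : obox a b = \bigcap_(i in [set: 'I_d]) (rV_coord i @^-1` `]a i, b i[)).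
  apply: fin_bigcap_measurable => // i _; rewrite -[X in measurable X]setTI.
  by apply: measurable_rV_coord => //; exact: measurable_itv.
apply/seteqP; split => [x xab i _|x xab i] /=; rewrite ?in_itv/=; first exact: xab.
by have := xab i I; rewrite /= in_itv.
Qed.

Lemma lebesgue_obox (a b : 'I_d -> R) :
  lebesgue_rV d (obox a b) =
  (\prod_(i < d) lebesgue_measure (`]a i, b i[ : set (measurableTypeR R)))%E.
Proof.
rewrite -(@lebesgue_rV_box R d (fun i => `]a i, b i[%classic)); last first.
  by move=> i; exact: measurable_itv.
by congr (lebesgue_rV d _); apply/seteqP; split => x xab i; have := xab i; rewrite /= in_itv.
Qed.

Definition cbox (a b : 'I_d -> R) : set 'rV[R]_d :=
  [set x | forall i, a i <= x 0 i <= b i].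

Definition rat_lo (p : {ffun 'I_d -> rat * rat}) (i : 'I_d) : R := ratr (p i).1.
Definition rat_up (p : {ffun 'I_d -> rat * rat}) (i : 'I_d) : R := ratr (p i).2.

(** Rational boxes form a countable base of the topology. *)
Lemma rational_box (U : set 'rV[R]_d) x : open U -> U x ->
  exists p, obox (rat_lo p) (rat_up p) x /\ cbox (rat_lo p) (rat_up p) `<=` U.
Proof.
rewrite openE => /(_ x) oU /oU /nbhs_ballP[e /= e0 xeU].
have lo i : {q : rat | x 0 i - e < ratr q < x 0 i}.
  by apply: cid; have [|q] := @rat_in_itvoo R (x 0 i - e) (x 0 i); [lra|rewrite in_itv; exists q].
have hi i : {q : rat | x 0 i < ratr q < x 0 i + e}.
  by apply: cid; have [|q] := @rat_in_itvoo R (x 0 i) (x 0 i + e); [lra|rewrite in_itv; exists q].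
exists [ffun i => (sval (lo i), sval (hi i))]; split=> [i|y By]; last first.
  apply: xeU; rewrite -ball_normE /=; apply: norm_lt_coord => // i.
  have := By i; rewrite /rat_lo /rat_up !mxE ffunE /=.
  by move: (svalP (lo i)) (svalP (hi i)) => /=; rewrite ltr_norml; lra.
rewrite /rat_lo /rat_up ffunE /=; move: (svalP (lo i)) (svalP (hi i)) => /=; lra.
Qed.

Lemma obox_cbox a b : obox a b `<=` cbox a b.
Proof. by move=> x xab i; have /andP[? ?] := xab i; rewrite !ltW. Qed.

Lemma open_measurable_rV (U : set 'rV[R]_d) : open U -> measurable U.
Proof.
move=> oU; pose B (p : {ffun 'I_d -> rat * rat}) := obox (rat_lo p) (rat_up p).
rewrite (_ : U = \bigcup_(p in [set p | B p `<=` U]) B p).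
  rewrite bigcup_mkcond; apply: countable_bigcupT_measurable => // p.
  by case: ifPn => _; [exact: measurable_obox|exact: measurable0].
apply/seteqP; split => [x Ux|x [p /= pU]]; last exact: pU.
have [p [xp pU]] := rational_box oU Ux.
by exists p => //=; exact: subset_trans (@obox_cbox _ _) pU.
Qed.

Lemma compact_cbox (a b : 'I_d -> R) : compact (cbox a b).
Proof.
have /(_ (fun i => `[a i, b i]%classic)) := @rV_compact R d.
rewrite (_ : mkset _ = cbox a b); first by apply => i; exact: segment_compact.
by apply/seteqP; split => x xab i; have := xab i; rewrite /= in_itv.
Qed.

Lemma closed_measurable_rV (U : set 'rV[R]_d) : closed U -> measurable U.
Proof.
move=> cU; rewrite -(setCK U); apply: measurableC; apply: open_measurable_rV.
exact: closed_openC.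
Qed.

Lemma bigcup_obox : \bigcup_n obox (fun=> - n%:R) (fun=> n%:R) = [set: 'rV[R]_d].
Proof.
apply/seteqP; split => // x _.
exists (Num.truncn `|x|).+1 => // i.
by rewrite -ltr_norml (le_lt_trans (coord_le_norm _ _))// truncnS_gt.
Qed.

Definition oboxes : set (set 'rV[R]_d) := [set obox p.1 p.2 | p in [set: ('I_d -> R) * ('I_d -> R)]].

Lemma measurable_rV_oboxes : (measurable : set (set 'rV[R]_d)) = <<s oboxes >>.
Proof.
apply/seteqP; split; last first.
  apply: smallest_sub; first exact: sigma_algebra_measurable.
  by move=> _ [[a b] _ <-]; exact: measurable_obox.
apply: smallest_sub; first exact: smallest_sigma_algebra.
suff gen (i : 'I_d) (A : set R) : measurable A -> <<s oboxes >> (rV_coord i @^-1` A).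
  case: d oboxes gen => [|n] ob gen; first by rewrite big_ord0 => x /=.
  rewrite -bigcup_mkord_ord; apply: bigcup_sub => i Ii A [B mB <-].
  by rewrite setTI; exact: gen.
rewrite (_ : measurable = (RGenInftyO.G (R:=R)).-sigma.-measurable :> set (set R)); last first.
  exact: RGenInftyO.measurableE.
move: A; apply: smallest_sub.
  split=> [|A GA|A GA]; first by rewrite preimage_set0; exact: sigma_algebra0.
    by rewrite setTD preimage_setC; exact: sigma_algebraC.
  by rewrite preimage_bigcup; exact: sigma_algebra_bigcup.
move=> _ [b ->].
pose lo (n : nat) (k : 'I_d) : R := - n%:R.
pose up (n : nat) (k : 'I_d) : R := if k == i then Num.min b n%:R else n%:R.
rewrite (_ : _ @^-1` _ = \bigcup_n obox (lo n) (up n)).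
  apply: sigma_algebra_bigcup => n.
  by apply: sub_sigma_algebra; exists (lo n, up n).
apply/seteqP; split => [x /= xb|x [n _ /= xn]]; last first.
  rewrite in_itv /= /rV_coord; have /andP[_] := xn i.
  by rewrite /up eqxx lt_min => /andP[].
have [n _ xn] : (\bigcup_n obox (fun=> - n%:R) (fun=> n%:R)) x by rewrite bigcup_obox.
exists n => // k; have := xn k; rewrite /lo /up; case: eqVneq => // ->.
by rewrite lt_min; move: xb; rewrite in_itv /= /rV_coord => ->.
Qed.

Lemma oboxI (a b a' b' : 'I_d -> R) : obox a b `&` obox a' b' =
  obox (fun i => Num.max (a i) (a' i)) (fun i => Num.min (b i) (b' i)).
Proof.
apply/seteqP; split => [x [xab xab'] i|x xab].
  rewrite gt_max lt_min; have /andP[-> ->] := xab i.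
  by have /andP[-> ->] := xab' i.
by split=> i; have := xab i; rewrite gt_max lt_min => /andP[/andP[? ?] /andP[? ?]]; apply/andP.
Qed.

Lemma setI_closed_oboxes : setI_closed oboxes.
Proof.
move=> _ _ [[a b] _ <-] [[a' b'] _ <-]; rewrite oboxI.
by exists (fun i => Num.max (a i) (a' i), fun i => Num.min (b i) (b' i)).
Qed.

Lemma lebesgue_obox_fin (a b : 'I_d -> R) : (lebesgue_rV d (obox a b) < +oo)%E.
Proof.
rewrite lebesgue_obox.
suff : (\prod_(i < d) lebesgue_measure (`]a i, b i[ : set (measurableTypeR R)))%E
    \is a fin_num by rewrite ltey_eq => ->.
apply: prode_fin_num => i _; rewrite ge0_fin_numE//.
by rewrite lebesgue_measure_itv /=; case: ifP => _; rewrite -?EFinB ltry.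
Qed.

Lemma oboxes_measure_unique (m1 m2 : {measure set 'rV[R]_d -> \bar R}) :
  (forall a b, m1 (obox a b) = m2 (obox a b)) ->
  (forall a b, m1 (obox a b) < +oo)%E ->
  forall A, measurable A -> m1 A = m2 A.
Proof.
move=> m12 m1fin A mA.
apply: (@measure_unique _ _ _ oboxes (fun n : nat => obox (fun=> - n%:R) (fun=> n%:R))) mA.
- exact: measurable_rV_oboxes.
- exact: setI_closed_oboxes.
- by move=> n; exists (fun=> - n%:R, fun=> n%:R).
- exact: bigcup_obox.
- by move=> _ [[a b] _ <-]; exact: m12.
- by move=> n; exact: m1fin.
Qed.

Lemma bounded_lebesgue_fin (A : set 'rV[R]_d) : measurable A -> bounded_set A ->
  (lebesgue_rV d A < +oo)%E.
Proof.
move=> mA [M [_ /(_ (`|M| + 1)) AM]].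
have {}AM x : A x -> `|x| <= `|M| + 1.
  by move=> Ax; apply: AM => //; rewrite (le_lt_trans (ler_norm _))// ltrDl.
apply: (@le_lt_trans _ _ (lebesgue_rV d (obox (fun=> - (`|M| + 2)) (fun=> `|M| + 2)))).
  apply: le_measure; rewrite ?inE//; first exact: measurable_obox.
  move=> x /AM xM i; rewrite -ltr_norml (le_lt_trans (coord_le_norm _ _))//.
  by rewrite (le_lt_trans xM)// ltrD2l ltr1n.
exact: lebesgue_obox_fin.
Qed.

Lemma measurable_shift (c : 'rV[R]_d) : measurable_fun setT (fun x : 'rV[R]_d => x + c).
Proof.
apply: measurable_fun_rVP => i.
rewrite (_ : _ \o _ = (fun x => rV_coord i x + c 0 i)); last first.
  by apply/funext => x; rewrite /= /rV_coord mxE.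
by apply: measurable_funD => //; exact: measurable_rV_coord.
Qed.

Lemma lebesgue_rV_shift (c : 'rV[R]_d) (A : set 'rV[R]_d) : measurable A ->
  lebesgue_rV d ((fun x => x + c) @^-1` A) = lebesgue_rV d A.
Proof.
pose m : {measure set 'rV[R]_d -> \bar R} :=
  measure_function_pushforward__canonical__measure_function_Measure
    (lebesgue_rV d) (measurable_shift c).
have mE a b : m (obox a b) = lebesgue_rV d (obox a b).
  have -> : m (obox a b) = lebesgue_rV d (obox (fun i => a i - c 0 i) (fun i => b i - c 0 i)).
    congr (lebesgue_rV d _); apply/seteqP; split => x xab i; have := xab i; rewrite mxE; lra.
  rewrite !lebesgue_obox; apply: eq_bigr => i _.
  rewrite !lebesgue_measure_itv /= !lte_fin ltrD2r; case: ifP => // _.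
  by rewrite -!EFinB; congr EFin; lra.
move=> mA; apply: (@oboxes_measure_unique m (lebesgue_rV d)) => // a b.
by have -> := mE a b; exact: lebesgue_obox_fin.
Qed.

(** Small translates of S along c are disjoint, congruent and stay in a bounded
    set, so infinitely many of them fit only if S is null. *)
Lemma transversal_null (S : set 'rV[R]_d) (c : 'rV[R]_d) :
  measurable S -> bounded_set S ->
  (forall x t, t != 0 -> S x -> S (x + t *: c) -> False) ->
  lebesgue_rV d S = 0%E.
Proof.
move=> mS bS Sc.
pose F (n : nat) := (fun x : 'rV[R]_d => x + n.+1%:R^-1 *: c) @^-1` S.
have mF n : measurable (F n).
  by rewrite -[F n]setTI; apply: measurable_shift.
have tF : trivIset setT F.
  apply/trivIsetP => i j _ _ ij; rewrite -subset0 => x [/= xi xj].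
  apply: (Sc (x + i.+1%:R^-1 *: c) (j.+1%:R^-1 - i.+1%:R^-1)) => //.
    by rewrite subr_eq0; apply: contra ij => /eqP/invr_inj/eqP; rewrite eqr_nat eq_sym.
  by rewrite -addrA -scalerDl [X in X *: c]addrC subrK.
have bU : bounded_set (\bigcup_n F n).
  case: bS => M [_ /(_ (`|M| + 1)) SM].
  exists (`|M| + 1 + `|c|); split; first by rewrite num_real.
  move=> r Mr x [n _ /= /SM].
  rewrite (le_lt_trans (ler_norm _)) ?ltrDl// => /(_ isT) xM.
  rewrite -(addrK (n.+1%:R^-1 *: c) x) (le_trans (ler_normB _ _))// ltW//.
  rewrite (le_lt_trans _ Mr)// lerD// normrZ ler_piMl// ger0_norm ?invr_ge0//.
  by rewrite invf_le1// ler1n.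
have := bounded_lebesgue_fin (bigcup_measurable (fun n _ => mF n)) bU.
rewrite measure_bigcup//= (eq_eseriesr (g := fun=> lebesgue_rV d S)); last first.
  by move=> n _; exact: lebesgue_rV_shift.
set c0 := lebesgue_rV d S => fin.
have c0_ge0 : (0 <= c0)%E by exact: measure_ge0.
have le_total n : (n%:R%:E * c0 <= \big[+%E/0%E]_(0 <= i <oo) c0)%E.
  apply: le_trans (nneseries_lim_ge n _) => //.
  by rewrite sumr_const_nat subn0 mule_natl.
have c0fin : c0 \is a fin_num.
  rewrite ge0_fin_numE//; apply: le_lt_trans fin; rewrite -[leLHS]mul1e.
  apply: le_trans (le_total 1%N) _; rewrite le_eqVlt; apply/orP; left.
  by apply/eqP; apply: eq_eseriesl => n; rewrite in_setT.
apply/eqP; rewrite eq_le c0_ge0 andbT -(fineK c0fin) lee_fin leNgt; apply/negP => c0gt0.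
set tot := (X in (X < +oo)%E) in fin.
have totfin : tot \is a fin_num.
  by rewrite ge0_fin_numE//; apply: nneseries_ge0.
have : (Num.truncn (fine tot / fine c0)).+1%:R * fine c0 <= fine tot.
  rewrite -lee_fin EFinM !fineK// (_ : tot = \big[+%E/0%E]_(0 <= i <oo) c0)//.
  by apply: eq_eseriesl => n; rewrite in_setT.
by rewrite -ler_pdivlMr// leNgt truncnS_gt.
Qed.

End rowvectors.

Section integrals.
Context {d' : measure_display} {T : measurableType d'} {R : realType}.
Variable mu : {measure set T -> \bar R}.

Lemma bounded_integrable (D : set T) (f : T -> R) (C : R) :
  measurable D -> (mu D < +oo)%E -> measurable_fun D f ->
  (forall x, D x -> `|f x| <= C) -> mu.-integrable D (EFin \o f).
Proof.
move=> mD Dfin mf fC; apply: measurable_bounded_integrable => //.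
exists `|C|; split; first by rewrite num_real.
move=> M CM x Dx /=; apply: le_trans (fC _ Dx) _.
by rewrite (le_trans (ler_norm _))// ltW.
Qed.

Lemma dominated_cvg_Rintegral (D : set T) (f_ : nat -> T -> R) (f g : T -> R) :
  measurable D ->
  (forall n, measurable_fun D (f_ n)) -> measurable_fun D f ->
  mu.-integrable D (EFin \o g) ->
  (forall n x, D x -> `|f_ n x| <= g x) ->
  {ae mu, forall x, D x -> f_ ^~ x @ \oo --> f x} ->
  \int[mu]_(x in D) f_ n x @[n --> \oo] --> \int[mu]_(x in D) f x.
Proof.
move=> mD mf_ mf ig fg f_f.
have [|||||fi _] := @dominated_convergence _ _ _ mu D mD (fun n => EFin \o f_ n) (EFin \o f) (EFin \o g) => //.
- by move=> n; exact/measurable_EFinP.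
- exact/measurable_EFinP.
- apply: filterS f_f => x xf Dx; apply: cvg_EFin; last exact: xf.
  exact: nearW.
- by apply/aeW => x n Dx; rewrite /= lee_fin; exact: fg.
by rewrite -(fineK (integrable_fin_num mD fi)) => /fine_cvg.
Qed.

Lemma bounded_cvg_Rintegral (D : set T) (f_ : nat -> T -> R) (f : T -> R) (C : R) :
  measurable D -> (mu D < +oo)%E ->
  (forall n, measurable_fun D (f_ n)) -> measurable_fun D f ->
  (forall n x, D x -> `|f_ n x| <= C) ->
  {ae mu, forall x, D x -> f_ ^~ x @ \oo --> f x} ->
  \int[mu]_(x in D) f_ n x @[n --> \oo] --> \int[mu]_(x in D) f x.
Proof.
move=> mD Dfin mf_ mf fC; apply: (dominated_cvg_Rintegral (g := fun=> C)) => //.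
apply: (bounded_integrable (C := `|C|)) => //; exact: measurable_cst.
Qed.

Lemma Rintegral_support (D E : set T) (f : T -> R) :
  E `<=` D -> (forall x, D x -> ~ E x -> f x = 0) ->
  \int[mu]_(x in D) f x = \int[mu]_(x in E) f x.
Proof.
move=> ED fE0; rewrite Rintegral_mkcond [RHS]Rintegral_mkcond.
congr (Rintegral _ _ _); apply/funext => x; rewrite !patchE.
case: ifPn => [/set_mem Dx|/negP xD].
  by case: ifPn => // /negP xE; apply: fE0 => // Ex; apply: xE; exact/mem_set.
by case: ifPn => // /set_mem/ED Dx; exfalso; apply: xD; exact/mem_set.
Qed.

Lemma ae_eq_Rintegral (D : set T) (f g : T -> R) : measurable D ->
  measurable_fun D f -> measurable_fun D g ->
  {ae mu, forall x, D x -> f x = g x} ->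
  \int[mu]_(x in D) f x = \int[mu]_(x in D) g x.
Proof.
move=> mD mf mg fg; congr fine; apply: ae_eq_integral => //.
- exact/measurable_EFinP.
- exact/measurable_EFinP.
- by apply: filterS fg => x fgx Dx; rewrite fgx.
Qed.

End integrals.

Section shift_integral.
Context {R : realType} {d : nat}.
Let leb : {measure set 'rV[R]_d -> \bar R} := lebesgue_rV d.

Lemma Rintegral_shift (c : 'rV[R]_d) (f : 'rV[R]_d -> R) :
  measurable_fun setT f ->
  \int[leb]_x f (x + c) = \int[leb]_x f x.
Proof.
move=> mf.
pose m : {measure set 'rV[R]_d -> \bar R} :=
  measure_function_pushforward__canonical__measure_function_Measure
    leb (measurable_shift c).
have pos (h : 'rV[R]_d -> \bar R) : measurable_fun setT h -> (forall x, 0 <= h x)%E ->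
    (\int[leb]_x h (x + c)%R = \int[leb]_x h x)%E.
  move=> mh h0; transitivity (\int[m]_x h x)%E.
    rewrite (@ge0_integral_pushforward _ _ _ _ _ _ (measurable_shift c)) //.
  by apply: eq_measure_integral => A mA _; exact: lebesgue_rV_shift.
have mEf : measurable_fun setT (EFin \o f) by exact/measurable_EFinP.
congr fine; rewrite integralE [RHS]integralE; congr (_ - _)%E.
  have e := pos (EFin \o f)^\+%E (measurable_funepos mEf) (fun x => funepos_ge0 _ x).
  by rewrite -[RHS]e; apply: eq_integral => x _; rewrite !funeposE.
have e := pos (EFin \o f)^\-%E (measurable_funeneg mEf) (fun x => funeneg_ge0 _ x).
by rewrite -[RHS]e; apply: eq_integral => x _; rewrite !funenegE.
Qed.

End shift_integral.

(** * Differential calculus along coordinate directions *)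

Section epsilon_delta.
Context {R : realType} {d : nat}.
Implicit Types (x y : 'rV[R]_d) (f : 'rV[R]_d -> R).

Lemma nbhs_rVP x (P : set 'rV[R]_d) :
  nbhs x P <-> exists2 r : R, 0 < r & forall y, `|y - x| < r -> P y.
Proof.
split=> [/nbhs_ballP[r /= r0 xr]|[r r0 xr]].
  by exists r => // y yx; apply: xr; rewrite -ball_normE /= distrC.
apply/nbhs_ballP; exists r => //= y; rewrite -ball_normE /= distrC; exact: xr.
Qed.

Lemma open_rVP (D : set 'rV[R]_d) x : open D -> D x ->
  exists2 r : R, 0 < r & forall y, `|y - x| < r -> D y.
Proof. by rewrite openE => oD /oD /nbhs_rVP. Qed.

Lemma continuous_rVP f x : {for x, continuous f} <->
  forall e : R, 0 < e -> exists2 r : R, 0 < r & forall y, `|y - x| < r -> `|f y - f x| < e.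
Proof.
split=> [/cvgrPdist_lt fx e e0|fx].
  have /nbhs_rVP[r r0 xr] := fx _ e0.
  by exists r => // y /xr; rewrite distrC.
apply/(@cvgrPdist_lt _ _ _ (nbhs x)) => e e0; apply/nbhs_rVP.
by have [r r0 xr] := fx _ e0; exists r => // y /xr; rewrite distrC.
Qed.

Lemma lip_continuous_at f x (r C : R) : 0 < r ->
  (forall y, `|y - x| < r -> `|f y - f x| <= C * `|y - x|) -> {for x, continuous f}.
Proof.
move=> r0 fC; apply/continuous_rVP => e e0.
have C0 : 0 < `|C| + 1 by rewrite ltr_wpDl.
exists (Num.min r (e / (`|C| + 1))); first by rewrite lt_min r0 divr_gt0.
move=> y; rewrite lt_min => /andP[yr ye].
apply: le_lt_trans (fC y yr) _; apply: (@le_lt_trans _ _ ((`|C| + 1) * `|y - x|)).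
  by rewrite ler_wpM2r// (le_trans (ler_norm _))// lerDl.
by rewrite mulrC -ltr_pdivlMr.
Qed.

Lemma continuous_rV_cst x (c : R) : {for x, continuous (fun _ : 'rV[R]_d => c)}.
Proof. by apply/continuous_rVP => e e0; exists 1 => // y _; rewrite subrr normr0. Qed.

Lemma continuous_rVD f g x : {for x, continuous f} -> {for x, continuous g} ->
  {for x, continuous (fun y => f y + g y)}.
Proof. by move=> cf cg; exact: (@cvgD _ _ _ (nbhs x) _ f g _ _ cf cg). Qed.

Lemma continuous_rVM f g x : {for x, continuous f} -> {for x, continuous g} ->
  {for x, continuous (fun y => f y * g y)}.
Proof. by move=> cf cg; exact: (@cvgM _ _ (nbhs x) _ f g _ _ cf cg). Qed.

Lemma continuous_rV_comp f (g : R -> R) x : {for x, continuous f} -> {for f x, continuous g} ->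
  {for x, continuous (fun y => g (f y))}.
Proof. by move=> cf cg; exact: (@continuous_comp _ _ _ f g x cf cg). Qed.

End epsilon_delta.

Lemma growth_line (R : realType) (d : nat) (f : 'rV[R]_d -> R) p v (s : R) :
  (fun h : R => h^-1 *: (((fun t : R => f (p + t *: v)) \o shift s) (h *: (1 : R)) - f (p + s *: v))) =
  (fun h : R => h^-1 *: ((f \o shift (p + s *: v)) (h *: v) - f (p + s *: v))).
Proof.
apply/funext => h /=; congr (_ *: (f _ - _)).
by rewrite [h *: 1]mulr1 scalerDl addrCA.
Qed.

Section lines.
Context {R : realType} {d : nat}.
Implicit Types (x y p v : 'rV[R]_d) (f : 'rV[R]_d -> R).

Lemma is_derive_line f p v (s : R) df :
  is_derive (p + s *: v) v f df <-> is_derive s (1 : R) (fun t : R => f (p + t *: v)) df.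
Proof.
have E := growth_line f p v s.
split => -[df1 df2]; split.
- by rewrite /derivable E.
- by rewrite /derive E.
- by rewrite /derivable -E.
- by rewrite /derive -E.
Qed.

Lemma is_derive_comp1 f (g : R -> R) x v df dg :
  is_derive x v f df -> is_derive (f x) (1 : R) g dg ->
  is_derive x v (g \o f) (dg * df).
Proof.
move=> fd gd; rewrite -[x]addr0 -(scale0r v); apply/is_derive_line.
apply: (@is_derive1_comp _ g (fun t : R => f (x + t *: v))).
  by rewrite scale0r addr0.
by apply/is_derive_line; rewrite scale0r addr0.
Qed.

Lemma MVT_line f p v (a b : R) : a <= b ->
  (forall s, a <= s <= b -> derivable f (p + s *: v) v) ->
  exists2 c, a <= c <= b &
    f (p + b *: v) - f (p + a *: v) = 'D_v f (p + c *: v) * (b - a).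
Proof.
move=> ab fd.
have ld s : a <= s <= b -> is_derive s (1 : R) (fun t : R => f (p + t *: v)) ('D_v f (p + s *: v)).
  by move=> sab; apply/is_derive_line/derivableP/fd.
have [||c cab fE] := @MVT_segment R (fun t : R => f (p + t *: v)) (fun s => 'D_v f (p + s *: v)) a b ab.
- by move=> s; rewrite in_itv /= => /andP[sa sb]; apply: ld; rewrite !ltW.
- apply: derivable_within_continuous => s; rewrite in_itv /= => sab.
  by have [] := ld s sab.
- by exists c; move: cab; rewrite ?in_itv.
Qed.

Lemma derive_bound_lip f p v (t C : R) :
  (forall s, `|s| <= `|t| -> 0 <= s * t -> derivable f (p + s *: v) v /\ `|'D_v f (p + s *: v)| <= C) ->
  `|f (p + t *: v) - f p| <= C * `|t|.
Proof.
move=> fC; have [t0|/ltW t0] := leP 0 t.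
  have [|c cab] := @MVT_line f p v 0 t t0.
    move=> s /andP[s0 st]; apply: (fC s _ _).1; last by rewrite mulr_ge0.
    by rewrite !ger0_norm.
  rewrite scale0r addr0 subr0 => ->; rewrite normrM ler_wpM2r//.
  case/andP : cab => c0 ct; apply: (fC c _ _).2; last by rewrite mulr_ge0.
  by rewrite !ger0_norm.
have [|c cab] := @MVT_line f p v t 0 t0.
  move=> s /andP[st s0]; apply: (fC s _ _).1; last by rewrite mulr_le0.
  by rewrite !ler0_norm// lerN2.
rewrite scale0r addr0 sub0r => fE; rewrite distrC fE normrM normrN ler_wpM2r//.
case/andP : cab => ct c0; apply: (fC c _ _).2; last by rewrite mulr_le0.
by rewrite !ler0_norm// lerN2.
Qed.

Definition box_path x y (k : nat) : 'rV[R]_d := \row_j (if (j < k)%N then y 0 j else x 0 j).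

Lemma box_pathS x y (k : 'I_d) :
  box_path x y k.+1 = box_path x y k + (y 0 k - x 0 k) *: unitv k.
Proof.
apply/rowP => j; rewrite !mxE eqxx /= ltnS leq_eqVlt.
have [jk|jk] := eqVneq j k.
  by rewrite jk eqxx ltnn /= mulr1 addrC subrK.
by rewrite mulr0 addr0 (_ : (j == k :> nat) = false) //; exact/negbTE.
Qed.

(** Moving one coordinate at a time stays in the ball, for the maximum norm. *)
Lemma partials_lip f x0 (r C : R) : 0 <= C ->
  (forall y, ball x0 r y -> forall j, derivable f y (unitv j) /\ `|'D_(unitv j) f y| <= C) ->
  forall x y, ball x0 r x -> ball x0 r y -> `|f y - f x| <= d%:R * C * `|y - x|.
Proof.
move=> C0 fC x y xr yr.
have fE : f y - f x = \sum_(k < d) (f (box_path x y k.+1) - f (box_path x y k)).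
  rewrite -(big_mkord xpredT (fun k => f (box_path x y k.+1) - f (box_path x y k))).
  rewrite telescope_sumr//; congr (f _ - f _); apply/rowP => j; rewrite mxE.
    by rewrite ltn_ord.
  by rewrite ltn0.
rewrite fE (le_trans (ler_norm_sum _ _ _))//.
have -> : d%:R * C * `|y - x| = \sum_(k < d) C * `|y - x|.
  by rewrite sumr_const card_ord -mulrA mulr_natl.
apply: ler_sum => k _.
rewrite box_pathS; apply: (@le_trans _ _ (C * `|y 0 k - x 0 k|)); last first.
  by rewrite ler_wpM2l//; have := coord_le_norm (y - x) k; rewrite !mxE.
apply: derive_bound_lip => s sle s0; apply: fC.
move: xr yr; rewrite -!ball_normE /= => xr yr.
have r0 : 0 < r by apply: le_lt_trans xr.
apply: norm_lt_coord => // j.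
have xj := le_lt_trans (coord_le_norm _ j) xr; have yj := le_lt_trans (coord_le_norm _ j) yr.
move: xj yj; rewrite !mxE eqxx /= => xj yj.
have [jk|jk] := eqVneq j k; last first.
  by rewrite mulr0 addr0; case: ifP.
rewrite jk ltnn mulr1; move: xj yj; rewrite jk => xj yj.
move: sle s0 xj yj; rewrite !ltr_norml.
have [t0|t0] := leP 0 (y 0 k - x 0 k).
  rewrite (ger0_norm t0) ler_norml => /andP[s1 s2] st /andP[? ?] /andP[? ?].
  have s0 : 0 <= s by nra.
  by apply/andP; split; lra.
rewrite (ltr0_norm t0) ler_norml => /andP[s1 s2] st /andP[? ?] /andP[? ?].
have s0 : s <= 0 by nra.
by apply/andP; split; lra.
Qed.

Lemma C1_on_continuous (D : set 'rV[R]_d) f x : open D -> C1_on D f -> D x ->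
  {for x, continuous f}.
Proof.
move=> oD fC1 Dx.
have nD : \forall y \near x, D y by move: oD; rewrite openE => /(_ _ Dx).
pose C := \sum_(j < d) (`|'D_(unitv j) f x| + 1).
have nC : \forall y \near x, forall j, `|'D_(unitv j) f y| <= C.
  apply: (@filter_forall _ _ (fun j (y : 'rV[R]_d) => `|'D_(unitv j) f y| <= C) (nbhs x)) => j.
  have [_ /cvgrPdist_le /(_ 1 ltr01)] := fC1 x Dx j.
  apply: filterS => y fyx; rewrite /C (bigD1 j)//=.
  rewrite (@le_trans _ _ (`|'D_(unitv j) f x| + 1))//; last first.
    by rewrite lerDl sumr_ge0// => i _; rewrite addr_ge0.
  rewrite -[X in `|X|](subrK ('D_(unitv j) f x)) addrC (le_trans (ler_normD _ _))//.
  by rewrite lerD2l distrC.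
have : \forall y \near x, D y /\ forall j, `|'D_(unitv j) f y| <= C by apply: filterI.
move/nbhs_rVP => [r r0 xr].
apply: (@lip_continuous_at _ _ f x r (d%:R * C)) => // y yr.
apply: (@partials_lip f x r C) => //.
- by rewrite sumr_ge0// => i _; rewrite addr_ge0.
- move=> z; rewrite -ball_normE /= distrC => /xr[Dz zC] j; split; last exact: zC.
  by have [] := fC1 z Dz j.
- exact: ballxx.
- by rewrite -ball_normE /= distrC.
Qed.

Lemma C1_on_intro (D : set 'rV[R]_d) f (G : 'I_d -> 'rV[R]_d -> R) : open D ->
  (forall x j, D x -> is_derive x (unitv j) f (G j x)) ->
  (forall x j, D x -> {for x, continuous (G j)}) -> C1_on D f.
Proof.
move=> oD fG cG x Dx j; split; first by have [] := fG x j Dx.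
have GE y : D y -> 'D_(unitv j) f y = G j y by move=> Dy; have [] := fG y j Dy.
apply/continuous_rVP => e e0.
have /continuous_rVP/(_ e e0)[r r0 xr] := cG x j Dx.
have [r' r'0 xr'] := open_rVP oD Dx.
exists (Num.min r r'); first by rewrite lt_min r0.
move=> y; rewrite lt_min => /andP[yr yr'].
rewrite -!/(unitv _) !GE//; [exact: xr|exact: xr'].
Qed.

Lemma C1_on_comp (D : set 'rV[R]_d) f (g dg : R -> R) : open D ->
  (forall s, is_derive s (1 : R) g (dg s)) -> continuous dg -> C1_on D f ->
  C1_on D (g \o f) /\ forall x j, D x -> is_derive x (unitv j) (g \o f) (dg (f x) * 'D_(unitv j) f x).
Proof.
move=> oD gd cdg fC1.
have D1 x j : D x -> is_derive x (unitv j) (g \o f) (dg (f x) * 'D_(unitv j) f x).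
  by move=> Dx; apply: is_derive_comp1 => //; apply/derivableP; have [] := fC1 x Dx j.
split => //; apply: (C1_on_intro oD D1) => x j Dx.
apply: continuous_rVM; last by have [] := fC1 x Dx j.
by apply: continuous_rV_comp; [exact: C1_on_continuous Dx|exact: cdg].
Qed.

Lemma C1_onM (D : set 'rV[R]_d) f g : open D -> C1_on D f -> C1_on D g ->
  C1_on D (fun x => f x * g x) /\ forall x j, D x ->
    is_derive x (unitv j) (fun x => f x * g x) (f x * 'D_(unitv j) g x + g x * 'D_(unitv j) f x).
Proof.
move=> oD fC1 gC1.
have D1 x j : D x -> is_derive x (unitv j) (fun x => f x * g x)
    (f x * 'D_(unitv j) g x + g x * 'D_(unitv j) f x).
  move=> Dx; apply: is_deriveM.
    by apply/derivableP; have [] := fC1 x Dx j.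
  by apply/derivableP; have [] := gC1 x Dx j.
split => //; apply: (C1_on_intro oD D1) => x j Dx.
apply: continuous_rVD; apply: continuous_rVM.
- exact: C1_on_continuous Dx.
- by have [] := gC1 x Dx j.
- exact: C1_on_continuous Dx.
- by have [] := fC1 x Dx j.
Qed.

Lemma C1_on_cst (D : set 'rV[R]_d) (c : R) : C1_on D (fun=> c).
Proof.
move=> x _ j; split; first exact: derivable_cst.
rewrite (_ : 'D__ _ = fun=> 0); first exact: continuous_rV_cst.
by apply/funext => y; rewrite derive_cst.
Qed.

Lemma is_derive_coord x i j : is_derive x (unitv j) (fun y : 'rV[R]_d => y 0 i) (i == j)%:R.
Proof.
rewrite -[x]addr0 -(scale0r (unitv j)); apply/is_derive_line.
rewrite (_ : (fun t => _) = fun t : R => x 0 i + t * (i == j)%:R); last first.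
  by apply/funext => t; rewrite !mxE eqxx.
by apply: is_derive_eq; rewrite add0r scaler0 add0r /GRing.scale /= ?mulr1 ?mul1r.
Qed.

Lemma C1_on_coord (D : set 'rV[R]_d) i : open D -> C1_on D (fun y : 'rV[R]_d => y 0 i).
Proof.
move=> oD; apply: (C1_on_intro oD (fun x j _ => is_derive_coord x i j)) => x j _.
exact: continuous_rV_cst.
Qed.

Lemma C1_on_prod (D : set 'rV[R]_d) (I : Type) (s : seq I) (F : I -> 'rV[R]_d -> R) : open D ->
  (forall i, C1_on D (F i)) -> C1_on D (fun x => \prod_(i <- s) F i x).
Proof.
move=> oD FC; elim: s => [|i s IHs].
  by rewrite (_ : (fun x => _) = fun=> 1); [exact: C1_on_cst|apply/funext => x; rewrite big_nil].
rewrite (_ : (fun x => _) = fun x => F i x * \prod_(i <- s) F i x); last first.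
  by apply/funext => x; rewrite big_cons.
by have [] := C1_onM oD (FC i) IHs.
Qed.

End lines.

(** * Square integrable functions and test functions *)

Section L2.
Context {R : realType} {d : nat}.
Implicit Types (O D : set 'rV[R]_d) (f g : 'rV[R]_d -> R).
Let leb : {measure set 'rV[R]_d -> \bar R} := lebesgue_rV d.

Lemma continuous_measurable_rV D f : open D ->
  (forall x, D x -> {for x, continuous f}) -> measurable_fun D f.
Proof.
move=> oD cf; apply: (measurability _ (RGenInftyO.measurableE R)).
move=> _ [_ [b ->] <-]; apply: open_measurable_rV.
rewrite openE => x [Dx /=]; rewrite in_itv /= => fxb.
have [r r0 xr] := open_rVP oD Dx.
have /continuous_rVP/(_ (b - f x)) := cf x Dx.
rewrite subr_gt0 => /(_ fxb)[r' r'0 xr'].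
suff : nbhs x (D `&` f @^-1` `]-oo, b[) by [].
apply/nbhs_rVP; exists (Num.min r r'); first by rewrite lt_min r0.
move=> y; rewrite lt_min => /andP[/xr Dy /xr' fy]; split => //=.
rewrite in_itv /=; move: fy; rewrite ltr_norml; lra.
Qed.

Lemma bounded_open_fin O : open O -> bounded_set O -> (leb O < +oo)%E.
Proof. by move=> oO bO; apply: bounded_lebesgue_fin => //; exact: open_measurable_rV. Qed.

Lemma bounded_L2 O f (C : R) : measurable O -> (leb O < +oo)%E ->
  measurable_fun O f -> (forall x, O x -> `|f x| <= C) -> L2 O f.
Proof.
move=> mO Ofin mf fC; split => //.
apply: (@le_lt_trans _ _ (\int[leb]_(x in O) `|(f x ^+ 2)%:E|)%E).
  apply: ge0_le_integral => //.
  - by move=> x _; rewrite lee_fin sqr_ge0.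
  - by apply/measurable_EFinP; exact: measurable_funX.
  - by apply: measurableT_comp => //; apply/measurable_EFinP; exact: measurable_funX.
  - by move=> x _; exact: lee_abs.
have : leb.-integrable O (EFin \o (fun x => f x ^+ 2)).
  apply: (bounded_integrable (C := C ^+ 2)) => //; first exact: measurable_funX.
  by move=> x /fC fx; rewrite normrX lerXn2r ?nnegrE// (le_trans _ fx).
by case/integrableP.
Qed.

Lemma L2_sqr_integrable O f : measurable O -> L2 O f ->
  leb.-integrable O (EFin \o (fun x => f x ^+ 2)).
Proof.
move=> mO [mf fi]; apply/integrableP; split.
  by apply/measurable_EFinP; exact: measurable_funX.
rewrite (eq_integral (fun x => (f x ^+ 2)%:E))// => x _ /=.
by rewrite ger0_norm ?sqr_ge0.
Qed.

Lemma L2_mul_integrable O f g : measurable O -> L2 O f -> L2 O g ->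
  leb.-integrable O (EFin \o (fun x => f x * g x)).
Proof.
move=> mO f2 g2; have [mf _] := f2; have [mg _] := g2.
apply: (le_integrable mO _ _ (integrableD mO (L2_sqr_integrable mO f2) (L2_sqr_integrable mO g2))).
  by apply/measurable_EFinP; exact: measurable_funM.
move=> x _ /=; rewrite lee_fin [leRHS]ger0_norm ?addr_ge0 ?sqr_ge0// ler_norml.
by apply/andP; split; nra.
Qed.

Lemma L2_lin O f g (c : R) : measurable O -> L2 O f -> L2 O g ->
  L2 O (fun x => c * f x + g x).
Proof.
move=> mO f2 g2; have [mf _] := f2; have [mg _] := g2.
have mcf : measurable_fun O (fun x => c * f x + g x).
  by apply: measurable_funD => //; exact: measurable_funM.
split => //.
have i1 := integrableD mO (integrableZl mO (2 * c ^+ 2) (L2_sqr_integrable mO f2))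
   (integrableZl mO 2 (L2_sqr_integrable mO g2)).
have /integrableP[_] : leb.-integrable O (EFin \o (fun x => (c * f x + g x) ^+ 2)).
  apply: (le_integrable mO _ _ i1).
    by apply/measurable_EFinP; exact: measurable_funX.
  move=> x _ /=; rewrite lee_fin [leRHS]ger0_norm; last first.
    by have := sqr_ge0 (c * f x); have := sqr_ge0 (g x); rewrite exprMn; lra.
  by rewrite ger0_norm ?sqr_ge0//; have := sqr_ge0 (c * f x - g x); nra.
by rewrite (eq_integral (fun x => ((c * f x + g x) ^+ 2)%:E))// => x _ /=; rewrite ger0_norm ?sqr_ge0.
Qed.

Lemma L2S O O' f : measurable O -> measurable O' -> O' `<=` O -> L2 O f -> L2 O' f.
Proof.
move=> mO mO' O'O [mf fi]; split; first exact: measurable_funS mf.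
apply: le_lt_trans fi; apply: ge0_subset_integral => //.
  by apply/measurable_EFinP; exact: measurable_funX.
by move=> x _; rewrite lee_fin sqr_ge0.
Qed.

Lemma L2_eq O f g : {in O, f =1 g} -> L2 O f -> L2 O g.
Proof.
move=> fg [mf fi]; split; first exact: eq_measurable_fun mf.
by rewrite (eq_integral (fun x => (f x ^+ 2)%:E))// => x Ox; rewrite fg.
Qed.

Lemma L2_integrable O f : measurable O -> (leb O < +oo)%E -> L2 O f ->
  leb.-integrable O (EFin \o f).
Proof.
move=> mO Ofin f2.
have c2 : L2 O (fun=> 1) by apply: (bounded_L2 (C := 1)) => // x _; rewrite normr1.
have := L2_mul_integrable mO f2 c2.
by rewrite (_ : (fun x => _) = f)//; apply/funext => x; rewrite mulr1.
Qed.

Lemma L2_bounded_mul O f g (C : R) : measurable O -> L2 O f -> measurable_fun O g ->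
  (forall x, O x -> `|g x| <= C) -> L2 O (fun x => g x * f x).
Proof.
move=> mO f2 mg gC; have [mf _] := f2.
have mgf : measurable_fun O (fun x => g x * f x) by exact: measurable_funM.
split => //.
have /integrableP[_] : leb.-integrable O (EFin \o (fun x => (g x * f x) ^+ 2)).
  apply: (le_integrable mO _ _ (integrableZl mO (C ^+ 2) (L2_sqr_integrable mO f2))).
    by apply/measurable_EFinP; exact: measurable_funX.
  move=> x Ox /=; rewrite lee_fin.
  have C0 : 0 <= C by rewrite (le_trans _ (gC _ Ox)).
  rewrite [leRHS]ger0_norm; last by rewrite mulr_ge0// sqr_ge0.
  rewrite ger0_norm ?sqr_ge0// exprMn ler_wpM2r ?sqr_ge0//.
  by rewrite -real_normK ?num_real// lerXn2r ?nnegrE ?gC.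
by rewrite (eq_integral (fun x => ((g x * f x) ^+ 2)%:E))// => x _ /=; rewrite ger0_norm ?sqr_ge0.
Qed.

End L2.

Section test_functions.
Context {R : realType} {d : nat}.
Implicit Types (O K : set 'rV[R]_d) (f phi psi : 'rV[R]_d -> R).

Lemma gradientE f x j : gradient f x 0 j = 'D_(unitv j) f x.
Proof. by rewrite mxE. Qed.

Lemma compact_continuous_bounded K f : compact K -> (forall x, K x -> {for x, continuous f}) ->
  exists C : R, forall x, K x -> `|f x| <= C.
Proof.
move=> cK cf.
have /compact_bounded[M [_ fM]] : compact (f @` K).
  apply: continuous_compact cK; apply: continuous_in_subspaceT => x /set_mem Kx; exact: cf.
exists (`|M| + 1) => x Kx; apply: fM; last by exists x.
by rewrite (le_lt_trans (ler_norm _))// ltrDl.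
Qed.

Lemma near_zero_derive f x v : (\forall y \near x, f y = 0) -> is_derive x v f 0.
Proof.
move=> fx; apply: (@near_eq_is_derive _ _ _ (cst (0 : R)) f).
by apply: filterS fx => y ->.
Qed.

Lemma compl_compact_near K x : compact K -> ~ K x -> \forall y \near x, ~ K y.
Proof.
move=> cK Kx; have : open (~` K) by apply: closed_openC; exact: compact_closed.
by rewrite openE => /(_ _ Kx).
Qed.

(** The partial derivatives vanish on the complement of the compact set, which
    is open, so that they are continuous everywhere. *)
Lemma test_function_intro O K f : open O -> C1_on O f -> compact K -> K `<=` O ->
  (forall x, ~ K x -> f x = 0) -> test_function O f.
Proof.
move=> oO fC1 cK KO fK; split; last by exists K.
move=> x _ j.
have [Kx|Kx] := pselect (K x); first by apply: fC1; exact: KO.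
have f0 y : ~ K y -> is_derive y (unitv j) f 0.
  move=> Ky; apply: near_zero_derive; apply: filterS (compl_compact_near cK Ky) => z; exact: fK.
split; first by have [] := f0 x Kx.
apply/continuous_rVP => e e0.
have /nbhs_rVP[r r0 xr] := compl_compact_near cK Kx.
exists r => // y /xr Ky.
have [_ ->] := f0 x Kx; have [_ ->] := f0 y Ky.
by rewrite subrr normr0.
Qed.

Lemma test_functionM O phi psi : open O -> test_function O phi -> C1_on O psi ->
  test_function O (fun x => phi x * psi x).
Proof.
move=> oO [phi1 [K [cK KO phiK]]] psi1.
apply: (@test_function_intro O K) => //.
  have phiO : C1_on O phi by move=> x _; exact: phi1.
  by have [] := C1_onM oO phiO psi1.
by move=> x /phiK ->; rewrite mul0r.
Qed.

Lemma test_functionS O O' phi : O' `<=` O -> test_function O' phi -> test_function O phi.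
Proof.
move=> O'O [phi1 [K [cK KO phiK]]]; split => //.
by exists K; split => //; exact: subset_trans O'O.
Qed.

Lemma test_functionP O phi : test_function O phi ->
  exists K (C : R), [/\ compact K, K `<=` O,
    forall x, ~ K x -> phi x = 0 /\ forall j, gradient phi x 0 j = 0 &
    forall x, `|phi x| <= C /\ forall j, `|gradient phi x 0 j| <= C].
Proof.
move=> [phi1 [K [cK KO phiK]]].
have phi0 x : ~ K x -> phi x = 0 /\ forall j, gradient phi x 0 j = 0.
  move=> Kx; split => [|j]; first exact: phiK.
  have [|_ <-] := @near_zero_derive phi x (unitv j); last by rewrite gradientE.
  by apply: filterS (compl_compact_near cK Kx) => z; exact: phiK.
have [C0 phiC] : exists C, forall x, K x -> `|phi x| <= C.
  apply: compact_continuous_bounded cK _ => x _.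
  by apply: (C1_on_continuous openT) => //; exact: phi1.
have /choice[C1 gradC] : forall j, exists C, forall x, K x -> `|gradient phi x 0 j| <= C.
  move=> j; have [|C CP] := @compact_continuous_bounded K ('D_(unitv j) phi) cK.
    by move=> x _; have [] := phi1 x I j.
  by exists C => x Kx; rewrite gradientE; exact: CP.
exists K, (`|C0| + \sum_j `|C1 j|); split => // x.
have [Kx|/phi0[-> g0]] := pselect (K x); last first.
  split=> [|j]; rewrite ?g0 normr0 addr_ge0 ?sumr_ge0//.
split=> [|j].
  by rewrite (le_trans (phiC _ Kx))// (le_trans (ler_norm _))// lerDl sumr_ge0.
rewrite (le_trans (gradC _ _ Kx))// (le_trans (ler_norm _))// (bigD1 j)//= addrCA.
by rewrite lerDl addr_ge0// sumr_ge0.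
Qed.

Lemma test_function_measurable O phi : test_function O phi ->
  measurable_fun setT phi /\ forall j, measurable_fun setT (fun x => gradient phi x 0 j).
Proof.
move=> [phi1 _]; split => [|j].
  apply: continuous_measurable_rV; first exact: openT.
  by move=> x _; apply: (C1_on_continuous openT).
apply: continuous_measurable_rV; first exact: openT.
move=> x _; rewrite (_ : (fun x => _) = 'D_(unitv j) phi).
  by have [] := phi1 x I j.
by apply/funext => y; rewrite gradientE.
Qed.

End test_functions.

(** * Calculus of weak gradients *)

Section weak_gradients.
Context {R : realType} {d : nat}.
Implicit Types (O D K : set 'rV[R]_d) (u v phi psi : 'rV[R]_d -> R).
Implicit Types (G H : 'rV[R]_d -> 'rV[R]_d).
Let leb : {measure set 'rV[R]_d -> \bar R} := lebesgue_rV d.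

Lemma is_weak_gradient_eq O u v G : {in O, u =1 v} ->
  is_weak_gradient O u G -> is_weak_gradient O v G.
Proof.
move=> uv [GL2 Gu]; split => // f tf j; rewrite -Gu//.
by apply: eq_Rintegral => x Ox; rewrite uv.
Qed.

Lemma is_weak_gradient_eqG O u G H : {in O, G =1 H} ->
  is_weak_gradient O u G -> is_weak_gradient O u H.
Proof.
move=> GH [GL2 Gu]; split=> [j|f tf j].
  by apply: L2_eq (GL2 j) => x Ox; rewrite GH.
rewrite Gu//; congr (- _); apply: eq_Rintegral => x Ox; by rewrite GH.
Qed.

Lemma wgrad_eq O u v : {in O, u =1 v} -> wgrad O u = wgrad O v.
Proof.
move=> uv; rewrite /wgrad; congr (xget _ _); apply/seteqP; split => G /=.
  exact: is_weak_gradient_eq.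
by apply: is_weak_gradient_eq => x Ox; rewrite uv.
Qed.

Lemma wgradP O u : H1 O u -> is_weak_gradient O u (wgrad O u).
Proof. by move=> [_ [G GP]]; rewrite /wgrad; case: xgetP => [H -> //|/(_ G)]. Qed.

Lemma is_weak_gradient_sub O O' u G : open O -> open O' -> O' `<=` O ->
  is_weak_gradient O u G -> is_weak_gradient O' u G.
Proof.
move=> oO oO' O'O [GL2 Gu].
have [mO mO'] := (open_measurable_rV oO, open_measurable_rV oO').
split=> [j|f tf j]; first exact: L2S (GL2 j).
have [K [C [_ KO' fK _]]] := test_functionP tf.
have := Gu f (test_functionS O'O tf) j.
rewrite (@Rintegral_support _ _ _ leb O O')//; last first.
  by move=> x _ xO'; have [|_ ->] := fK x; [move/KO'|rewrite mulr0].
move=> ->; congr (- _); apply: Rintegral_support => // x _ xO'.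
by have [|-> _] := fK x; [move/KO'|rewrite mulr0].
Qed.

Lemma test_mul_integrable O u phi : open O -> bounded_set O -> L2 O u -> test_function O phi ->
  leb.-integrable O (EFin \o (fun x => u x * phi x)) /\
  forall j, leb.-integrable O (EFin \o (fun x => u x * gradient phi x 0 j)).
Proof.
move=> oO bO u2 tphi; have mO := open_measurable_rV oO.
have Ofin := bounded_open_fin oO bO.
have [mphi mgphi] := test_function_measurable tphi.
have [K [C [_ _ _ phiC]]] := test_functionP tphi.
split=> [|j]; apply: L2_mul_integrable => //.
  apply: (bounded_L2 (C := C)) => //; first exact: measurable_funS mphi.
  by move=> x _; have [] := phiC x.
apply: (bounded_L2 (C := C)) => //; first exact: measurable_funS (mgphi j).
by move=> x _; have [] := phiC x.
Qed.

Lemma is_weak_gradient_lin O u v G H (c : R) : open O -> bounded_set O ->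
  L2 O u -> L2 O v -> is_weak_gradient O u G -> is_weak_gradient O v H ->
  is_weak_gradient O (fun x => c * u x + v x) (fun x => c *: G x + H x).
Proof.
move=> oO bO u2 v2 [GL2 Gu] [HL2 Hv]; have mO := open_measurable_rV oO.
split=> [j|f tf j].
  by apply: (L2_eq (f := fun x => c * G x 0 j + H x 0 j)); [move=> x _; rewrite !mxE|exact: L2_lin].
have [_ /(_ j) iu] := test_mul_integrable oO bO u2 tf.
have [_ /(_ j) iv] := test_mul_integrable oO bO v2 tf.
have [iG _] := test_mul_integrable oO bO (GL2 j) tf.
have [iH _] := test_mul_integrable oO bO (HL2 j) tf.
transitivity (\int[leb]_(x in O) (c * (u x * gradient f x 0 j) + v x * gradient f x 0 j)).
  by apply: eq_Rintegral => x _; ring.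
rewrite RintegralD//; last exact: (integrableZl mO c iu).
rewrite RintegralZl// Gu// Hv//.
have -> : \int[leb]_(x in O) ((c *: G x + H x) 0 j * f x) =
    \int[leb]_(x in O) (c * (G x 0 j * f x) + H x 0 j * f x).
  by apply: eq_Rintegral => x _; rewrite !mxE; ring.
rewrite RintegralD//; last exact: (integrableZl mO c iG).
by rewrite RintegralZl//; ring.
Qed.

Lemma H1_lin O u v (c : R) : open O -> bounded_set O -> H1 O u -> H1 O v ->
  H1 O (fun x => c * u x + v x).
Proof.
move=> oO bO [u2 [G Gu]] [v2 [H Hv]]; split; first exact: L2_lin (open_measurable_rV oO) u2 v2.
by exists (fun x => c *: G x + H x); exact: is_weak_gradient_lin.
Qed.

Lemma H1_eq O u v : {in O, u =1 v} -> H1 O u -> H1 O v.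
Proof.
move=> uv [u2 [G Gu]]; split; first exact: L2_eq u2.
by exists G; exact: is_weak_gradient_eq Gu.
Qed.

Lemma H1_sub O O' u : open O -> open O' -> O' `<=` O -> H1 O u -> H1 O' u.
Proof.
move=> oO oO' O'O [u2 [G Gu]]; split; last by exists G; exact: is_weak_gradient_sub Gu.
by apply: L2S u2 => //; exact: open_measurable_rV.
Qed.

(** By dominated convergence on both sides of the defining identity. *)
Lemma is_weak_gradient_lim O (u_ : nat -> 'rV[R]_d -> R) (G_ : nat -> 'rV[R]_d -> 'rV[R]_d) u G (C : R) :
  open O -> bounded_set O ->
  (forall n, measurable_fun O (u_ n)) -> (forall n x, O x -> `|u_ n x| <= C) ->
  (forall n x j, O x -> `|G_ n x 0 j| <= C) ->
  (forall n, is_weak_gradient O (u_ n) (G_ n)) ->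
  (forall x, O x -> u_ ^~ x @ \oo --> u x) ->
  (forall x j, O x -> (fun n => G_ n x 0 j) @ \oo --> G x 0 j) ->
  is_weak_gradient O u G.
Proof.
move=> oO bO mu_ uC GC wG u_u G_G; have mO := open_measurable_rV oO.
have Ofin := bounded_open_fin oO bO.
have mG j : measurable_fun O (fun x => G x 0 j).
  apply: (measurable_fun_cvg (h := fun n x => G_ n x 0 j)) => [n|x Ox]; last exact: G_G.
  by have [/(_ j) []] := wG n.
have mu : measurable_fun O u by exact: measurable_fun_cvg u_u.
split=> [j|f tf j].
  apply: (bounded_L2 (C := C)) => // x Ox.
  have cG : (fun n => `|G_ n x 0 j|) @ \oo --> `|G x 0 j| by apply: cvg_norm; exact: G_G.
  rewrite -(cvg_lim _ cG)//; apply: limr_le; first by apply/cvg_ex; exists `|G x 0 j|.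
  by apply: nearW => n; exact: GC.
have [mf mgf] := test_function_measurable tf.
have [K [Cf [_ _ _ fC]]] := test_functionP tf.
have mfO := measurable_funS measurableT (@subsetT _ O) mf.
have mgfO := measurable_funS measurableT (@subsetT _ O) (mgf j).
have cu : (fun n => \int[leb]_(x in O) (u_ n x * gradient f x 0 j)) @ \oo -->
    \int[leb]_(x in O) (u x * gradient f x 0 j).
  apply: (bounded_cvg_Rintegral (C := C * Cf)) => //.
  - by move=> n; exact: measurable_funM.
  - exact: measurable_funM.
  - by move=> n x Ox; rewrite normrM ler_pM// ?uC//; have [_ ->] := fC x.
  - by apply/aeW => x Ox; apply: cvgMl; exact: u_u.
have cG : (fun n => - \int[leb]_(x in O) (G_ n x 0 j * f x)) @ \oo -->
    - \int[leb]_(x in O) (G x 0 j * f x).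
  apply: cvgN; apply: (bounded_cvg_Rintegral (C := C * Cf)) => //.
  - by move=> n; apply: measurable_funM => //; have [/(_ j) []] := wG n.
  - exact: measurable_funM.
  - by move=> n x Ox; rewrite normrM ler_pM// ?GC//; have [-> _] := fC x.
  - by apply/aeW => x Ox; apply: cvgMl; exact: G_G.
have e : (fun n => \int[leb]_(x in O) (u_ n x * gradient f x 0 j)) =
    fun n => - \int[leb]_(x in O) (G_ n x 0 j * f x).
  by apply/funext => n; have [_ ->] := wG n.
by rewrite e in cu; exact: (cvg_unique _ cu cG).
Qed.

(** The product of psi with a test function is one: use it for u. *)
Lemma is_weak_gradientM O u psi G (C : R) : open O -> bounded_set O ->
  L2 O u -> is_weak_gradient O u G -> C1_on O psi ->
  (forall x, O x -> `|psi x| <= C /\ forall j, `|gradient psi x 0 j| <= C) ->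
  is_weak_gradient O (fun x => psi x * u x) (fun x => psi x *: G x + u x *: gradient psi x).
Proof.
move=> oO bO u2 [GL2 Gu] psi1 psiC; have mO := open_measurable_rV oO.
have mpsi : measurable_fun O psi.
  by apply: continuous_measurable_rV => // x Ox; exact: C1_on_continuous Ox.
have mgpsi j : measurable_fun O (fun x => gradient psi x 0 j).
  apply: continuous_measurable_rV => // x Ox.
  rewrite (_ : (fun x => _) = 'D_(unitv j) psi); first by have [] := psi1 x Ox j.
  by apply/funext => y; rewrite gradientE.
have psiu2 : L2 O (fun x => psi x * u x).
  by apply: (L2_bounded_mul (C := C) mO u2 mpsi) => x /psiC[].
have psiG2 j : L2 O (fun x => psi x * G x 0 j).
  by apply: (L2_bounded_mul (C := C) mO (GL2 j) mpsi) => x /psiC[].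
have gpsiu2 j : L2 O (fun x => gradient psi x 0 j * u x).
  by apply: (L2_bounded_mul (C := C) mO u2 (mgpsi j)) => x /psiC[].
split=> [j|f tf j].
  apply: (L2_eq (f := fun x => 1 * (psi x * G x 0 j) + gradient psi x 0 j * u x)); last exact: L2_lin.
  by move=> x _; rewrite !mxE; ring.
have tfpsi := test_functionM oO tf psi1.
have gE x : O x -> gradient (fun x => f x * psi x) x 0 j =
    f x * gradient psi x 0 j + psi x * gradient f x 0 j.
  move=> Ox; rewrite !gradientE.
  have f1 : C1_on O f by move=> y _; exact: tf.1.
  by have [_ /(_ x j Ox) [_ ->]] := C1_onM oO f1 psi1.
have [_ /(_ j) i1] := test_mul_integrable oO bO psiu2 tf.
have [i2 _] := test_mul_integrable oO bO (gpsiu2 j) tf.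
have [i3 _] := test_mul_integrable oO bO (psiG2 j) tf.
have := Gu _ tfpsi j.
rewrite (eq_Rintegral _ (g := fun x => gradient psi x 0 j * u x * f x + psi x * u x * gradient f x 0 j)); last first.
  by move=> x /set_mem Ox; rewrite gE//; ring.
rewrite RintegralD// => E.
have -> : \int[leb]_(x in O) ((psi x *: G x + u x *: gradient psi x) 0 j * f x) =
    \int[leb]_(x in O) (psi x * G x 0 j * f x) +
    \int[leb]_(x in O) (gradient psi x 0 j * u x * f x).
  rewrite -RintegralD//; apply: eq_Rintegral => x _; rewrite !mxE; ring.
have e : \int[leb]_(x in O) (G x 0 j * (f x * psi x)) = \int[leb]_(x in O) (psi x * G x 0 j * f x).
  by apply: eq_Rintegral => x _; ring.
by move: E; rewrite e; lra.
Qed.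

End weak_gradients.

(** * Uniqueness of weak gradients *)

Section bumps.
Context {R : realType} {d : nat}.

Definition sqpos (s : R) : R := Num.max s 0 ^+ 2.

Lemma is_derive_quad (g : R -> R) (s c C : R) :
  (forall h, `|g (s + h) - g s - c * h| <= C * h ^+ 2) -> is_derive s (1 : R) g c.
Proof.
move=> gC.
have lim : (fun h : R => h^-1 *: ((g \o shift s) (h *: (1 : R)) - g s)) @ 0^' --> c.
  apply/cvgrPdist_le => e e0.
  apply/nbhs_ballP; exists (e / (`|C| + 1)) => /=; first by rewrite divr_gt0// ltr_wpDl.
  move=> h; rewrite -ball_normE /= sub0r normrN => he h0.
  have -> : c - h^-1 *: (g (h *: (1 : R) + s) - g s) = - (h^-1 * (g (s + h) - g s - c * h)).
    rewrite [h *: 1]mulr1 [h + s]addrC /GRing.scale /=; field.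
    exact: h0.
  rewrite normrN normrM normfV ler_pdivrMl ?normr_gt0//.
  apply: le_trans (gC h) _; rewrite -(@real_normK _ h) ?num_real//.
  move: he; rewrite ltr_pdivlMr ?ltr_wpDl// => he.
  have := normr_ge0 h; have := ler_norm C; have := normr_ge0 C; nra.
split; first by apply/cvg_ex; exists c.
exact: cvg_lim.
Qed.

Lemma is_derive_sqpos s : is_derive s (1 : R) sqpos (2 * Num.max s 0).
Proof.
apply: (@is_derive_quad _ _ _ 1) => h; rewrite /sqpos ler_norml mul1r.
have [s0|s0] := leP s 0; have [h0|h0] := leP (s + h) 0; apply/andP; split; nra.
Qed.

Lemma continuous_maxr0 : continuous (fun s : R => Num.max s 0).
Proof.
move=> s; apply/cvgrPdist_lt => e e0; apply/nbhs_ballP; exists e => //= t.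
rewrite /ball /= => st; apply: le_lt_trans st.
rewrite ler_norml; have := ler_norm (s - t); have := ler_norm (t - s).
rewrite distrC; have [s0|s0] := leP s 0; have [t0|t0] := leP t 0; move=> ? ?; apply/andP; split; lra.
Qed.

(** These functions increase to the indicator function of s != 0. *)
Definition sat (n : nat) (s : R) : R := n%:R * s ^+ 2 / (1 + n%:R * s ^+ 2).

Lemma sat_den (n : nat) (s : R) : 0 < 1 + n%:R * s ^+ 2.
Proof. by rewrite ltr_wpDr// mulr_ge0// sqr_ge0. Qed.

Lemma sat_bound n s : 0 <= sat n s <= 1.
Proof.
have D0 := sat_den n s; have N0 : 0 <= n%:R * s ^+ 2 by rewrite mulr_ge0// sqr_ge0.
by rewrite divr_ge0 ?(ltW D0)//= ler_pdivrMr// mul1r lerDr.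
Qed.

Lemma is_derive_sat n s : is_derive s (1 : R) (sat n) (2 * n%:R * s / (1 + n%:R * s ^+ 2) ^+ 2).
Proof.
have D0 := gt_eqF (sat_den n s).
have den : is_derive s (1 : R) (fun t : R => 1 + n%:R * t ^+ 2) (2 * n%:R * s).
  apply: (@is_derive_quad _ _ _ n%:R) => h; rewrite ler_norml; apply/andP; split; have := ler0n R n; nra.
have := @is_deriveM _ _ (fun t : R => n%:R * t ^+ 2) (fun t : R => (1 + n%:R * t ^+ 2)^-1) s 1.
have num : is_derive s (1 : R) (fun t : R => n%:R * t ^+ 2) (2 * n%:R * s).
  apply: (@is_derive_quad _ _ _ n%:R) => h; rewrite ler_norml; apply/andP; split; have := ler0n R n; nra.
move=> /(_ _ _ num (@is_deriveV _ (fun t : R => 1 + n%:R * t ^+ 2) _ _ _ (negbT D0) den)) H.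
apply: (is_derive_eq H); rewrite /GRing.scale /=; field.
by rewrite D0.
Qed.

Lemma continuous_dsat n : continuous (fun s : R => 2 * n%:R * s / (1 + n%:R * s ^+ 2) ^+ 2).
Proof.
move=> s; apply: cvgM; first by apply: cvgM; [exact: cvg_cst|exact: cvg_id].
apply: cvgV; first by rewrite expf_neq0// gt_eqF// sat_den.
rewrite [X in _ --> X](_ : _ = (1 + n%:R * s ^+ 2) * (1 + n%:R * s ^+ 2))//.
have c : (fun t : R => 1 + n%:R * t ^+ 2) @ s --> 1 + n%:R * s ^+ 2.
  apply: cvgD; first exact: cvg_cst.
  by apply: cvgM; [exact: cvg_cst|apply: exprn_continuous].
exact: (cvgM c c).
Qed.

Lemma cvg_sat s : (fun n => sat n s) @ \oo --> ((s != 0)%:R : R).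
Proof.
have [->|s0] := eqVneq s 0.
  rewrite (_ : (fun n => _) = fun=> 0); first exact: cvg_cst.
  by apply/funext => n; rewrite /sat expr0n /= mulr0 mul0r.
have q0 : 0 < s ^+ 2 by rewrite exprn_even_gt0.
apply/cvgrPdist_le => e e0; exists (Num.truncn (e^-1 / s ^+ 2)).+1 => //= n /= Nn.
have nq : e^-1 < n%:R * s ^+ 2.
  by rewrite -ltr_pdivrMr// (lt_le_trans (truncnS_gt _))// ler_nat.
have D0 := sat_den n s.
rewrite (_ : 1 - sat n s = (1 + n%:R * s ^+ 2)^-1); last by rewrite /sat; field; rewrite gt_eqF.
rewrite ger0_norm ?invr_ge0 ?(ltW D0)// -[leRHS]invrK lef_pV2 ?posrE ?invr_gt0//.
by rewrite ltW// (lt_trans nq)// ltrDr.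
Qed.

(** For a < b, a C^1 function that is nonzero exactly on the open box. *)
Definition bump (a b : 'I_d -> R) (x : 'rV[R]_d) : R :=
  \prod_(i < d) sqpos ((x 0 i - a i) * (b i - x 0 i)).

Lemma bump_C1 a b : C1_on setT (bump a b).
Proof.
apply: C1_on_prod; first exact: openT.
move=> i.
have C1l (c e : R) : C1_on setT (fun x : 'rV[R]_d => c * x 0 i + e).
  have d1 (s : R) : is_derive s (1 : R) (fun t : R => c * t + e) c.
    by apply: (@is_derive_quad _ _ _ 0) => h; rewrite mul0r le_eqVlt; apply/orP; left; rewrite normr_eq0; apply/eqP; ring.
  have cc : continuous (fun _ : R => c) by move=> t; exact: cvg_cst.
  by have [] := C1_on_comp openT d1 cc (C1_on_coord i openT).
have [C1q _] := C1_onM openT (C1l 1 (- a i)) (C1l (-1) (b i)).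
have cp : continuous (fun s : R => 2 * Num.max s 0).
  by move=> s; apply: cvgM; [exact: cvg_cst|exact: continuous_maxr0].
have [C1p _] := C1_on_comp openT is_derive_sqpos cp C1q.
rewrite (_ : (fun x => _) = sqpos \o (fun x : 'rV[R]_d => (1 * x 0 i + - a i) * (-1 * x 0 i + b i)))//.
by apply/funext => x /=; congr sqpos; ring.
Qed.

Lemma bump_neq0 a b x : (forall i, a i < b i) -> (bump a b x != 0) = `[< obox a b x >].
Proof.
move=> ab; apply/prodf_neq0/asboolP => [H i|xab i _].
  have := H i isT; rewrite /sqpos sqrf_eq0; have := ab i.
  have [_|] := leP ((x 0 i - a i) * (b i - x 0 i)) 0; first by rewrite eqxx.
  by move=> p0 abi _; apply/andP; split; nra.
rewrite /sqpos expf_neq0// gt_eqF// lt_max; apply/orP; left.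
by have /andP[? ?] := xab i; rewrite mulr_gt0// subr_gt0.
Qed.

Lemma bump_test a b (n : nat) (O : set 'rV[R]_d) : (forall i, a i < b i) -> cbox a b `<=` O ->
  test_function O (sat n \o bump a b).
Proof.
move=> ab abO.
have [C1s _] := C1_on_comp openT (is_derive_sat n) (@continuous_dsat n) (@bump_C1 a b).
apply: (@test_functionS _ _ _ (cbox a b)) => //.
split => //; exists (cbox a b); split => //; first exact: compact_cbox.
move=> x xab; have /negPn/eqP : ~~ (bump a b x != 0).
  by rewrite bump_neq0//; apply/asboolP; move=> /obox_cbox.
by move=> /= ->; rewrite /sat expr0n /= mulr0 mul0r.
Qed.

End bumps.

Section uniqueness.
Context {R : realType} {d : nat}.
Let leb : {measure set 'rV[R]_d -> \bar R} := lebesgue_rV d.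
Implicit Types (O : set 'rV[R]_d) (H : 'rV[R]_d -> R).

Lemma integral_box0 O H a b : open O -> leb.-integrable O (EFin \o H) ->
  (forall f, test_function O f -> \int[leb]_(x in O) (H x * f x) = 0) ->
  cbox a b `<=` O -> (\int[leb]_(x in obox a b) (H x)%:E)%E = 0%E.
Proof.
move=> oO iH Htest abO; have mO := open_measurable_rV oO.
have abO' : obox a b `<=` O by exact: subset_trans (@obox_cbox _ _ _ _) abO.
have mH : measurable_fun O H by case/integrableP : iH => /measurable_EFinP.
have iab : leb.-integrable (obox a b) (EFin \o H).
  by apply: integrableS iH => //; exact: measurable_obox.
rewrite -(fineK (integrable_fin_num (measurable_obox a b) iab)) -/(Rintegral _ _ H).
congr EFin.
have [ab|/existsNP[i /negP]] := pselect (forall i, a i < b i); last first.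
  rewrite -leNgt => ba; rewrite (_ : obox a b = set0) ?Rintegral_set0//.
  by rewrite -subset0 => x /(_ i) /andP[ax xb]; have := lt_trans ax xb; rewrite ltNge ba.
have lim : (fun n => \int[leb]_(x in O) (H x * (sat n \o bump a b) x)) @ \oo -->
    \int[leb]_(x in O) (H x * (bump a b x != 0)%:R).
  have mbump : measurable_fun O (bump a b).
    apply: continuous_measurable_rV => // x Ox.
    by apply: (C1_on_continuous openT) => //; exact: bump_C1.
  have msat n : measurable_fun O (sat n \o bump a b).
    have [m _] := test_function_measurable (bump_test n ab abO).
    exact: measurable_funS m.
  apply: (dominated_cvg_Rintegral (g := fun x => `|H x|)) => //.
  - by move=> n; exact: measurable_funM.
  - apply: measurable_funM => //.
    apply: (measurable_fun_cvg (h := fun n => sat n \o bump a b)) => // x _.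
    exact: cvg_sat.
  - exact: (integrable_norm iH).
  - move=> n x Ox; rewrite normrM ler_piMr//.
    by have /andP[s0 s1] := sat_bound n (bump a b x); rewrite ger0_norm.
  - by apply/aeW => x Ox; apply: cvgMr; exact: cvg_sat.
transitivity (\int[leb]_(x in O) (H x * (bump a b x != 0)%:R)).
  rewrite (@Rintegral_support _ _ _ leb O (obox a b))//.
    apply: eq_Rintegral => x /set_mem xab; rewrite bump_neq0//.
    by rewrite asboolT// mulr1.
  by move=> x _ xab; rewrite bump_neq0// asboolF// mulr0.
apply: (cvg_unique _ lim) => //.
rewrite (_ : (fun n => _) = fun=> 0); first exact: cvg_cst.
by apply/funext => n; apply: Htest; exact: bump_test.
Qed.

(** The integral of H over every box vanishes, since the indicator function of
    the box is a limit of test functions; the boxes generate the measurable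
    sets. *)
Lemma test_orthogonal_ae0 O H : open O -> leb.-integrable O (EFin \o H) ->
  (forall f, test_function O f -> \int[leb]_(x in O) (H x * f x) = 0) ->
  {ae leb, forall x, O x -> H x = 0}.
Proof.
move=> oO iH Htest; have mO := open_measurable_rV oO.
have box a b : cbox a b `<=` O -> {ae leb, forall x, obox a b x -> H x = 0}.
  move=> abO; set B := obox a b; have mB : measurable B by exact: measurable_obox.
  have BO : B `<=` O by exact: subset_trans (@obox_cbox _ _ _ _) abO.
  have iB : leb.-integrable B (EFin \o H) by apply: integrableS iH.
  have intB (E : set 'rV[R]_d) : measurable E -> (\int[leb]_(x in B `&` E) (H x)%:E)%E = 0%E.
    rewrite measurable_rV_oboxes.
    apply: (@dynkin_induction _ _ oboxes (fun E => (\int[leb]_(x in B `&` E) (H x)%:E)%E = 0%E)).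
    - exact: measurable_rV_oboxes.
    - exact: setI_closed_oboxes.
    - by rewrite setIT; exact: (integral_box0 oO).
    - move=> _ [[a' b'] _ <-].
      rewrite oboxI; apply: (integral_box0 oO) => // x xI; apply: abO => i.
      by have := xI i; rewrite ge_max le_min => /andP[/andP[-> _] /andP[-> _]].
    - move=> S mS S0.
      have BE : B = (B `&` S) `|` (B `&` ~` S) by rewrite -setIUr setUv setIT.
      have dBS : [disjoint B `&` S & B `&` ~` S]%classic.
        by apply/disj_setPS => x [[_ Sx] [_ /(_ Sx)]].
      have : (\int[leb]_(x in (B `&` S) `|` (B `&` ~` S)) (H x)%:E)%E = 0%E.
        by rewrite -BE; exact: (integral_box0 oO).
      rewrite integral_setU//.
      - by rewrite S0 add0e.
      - exact: measurableI.
      - by apply: measurableI => //; exact: measurableC.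
      - by rewrite -BE; case/integrableP : iB.
    - move=> F mF tF F0; rewrite setI_bigcupr.
      have mBF i : measurable (B `&` F i) by exact: measurableI.
      have iBF : leb.-integrable (\bigcup_i (B `&` F i)) (EFin \o H).
        apply: integrableS iB => //; first exact: bigcup_measurable.
        by rewrite -setI_bigcupr; exact: subIsetl.
      have tBF : trivIset setT (fun i => B `&` F i) by exact: trivIset_setIl.
      rewrite (integral_bigcup tBF mBF iBF).
      by apply: eseries0 => i _ _; exact: F0.
  have := @integral_ae_eq _ _ _ leb B mB (cst 0%E) (EFin \o H) iB.
  move=> /(_ (measurable_cst _)) => Hae.
  apply: filterS (Hae _) => [x xH Bx|E EB mE].
    by have := xH Bx => -[].
  by rewrite integral0 -[RHS](intB E)// setIidr.
have cover x : O x -> exists p : {ffun 'I_d -> rat * rat},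
    obox (rat_lo p) (rat_up p) x /\ cbox (rat_lo p) (rat_up p) `<=` O.
  exact: rational_box.
pose Z (n : nat) : set 'rV[R]_d := if unpickle n is Some p then
  [set x | cbox (rat_lo p) (rat_up p) `<=` O /\ obox (rat_lo p) (rat_up p) x /\ H x <> 0] else set0.
have : leb.-negligible (\bigcup_n Z n).
  apply: negligible_bigcup => n; rewrite /Z; case: unpickle => [p|]; last exact: negligible_set0.
  have [pO|pO] := pselect (cbox (rat_lo p : 'I_d -> R) (rat_up p) `<=` O); last first.
    rewrite (_ : mkset _ = set0); first exact: negligible_set0.
    by rewrite -subset0 => x [/pO].
  have /= nbox := box _ _ pO.
  by apply: (negligibleS _ nbox) => x [_ [xp Hx]] /= /(_ xp).
apply: negligibleS => x /= /not_implyP[Ox Hx].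
have [p [xp pO]] := cover x Ox.
by exists (pickle p) => //; rewrite /Z pickleK.
Qed.

Lemma is_weak_gradient_unique O u G G' : open O -> bounded_set O ->
  is_weak_gradient O u G -> is_weak_gradient O u G' ->
  {ae leb, forall x, O x -> G x = G' x}.
Proof.
move=> oO bO [G2 Gu] [G'2 G'u]; have mO := open_measurable_rV oO.
have Ofin := bounded_open_fin oO bO.
suff : {ae leb, forall x (j : 'I_d), O x -> G x 0 j = G' x 0 j}.
  by apply: filterS => x GG' Ox; apply/rowP => j; exact: GG'.
apply: (@filter_forall _ _ (fun j x => O x -> G x 0 j = G' x 0 j)) => j.
have D2 := L2_lin (-1) mO (G'2 j) (G2 j).
have := @test_orthogonal_ae0 O (fun x => -1 * G' x 0 j + G x 0 j) oO (L2_integrable mO Ofin D2).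
suff H0 : forall f, test_function O f ->
    \int[leb]_(x in O) ((-1 * G' x 0 j + G x 0 j) * f x) = 0.
  by move=> /(_ H0); apply: filterS => x GG' Ox; have := GG' Ox; lra.
move=> f tf.
have [i1 _] := test_mul_integrable oO bO (G2 j) tf.
have [i2 _] := test_mul_integrable oO bO (G'2 j) tf.
transitivity (\int[leb]_(x in O) (G x 0 j * f x - G' x 0 j * f x)).
  by apply: eq_Rintegral => x _; ring.
by rewrite RintegralB//; have := Gu f tf j; have := G'u f tf j; lra.
Qed.

End uniqueness.

(** * Classical gradients as weak gradients *)

Section difference_quotients.
Context {R : realType} {d : nat}.
Let leb : {measure set 'rV[R]_d -> \bar R} := lebesgue_rV d.
Implicit Types (O K U : set 'rV[R]_d) (u phi : 'rV[R]_d -> R).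

Lemma compact_margin K O : compact K -> open O -> K `<=` O ->
  exists2 r : R, 0 < r & forall x y, K x -> `|y - x| < r -> O y.
Proof.
move=> /compact_near_coveringP cK oO KO.
have : \forall r \near (0 : R)^'+, K `<=` [set x | forall y, `|y - x| < r -> O y].
  apply: cK => x Kx; have [r r0 xr] := open_rVP oO (KO _ Kx).
  exists ([set y | `|y - x| < r / 2], [set s | s < r / 2]) => /=.
    split; first by apply/nbhs_rVP; exists (r / 2); rewrite ?divr_gt0.
    by apply: nbhs_right_lt; rewrite divr_gt0.
  move=> [y s] /= [yx sr] z zy; apply: xr.
  rewrite -(subrKA y) (le_lt_trans (ler_normD _ _))// (splitr r) ltrD//.
  exact: lt_trans sr.
move=> [e /= e0 He]; exists (e / 2); first by rewrite divr_gt0.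
have : K `<=` [set x | forall y, `|y - x| < e / 2 -> O y].
  by apply: He; rewrite /= ?divr_gt0// sub0r normrN ger0_norm ?ltr_pdivrMr ?divr_ge0 ?ltW// ltr_pMr// ltr1n.
by move=> H x y /H; exact.
Qed.

Lemma derive_cvg_seq u x v (h : nat -> R) : derivable u x v ->
  (forall n, h n != 0) -> h @ \oo --> (0 : R) ->
  (fun n => (h n)^-1 * (u (x + h n *: v) - u x)) @ \oo --> 'D_v u x.
Proof.
move=> du h0 hlim.
have hl : h @ \oo --> 0^'.
  move=> A /= [e e0 eA]; have /cvgrPdist_lt/(_ e e0) := hlim.
  by apply: filterS => n hn; apply: eA => //; exact: h0.
have := cvg_comp _ _ hl du.
rewrite (_ : _ \o h = fun n => (h n)^-1 * (u (x + h n *: v) - u x))//.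
by apply/funext => n /=; rewrite [x + _]addrC.
Qed.

Lemma measurable_fun_shift u (c : 'rV[R]_d) : measurable_fun setT u ->
  measurable_fun setT (fun x : 'rV[R]_d => u (x + c)).
Proof. by move=> mu; apply: (measurableT_comp mu); exact: measurable_shift. Qed.

Lemma measurable_patch0 O u : measurable O -> measurable_fun O u -> measurable_fun setT (u \_ O).
Proof. by move=> mO mu; apply/(measurable_restrictT _ mO). Qed.

(** By translation invariance, difference quotients can be shifted from the test
    function to u; both sides then converge by bounded convergence. *)
Lemma lipschitz_is_weak_gradient O U u (C : R) :
  open O -> bounded_set O -> open U -> U `<=` O -> leb (O `\` U) = 0%E ->
  (forall x, O x -> {for x, continuous u}) -> (forall x, O x -> `|u x| <= C) ->
  (forall (x : 'rV[R]_d) j (t : R), (forall s : R, 0 <= s <= 1 -> O (x + (s * t) *: unitv j)) ->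
     `|u (x + t *: unitv j) - u x| <= C * `|t|) ->
  (forall x j, U x -> derivable u x (unitv j)) ->
  let G := fun x => \row_j (if x \in U then 'D_(unitv j) u x else 0) in
  is_weak_gradient O u G /\ forall x j, O x -> `|G x 0 j| <= C.
Proof.
move=> oO bO oU UO nOU cu uC lipu du G.
have [mO mU] := (open_measurable_rV oO, open_measurable_rV oU).
have Ofin := bounded_open_fin oO bO.
have mu : measurable_fun O u by exact: continuous_measurable_rV.
pose w : 'rV[R]_d -> R := u \_ O.
have wE x : O x -> w x = u x by move=> Ox; rewrite /w patchE mem_set.
have w0 x : ~ O x -> w x = 0 by move=> Ox; rewrite /w patchE memNset.
have mw : measurable_fun setT w by exact: measurable_patch0.
have C0 x : O x -> 0 <= C by move=> /uC; exact: le_trans.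
have duw x j (h : nat -> R) : U x -> (forall n, h n != 0) -> h @ \oo --> (0 : R) ->
    (fun n => (h n)^-1 * (w (x + h n *: unitv j) - w x)) @ \oo --> 'D_(unitv j) u x.
  move=> Ux h0 hlim; apply: cvg_trans (derive_cvg_seq (du x j Ux) h0 hlim).
  apply: near_eq_cvg.
  have [r r0 xr] := open_rVP oO (UO _ Ux).
  have /cvgrPdist_lt/(_ r r0) := hlim.
  apply: filterS => n; rewrite sub0r normrN => hn.
  rewrite !wE//; first exact: UO.
  by apply: xr; rewrite addrC addKr (le_lt_trans (norm_scale_unitv _ _)).
pose h (r : R) (n : nat) := r / n.+1%:R.
have h0 (r : R) n : 0 < r -> 0 < h r n <= r.
  by move=> r0; rewrite divr_gt0//= ler_pdivrMr// ler_peMr ?ler1n// ltW.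
have hlim r : h r @ \oo --> (0 : R).
  rewrite -(mulr0 r); apply: cvgMr; exact: cvg_harmonic.
have GU x j : U x -> G x 0 j = 'D_(unitv j) u x by move=> Ux; rewrite mxE mem_set.
have mG j : measurable_fun O (fun x => G x 0 j).
  have mGU : measurable_fun U (fun x => G x 0 j).
    apply: (measurable_fun_cvg (h := fun n (x : 'rV[R]_d) => (h 1 n)^-1 * (w (x + h 1 n *: unitv j) - w x))).
      move=> n; apply: measurable_funS (@subsetT _ U) _ => //.
      apply: measurable_funM => //; apply: measurable_funB => //.
      exact: measurable_fun_shift.
    move=> x Ux; rewrite GU//; apply: duw => // n.
    by have /andP[/lt0r_neq0] := h0 1 n ltr01.
  have : measurable_fun setT ((fun x => G x 0 j) \_ U) by exact: measurable_patch0.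
  rewrite (_ : _ \_ _ = fun x => G x 0 j); first exact: measurable_funS.
  by apply/funext => x; rewrite patchE /G !mxE; case: (x \in U).
have GC x j : O x -> `|G x 0 j| <= C.
  move=> Ox; rewrite mxE; case: ifPn => [/set_mem Ux|_]; last by rewrite normr0 (C0 _ Ox).
  have [r r0 xr] := open_rVP oO Ox.
  have hr n : 0 < h (r / 2) n <= r / 2 by apply: h0; rewrite divr_gt0.
  have cD : (fun n => `|(h (r/2) n)^-1 * (u (x + h (r/2) n *: unitv j) - u x)|) @ \oo --> `|'D_(unitv j) u x|.
    apply: cvg_norm; apply: derive_cvg_seq; [exact: du| |exact: hlim].
    by move=> n; have /andP[/lt0r_neq0] := hr n.
  rewrite -(cvg_lim _ cD)//; apply: limr_le; first by apply/cvg_ex; eexists; exact: cD.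
  apply: nearW => n; have /andP[hn0 hnr] := hr n.
  rewrite normrM normfV ler_pdivrMl ?normr_gt0 ?gt_eqF// [leRHS]mulrC.
  apply: lipu => s /andP[s0 s1]; apply: xr; rewrite addrC addKr.
  rewrite (le_lt_trans (norm_scale_unitv _ _))// ger0_norm ?mulr_ge0// ?ltW//.
  by rewrite (@le_lt_trans _ _ (r / 2))// ?ltr_pdivrMr// ?ltr_pMr ?ltr1n// (le_trans _ hnr)// ler_piMl// ltW.
split => //; split=> [j|f tf j].
  by apply: (bounded_L2 (C := C)) => // x Ox; exact: GC.
have [mf mgf] := test_function_measurable tf.
have [K [Cf [cK KO fK fC]]] := test_functionP tf.
have [r r0 Kr] := compact_margin cK oO KO.
pose hn n := h (r / 2) n.
have hn0 n : 0 < hn n by have /andP[] : 0 < h (r / 2) n <= r / 2 by apply: h0; rewrite divr_gt0.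
have hnr n : hn n < r.
  apply: (@le_lt_trans _ _ (r / 2)); last by rewrite ltr_pdivrMr// ltr_pMr ?ltr1n.
  by have /andP[] : 0 < h (r / 2) n <= r / 2 by apply: h0; rewrite divr_gt0.
have Cf0 : 0 <= Cf by have [/(le_trans _)->] := fC 0.
have shiftE n : \int[leb]_(x in O) (u x * ((hn n)^-1 * (f (x + hn n *: unitv j) - f x))) =
    \int[leb]_(x in O) ((hn n)^-1 * (w (x - hn n *: unitv j) - w x) * f x).
  pose F (x : 'rV[R]_d) := w (x - hn n *: unitv j) * f x.
  have mF : measurable_fun setT F by apply: measurable_funM => //; exact: measurable_fun_shift.
  have bw x : `|w x| <= `|C|.
    have [Ox|/w0 ->] := pselect (O x); last by rewrite normr0.
    by rewrite wE// (le_trans (uC _ Ox))// ler_norm.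
  have bint (p q : 'rV[R]_d -> R) : measurable_fun setT p -> measurable_fun setT q ->
      (forall x, `|p x| <= `|C|) -> (forall x, `|q x| <= Cf) ->
      leb.-integrable O (EFin \o (fun x => p x * q x)).
    move=> mp mq pC qC; apply: (bounded_integrable (C := `|C| * Cf)) => //.
      by apply: measurable_funS (measurable_funM mp mq).
    by move=> x _; rewrite normrM ler_pM.
  have mfh : measurable_fun setT (fun x : 'rV[R]_d => f (x + hn n *: unitv j)) by exact: measurable_fun_shift.
  have mwh : measurable_fun setT (fun x : 'rV[R]_d => w (x - hn n *: unitv j)) by exact: measurable_fun_shift.
  have fCf x : `|f x| <= Cf by have [] := fC x.
  have i1 := bint w (fun x : 'rV[R]_d => f (x + hn n *: unitv j)) mw mfh bw (fun x => fCf _).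
  have i2 := bint w f mw mf bw fCf.
  have i3 := bint (fun x : 'rV[R]_d => w (x - hn n *: unitv j)) f mwh mf (fun x => bw _) fCf.
  have AA : \int[leb]_(x in O) (w x * f (x + hn n *: unitv j)) = \int[leb]_(x in O) F x.
    rewrite -(@Rintegral_support _ _ _ leb setT)//; last by move=> x _ /w0 ->; rewrite mul0r.
    rewrite -[RHS](@Rintegral_support _ _ _ leb setT)//; last first.
      by move=> x _ xO; rewrite /F (fK x _).1 ?mulr0// => /KO.
    rewrite -(Rintegral_shift (hn n *: unitv j) mF); apply: eq_Rintegral => x _.
    by rewrite /F addrK.
  transitivity ((hn n)^-1 * (\int[leb]_(x in O) (w x * f (x + hn n *: unitv j)) - \int[leb]_(x in O) (w x * f x))).
    rewrite -RintegralB// -RintegralZl//; last exact: (integrableB mO i1 i2).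
    by apply: eq_Rintegral => x /set_mem Ox; rewrite wE//; ring.
  rewrite AA -RintegralB// -RintegralZl//; last exact: (integrableB mO i3 i2).
  by apply: eq_Rintegral => x _; rewrite /F; ring.
have mhn n : measurable_fun setT (fun x : 'rV[R]_d => (hn n)^-1 * (f (x + hn n *: unitv j) - f x)).
  by apply: measurable_funM => //; apply: measurable_funB => //; exact: measurable_fun_shift.
have hnlim : hn @ \oo --> (0 : R) by exact: hlim.
have lim1 : (fun n => \int[leb]_(x in O) (u x * ((hn n)^-1 * (f (x + hn n *: unitv j) - f x)))) @ \oo -->
    \int[leb]_(x in O) (u x * gradient f x 0 j).
  apply: (bounded_cvg_Rintegral (C := C * Cf)) => //.
  - by move=> n; apply: measurable_funM => //; exact: measurable_funS (mhn n).
  - by apply: measurable_funM => //; exact: measurable_funS (mgf j).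
  - move=> n x Ox; rewrite normrM ler_pM// ?uC// normrM normfV ler_pdivrMl ?normr_gt0 ?gt_eqF//.
    rewrite [leRHS]mulrC; apply: derive_bound_lip => s _ _; split; first by have [/(_ (x + s *: unitv j) I j)[]] := tf.
    by rewrite -gradientE; have [_] := fC (x + s *: unitv j).
  - apply/aeW => x Ox; apply: cvgMr; rewrite gradientE; apply: derive_cvg_seq => //.
    + by have [/(_ x I j)[]] := tf.
    + by move=> n; rewrite gt_eqF.
have lim2 : (fun n => \int[leb]_(x in O) ((hn n)^-1 * (w (x - hn n *: unitv j) - w x) * f x)) @ \oo -->
    \int[leb]_(x in O) (- G x 0 j * f x).
  apply: (bounded_cvg_Rintegral (C := C * Cf)) => //.
  - move=> n; apply: measurable_funM; last exact: measurable_funS mf.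
    apply: measurable_funS (@subsetT _ O) _ => //.
    by apply: measurable_funM => //; apply: measurable_funB => //; exact: measurable_fun_shift.
  - by apply: measurable_funM; [exact: measurable_funN|exact: measurable_funS mf].
  - move=> n x Ox; have [Kx|Kx] := pselect (K x); last first.
      by rewrite (fK x Kx).1 mulr0 normr0 mulr_ge0// (C0 _ Ox).
    rewrite normrM ler_pM//; last by have [] := fC x.
    have seg s : 0 <= s <= 1 -> O (x + (s * - hn n) *: unitv j).
      move=> /andP[s0 s1]; apply: Kr Kx _; rewrite addrC addKr.
      rewrite (le_lt_trans (norm_scale_unitv _ _))// normrM normrN !ger0_norm// ?ltW//.
      by rewrite (le_lt_trans _ (hnr n))// ler_piMl// ltW.
    have := lipu x j (- hn n) seg; rewrite scaleNr normrN => lx.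
    have := seg 1; rewrite mul1r lexx ler01 scaleNr => /(_ isT) Ox'.
    rewrite !wE// normrM normfV ler_pdivrMl ?normr_gt0 ?gt_eqF// [leRHS]mulrC.
    by rewrite (le_trans lx).
  - have nU : leb.-negligible (O `\` U) by apply/negligibleP => //; exact: measurableD.
    apply: negligibleS nU => x /= /not_implyP[Ox nlim]; split => // Ux; apply: nlim.
    apply: cvgMl; rewrite GU//.
    have hN0 n : - hn n != 0 by rewrite oppr_eq0 gt_eqF.
    have hNl : (fun n => - hn n) @ \oo --> (0 : R) by rewrite -oppr0; exact: cvgN.
    have D := duw x j (fun n => - hn n) Ux hN0 hNl.
    rewrite (_ : (fun n => _) = fun n => - ((- hn n)^-1 * (w (x + - hn n *: unitv j) - w x))).
      exact: cvgN.
    by apply/funext => n; rewrite invrN mulNr opprK scaleNr.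
have e := funext shiftE; rewrite e in lim1.
rewrite (cvg_unique _ lim1 lim2)// -[RHS]mulN1r -RintegralZl//.
  by apply: eq_Rintegral => x _; ring.
apply: (bounded_integrable (C := C * Cf)) => //.
  by apply: measurable_funM => //; exact: measurable_funS mf.
by move=> x Ox; rewrite normrM ler_pM// ?GC//; have [] := fC x.
Qed.

End difference_quotients.

(** * Mesh cells *)

Section dini.
Context {R : realType}.

(** Were the conclusion to fail, h would cross some line l of slope C that
    starts above h 0, for a last time.  The line lies above m, so that growth
    is needed only where h exceeds m: for m = 0 and a partition of unity, only
    inside the patch. *)
Lemma dini_growth (h : R -> R) (C m : R) : 0 <= C -> m <= h 0 ->
  (forall t e : R, 0 <= t <= 1 -> 0 < e ->
     exists2 r : R, 0 < r & forall s : R, 0 <= s <= 1 -> `|s - t| < r -> `|h s - h t| < e) ->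
  (forall t r : R, 0 <= t < 1 -> m < h t -> 0 < r ->
     exists2 s : R, t < s < t + r & s <= 1 /\ h s <= h t + C * (s - t)) ->
  h 1 <= h 0 + C.
Proof.
move=> C0 mh0 ch dh; rewrite leNgt; apply/negP => h1.
pose e := (h 1 - (h 0 + C)) / 2.
have e0 : 0 < e by rewrite divr_gt0// subr_gt0.
pose l t := h 0 + e + C * t.
pose S := [set t | 0 <= t <= 1 /\ h t <= l t].
have S0 : S 0 by split; rewrite ?lexx ?ler01// /l mulr0 addr0 lerDl ltW.
have ubS : ubound S 1 by move=> t [/andP[]].
have supS : has_sup S by split; [exists 0|exists 1].
pose t0 := sup S.
have t00 : 0 <= t0 by apply: ub_le_sup S0; exists 1.
have t01 : t0 <= 1 by apply: ge_sup => //; exists 0.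
have ht0 : h t0 <= l t0.
  rewrite leNgt; apply/negP => lt0.
  have [||r r0 hr] := ch t0 ((h t0 - l t0) / 2); first by rewrite t00.
    by rewrite divr_gt0// subr_gt0.
  have [s [s01 hs] st] := sup_adherent r0 supS.
  have st0 : s <= t0 by apply: ub_le_sup; [exists 1|].
  have := hr s s01; rewrite ler0_norm ?subr_le0//.
  have /[swap] /[apply] : - (s - t0) < r by rewrite -/t0 in st; lra.
  rewrite ltr_norml; have : C * s <= C * t0 by rewrite ler_wpM2l.
  move: hs; rewrite /l in lt0 *; lra.
have t0lt1 : t0 < 1.
  rewrite lt_neqAle t01 andbT; apply/eqP => t1; move: ht0; rewrite t1 /l mulr1.
  by rewrite /e; lra.
have notS s : t0 < s -> S s -> False.
  by move=> ts Ss; have := ub_le_sup (ex_intro _ 1 ubS) Ss; rewrite leNgt ts.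
have [mt0|mt0] := ltP m (h t0).
  have [|s /andP[ts _] [s1 hs]] := dh t0 1 _ mt0 ltr01; first by rewrite t00.
  apply: (notS s) => //; split; first by rewrite s1 (le_trans t00)// ltW.
  by move: ht0 hs; rewrite /l; lra.
have h0t0 : h t0 < l t0.
  by rewrite (le_lt_trans mt0)// (le_lt_trans mh0)// /l -addrA ltrDl ltr_pwDl// mulr_ge0.
have [||r r0 hr] := ch t0 (l t0 - h t0); first by rewrite t00.
  by rewrite subr_gt0.
pose s := t0 + Num.min (1 - t0) (r / 2).
have ts : t0 < s by rewrite ltrDl lt_min subr_gt0 t0lt1 divr_gt0.
have s1 : s <= 1 by rewrite /s -lerBrDl ge_min lexx.
have sr : s - t0 < r.
  by rewrite /s addrC addKr gt_min orbC ltr_pdivrMr// ltr_pMr ?ltr1n.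
apply: (notS s) => //; split; first by rewrite s1 (le_trans t00)// ltW.
have := hr s; rewrite s1 (le_trans t00 (ltW ts)) => /(_ isT).
rewrite ger0_norm ?subr_ge0 ?(ltW ts)// => /(_ sr).
rewrite ltr_norml /l; have : C * t0 <= C * s by rewrite ler_wpM2l// ltW.
lra.
Qed.

End dini.

Section cells.
Context {R : realType} {d : nat}.
Implicit Types (x y s : 'rV[R]_d) (k : cell_kind) (c : @cell R d).
Let leb : {measure set 'rV[R]_d -> \bar R} := lebesgue_rV d.

Definition lin_const (M : 'M[R]_d) : R := \sum_i \sum_j `|M i j|.

Lemma norm_mulmx_le (M : 'M[R]_d) x : `|x *m M| <= lin_const M * `|x|.
Proof.
apply: norm_le_coord => [|j].
  by rewrite mulr_ge0// sumr_ge0// => i _; rewrite sumr_ge0.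
rewrite mxE (le_trans (ler_norm_sum _ _ _))// mulr_suml ler_sum// => i _.
rewrite normrM mulrC ler_pM//; last exact: coord_le_norm.
by rewrite (bigD1 j)//= lerDl sumr_ge0.
Qed.

(** The inverse of cell_map. *)
Definition pull c x : 'rV[R]_d := (x - cell_base c) *m invmx (cell_edges c).

Lemma pull_lip c x y : `|pull c x - pull c y| <= lin_const (invmx (cell_edges c)) * `|x - y|.
Proof. by rewrite -mulmxBl opprB addrA subrK norm_mulmx_le. Qed.

Lemma pullK c x : cell_edges c \in unitmx -> cell_map c (pull c x) = x.
Proof. by move=> u; rewrite /cell_map /pull mulmxKV// addrC subrK. Qed.

Lemma cell_mapK c s : cell_edges c \in unitmx -> pull c (cell_map c s) = s.
Proof. by move=> u; rewrite /cell_map /pull addrC addKr mulmxK. Qed.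

Lemma cell_setE k c : cell_edges c \in unitmx ->
  cell_set k c = [set x | ref_cell k (pull c x)].
Proof.
move=> u; apply/seteqP; split => [_ [s ks <-] /=|x /= kx].
  by rewrite cell_mapK.
by exists (pull c x) => //; exact: pullK.
Qed.

Lemma continuous_pull c x j : {for x, continuous (fun y => pull c y 0 j)}.
Proof.
apply: (@lip_continuous_at _ _ _ _ 1 (lin_const (invmx (cell_edges c)))) => // y _.
by apply: le_trans (pull_lip c y x); have := coord_le_norm (pull c y - pull c x) j; rewrite !mxE.
Qed.

Lemma continuous_sum_pull c x : {for x, continuous (fun y => \sum_j pull c y 0 j)}.
Proof.
apply: (@lip_continuous_at _ _ _ _ 1 (d%:R * lin_const (invmx (cell_edges c)))) => // y _.
rewrite -sumrB (le_trans (ler_norm_sum _ _ _))//.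
have -> : d%:R * lin_const (invmx (cell_edges c)) * `|y - x| =
    \sum_(j < d) lin_const (invmx (cell_edges c)) * `|y - x|.
  by rewrite sumr_const card_ord -mulrA mulr_natl.
apply: ler_sum => j _; apply: le_trans (pull_lip c y x).
by have := coord_le_norm (pull c y - pull c x) j; rewrite !mxE.
Qed.

Lemma ref_cell_box k s : ref_cell k s -> forall j, 0 <= s 0 j <= 1.
Proof.
case: k => //= -[s0 s1] j; rewrite s0/= (le_trans _ s1)// (bigD1 j)//= lerDl.
by rewrite sumr_ge0.
Qed.

Definition ref_interior k : set 'rV[R]_d :=
  match k with
  | Simplicial => [set s | (forall j, 0 < s 0 j) /\ \sum_j s 0 j < 1]
  | Rectangular => [set s | forall j, 0 < s 0 j < 1]
  end.

Definition cell_interior k c : set 'rV[R]_d := [set x | ref_interior k (pull c x)].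

Lemma open_lt_rV (f : 'rV[R]_d -> R) (a : R) : (forall x, {for x, continuous f}) ->
  open [set x | a < f x].
Proof.
move=> cf; rewrite openE => x /= ax.
suff : nbhs x [set x | a < f x] by [].
have /continuous_rVP/(_ (f x - a)) := cf x; rewrite subr_gt0 => /(_ ax)[r r0 xr].
apply/nbhs_rVP; exists r => // y /xr; rewrite ltr_norml /=; lra.
Qed.

Lemma open_gt_rV (f : 'rV[R]_d -> R) (a : R) : (forall x, {for x, continuous f}) ->
  open [set x | f x < a].
Proof.
move=> cf; rewrite openE => x /= ax.
suff : nbhs x [set x | f x < a] by [].
have /continuous_rVP/(_ (a - f x)) := cf x; rewrite subr_gt0 => /(_ ax)[r r0 xr].
apply/nbhs_rVP; exists r => // y /xr; rewrite ltr_norml /=; lra.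
Qed.

Lemma open_forall_ord (P : 'I_d -> set 'rV[R]_d) : (forall j, open (P j)) ->
  open [set x | forall j, P j x].
Proof.
move=> oP; rewrite openE => x Px.
apply: (@filter_forall _ _ P (nbhs x)) => j.
by have := oP j; rewrite openE; apply.
Qed.

Lemma open_cell_interior k c : open (cell_interior k c).
Proof.
rewrite /cell_interior; case: k => /=.
  rewrite (_ : mkset _ = [set x | forall j, 0 < pull c x 0 j] `&` [set x | \sum_j pull c x 0 j < 1])//.
  apply: openI; last by apply: open_gt_rV => x; exact: continuous_sum_pull.
  apply: (open_forall_ord (P := fun j => [set x | 0 < pull c x 0 j])) => j.
  by apply: open_lt_rV => x; exact: continuous_pull.
apply: (open_forall_ord (P := fun j => [set x | 0 < pull c x 0 j < 1])) => j.
rewrite (_ : mkset _ = [set x | 0 < pull c x 0 j] `&` [set x | pull c x 0 j < 1]); last first.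
  by apply/seteqP; split => x /= => [/andP[]//|[-> ->]].
by apply: openI; [apply: open_lt_rV|apply: open_gt_rV] => x; exact: continuous_pull.
Qed.

Lemma ref_interior_sub k s : ref_interior k s -> ref_cell k s.
Proof.
case: k => /= [[s0 s1]|s01 j]; last by have /andP[? ?] := s01 j; rewrite !ltW.
by split=> [j|]; rewrite ltW.
Qed.

Lemma cell_interior_sub k c : cell_edges c \in unitmx -> cell_interior k c `<=` cell_set k c.
Proof. by move=> u; rewrite cell_setE// => x; exact: ref_interior_sub. Qed.

Lemma cell_interior_dense k c x (r : R) : cell_edges c \in unitmx -> cell_set k c x -> 0 < r ->
  exists2 y, cell_interior k c y & `|y - x| < r.
Proof.
move=> u; rewrite cell_setE// => /= kx r0.
pose s := pull c x; pose z : 'rV[R]_d := const_mx d.+1%:R^-1.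
pose K := lin_const (cell_edges c) * `|z - s| + 1.
have K0 : 0 < K.
  by rewrite ltr_wpDl// mulr_ge0// sumr_ge0// => i _; rewrite sumr_ge0.
pose t := Num.min (2^-1) (r / K).
have t0 : 0 < t by rewrite lt_min invr_gt0 ltr0n divr_gt0.
have t1 : t < 1 by rewrite gt_min invf_lt1 ?ltr1n.
have tr : t * K <= r by rewrite -ler_pdivlMr// ge_min lexx orbT.
pose s' := s + t *: (z - s).
have s'E j : s' 0 j = (1 - t) * s 0 j + t * d.+1%:R^-1 by rewrite !mxE; ring.
have d1 : 0 < d.+1%:R^-1 :> R by rewrite invr_gt0.
exists (cell_map c s'); last first.
  rewrite -[X in _ - X](pullK x u) /cell_map opprD addrACA subrr add0r -mulmxBl.
  rewrite (_ : s' - _ = t *: (z - s)); last by rewrite addrC addKr.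
  rewrite (le_lt_trans (norm_mulmx_le _ _))// normrZ ger0_norm ?(ltW t0)//.
  by rewrite mulrCA (lt_le_trans _ tr)// ltr_pM2l// ltrDl.
rewrite /cell_interior /= cell_mapK//.
have sbox := ref_cell_box kx; rewrite -/s in sbox kx.
have pos j : 0 < s' 0 j.
  have /andP[sj0 sj1] := sbox j; rewrite s'E ltr_wpDl// ?mulr_gt0// mulr_ge0// subr_ge0 ltW//.
case: k kx => /= [[_ s1]|_ j].
  split=> //; rewrite (eq_bigr (fun j => (1 - t) * s 0 j + t * d.+1%:R^-1))//.
  rewrite big_split/= -mulr_sumr sumr_const card_ord -[_ *+ d]mulr_natl.
  have td : d%:R * (t * d.+1%:R^-1) < t :> R.
    by rewrite mulrCA gtr_pMr// ltr_pdivrMr// mul1r ltr_nat.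
  have ts : (1 - t) * (\sum_(i < d) s 0 i) <= (1 - t) * 1 by rewrite ler_wpM2l// subr_ge0 ltW.
  by have := ler_ltD ts td; rewrite mulr1 subrK.
rewrite pos/= s'E; have /andP[sj0 sj1] := sbox j.
have d0 : (0 < d)%N by exact: leq_ltn_trans (ltn_ord j).
have td : t * d.+1%:R^-1 < t by rewrite gtr_pMr// invf_lt1 ?ltr1n ?ltr0n.
have ts : (1 - t) * s 0 j <= (1 - t) * 1 by rewrite ler_wpM2l// subr_ge0 ltW.
by have := ler_ltD ts td; rewrite mulr1 subrK.
Qed.

Lemma closed_cell_set k c : cell_edges c \in unitmx -> closed (cell_set k c).
Proof.
move=> u; rewrite cell_setE//.
rewrite -[X in closed X]setCK; apply: open_closedC.
rewrite openE => x /= kx.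
suff : nbhs x (~` [set y | ref_cell k (pull c y)]) by [].
case: k kx => /=; last first.
  move=> /existsNP[j /negP]; rewrite negb_and -!ltNge => /orP[jx|jx].
    have := @open_gt_rV _ 0 (fun y => @continuous_pull c y j); rewrite openE => /(_ x jx).
    by apply: filterS => y /= jy /(_ j); rewrite leNgt jy.
  have := @open_lt_rV _ 1 (fun y => @continuous_pull c y j); rewrite openE => /(_ x jx).
  by apply: filterS => y /= jy /(_ j) /andP[_]; rewrite leNgt jy.
move=> /not_andP[/existsNP[j /negP]|/negP]; rewrite -ltNge => jx.
  have := @open_gt_rV _ 0 (fun y => @continuous_pull c y j); rewrite openE => /(_ x jx).
  by apply: filterS => y /= jy [/(_ j)]; rewrite leNgt jy.
have := @open_lt_rV _ 1 (fun y => @continuous_sum_pull c y); rewrite openE => /(_ x jx).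
by apply: filterS => y /= jy [_]; rewrite leNgt jy.
Qed.

Lemma bounded_cell_set k c : cell_edges c \in unitmx -> bounded_set (cell_set k c).
Proof.
move=> u; pose M := `|cell_base c| + lin_const (cell_edges c).
exists M; split; first by rewrite num_real.
move=> N MN /= _ [s ks <-]; rewrite (le_trans _ (ltW MN))// (le_trans (ler_normD _ _))// lerD2l.
rewrite (le_trans (norm_mulmx_le _ _))// ler_piMr ?sumr_ge0// => [i _|]; first by rewrite sumr_ge0.
apply: norm_le_coord => // j; have /andP[s0 s1] := ref_cell_box ks j.
by rewrite ger0_norm.
Qed.

Lemma pull_shift c x j (t : R) i : cell_edges c \in unitmx ->
  pull c (x + t *: (unitv j *m cell_edges c)) 0 i = pull c x 0 i + t * (i == j)%:R.
Proof.
move=> u; rewrite /pull -addrA addrCA mulmxDl addrC -scalemxAl mulmxK//.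
by rewrite [LHS]mxE [X in X + _]mxE unitvE addrC.
Qed.

(** The translates of a level set of l along v are other level sets. *)
Lemma level_null k c (l : 'rV[R]_d -> R) (a : R) v : cell_edges c \in unitmx ->
  (forall x, {for x, continuous l}) -> (forall x t, l (x + t *: v) = l x + t) ->
  {ae leb, forall x, ~ (cell_set k c x /\ l x = a)}.
Proof.
move=> u cl lv.
have cS : closed [set x | l x = a].
  rewrite (_ : mkset _ = ~` ([set x | l x < a] `|` [set x | a < l x])).
    apply: open_closedC; apply: openU; [exact: open_gt_rV|exact: open_lt_rV].
  apply/seteqP; split => [x /= -> []|x /= /not_orP[/negP + /negP]]; rewrite ?ltxx//.
  by rewrite -!leNgt => ? ?; apply: le_anti; apply/andP.
have mS : measurable (cell_set k c `&` [set x | l x = a]).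
  by apply: closed_measurable_rV; apply: closedI => //; exact: closed_cell_set.
have S0 : leb (cell_set k c `&` [set x | l x = a]) = 0%E.
  apply: (@transversal_null _ _ _ v) => //.
    have [M [Mr MP]] := bounded_cell_set k u; exists M; split => // N MN x [kx _]; exact: MP kx.
  move=> x t t0 [_ /= xa] [_ /=]; rewrite lv xa => /eqP.
  by rewrite -subr_eq0 addrAC subrr add0r (negbTE t0).
have /negligibleP nS : leb (cell_set k c `&` [set x | l x = a]) = 0%E by [].
by apply: negligibleS (nS mS) => x /= /contrapT.
Qed.

Lemma cell_boundary_null k c : cell_edges c \in unitmx ->
  {ae leb, forall x, cell_set k c x -> cell_interior k c x}.
Proof.
move=> u.
have nul a j : {ae leb, forall x, ~ (cell_set k c x /\ pull c x 0 j = a)}.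
  apply: (@level_null _ _ _ _ (unitv j *m cell_edges c)) => // [x|x t].
    exact: continuous_pull.
  by rewrite pull_shift// eqxx mulr1.
have nuls : {ae leb, forall x, ~ (cell_set k c x /\ \sum_j pull c x 0 j = 1)}.
  have [[j _]|nod] := pselect (exists j : 'I_d, True); last first.
    apply: aeW => x [_]; rewrite big1 => [/eqP|j _]; first by rewrite eq_sym oner_eq0.
    by exfalso; apply: nod; exists j.
  apply: (@level_null _ _ _ _ (unitv j *m cell_edges c)) => // [x|x t].
    exact: continuous_sum_pull.
  rewrite (eq_bigr (fun i => pull c x 0 i + t * (i == j)%:R)) => [|i _]; last exact: pull_shift.
  rewrite big_split/=; congr (_ + _); rewrite (bigD1 j)//= eqxx mulr1 big1 ?addr0// => i /negbTE ->.
  by rewrite mulr0.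
have nulF a : {ae leb, forall x j, ~ (cell_set k c x /\ pull c x 0 j = a)}.
  exact: (@filter_forall _ _ (fun j x => ~ (cell_set k c x /\ pull c x 0 j = a)) _ _ (nul a)).
apply: filterS3 (nulF 0) (nulF 1) nuls => x n0 n1 ns kx.
have kx' := kx; move: kx'; rewrite cell_setE//= => rx; have box := ref_cell_box rx.
rewrite /cell_interior /=.
have pos j : 0 < pull c x 0 j.
  have /andP[j0 _] := box j; rewrite lt_neqAle j0 andbT; apply/negP => /eqP e.
  by apply: (n0 j).
case: k n0 n1 ns kx rx {nul nulF} => /= n0 n1 ns kx rx.
  split=> //; case: rx => _ s1; rewrite lt_neqAle s1 andbT; apply/negP => /eqP e.
  exact: ns.
move=> j; rewrite pos/= lt_neqAle; have /andP[_ ->] := box j.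
by rewrite andbT; apply/negP => /eqP e; apply: (n1 j).
Qed.

End cells.

(** * Regularity of finite element functions *)

Section shape_functions.
Context {R : realType} {d : nat}.
Implicit Types (p q : 'rV[R]_d -> R) (s v : 'rV[R]_d) (k : cell_kind).

Definition unit_box : set 'rV[R]_d := [set s | forall j, 0 <= s 0 j <= 1].

(** What the analysis needs to know of a shape function. *)
Definition tame p : Prop :=
  (exists C : R, forall s s', unit_box s -> unit_box s' ->
     `|p s| <= C /\ `|p s - p s'| <= C * `|s - s'|) /\
  forall s v, derivable p s v.

Lemma tame_cst (c : R) : tame (fun=> c).
Proof.
split=> [|s v]; last exact: derivable_cst.
by exists `|c| => s s' _ _; rewrite subrr normr0 mulr_ge0.
Qed.

Lemma tame_coord i : tame (fun s => s 0 i).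
Proof.
split=> [|s v].
  exists 1 => s s' sb s'b; rewrite mul1r; split; last first.
    by have := coord_le_norm (s - s') i; rewrite !mxE.
  by have /andP[s0 s1] := sb i; rewrite ger0_norm.
have := @is_derive_line R d (fun s => s 0 i) s v 0 (v 0 i); rewrite scale0r addr0.
suff D : is_derive (0 : R) (1 : R) (fun t : R => (s + t *: v) 0 i) (v 0 i) by case=> _ /(_ D) [].
apply: (@is_derive_quad _ _ _ _ 0) => t; rewrite scale0r addr0 add0r !mxE mul0r.
by rewrite [X in `|X|](_ : _ = 0) ?normr0//; ring.
Qed.

Lemma tameD p q : tame p -> tame q -> tame (fun s => p s + q s).
Proof.
move=> [[C pC] dp] [[C' qC] dq]; split=> [|s v]; last exact: derivableD.
exists (C + C') => s s' sb s'b; have [p1 p2] := pC s s' sb s'b; have [q1 q2] := qC s s' sb s'b.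
split; first by rewrite (le_trans (ler_normD _ _))// lerD.
by rewrite opprD addrACA (le_trans (ler_normD _ _))// mulrDl lerD.
Qed.

Lemma tameM p q : tame p -> tame q -> tame (fun s => p s * q s).
Proof.
move=> [[C pC] dp] [[C' qC] dq]; split=> [|s v]; last exact: derivableM.
exists (C * C' + C * C') => s s' sb s'b.
have [p1 p2] := pC s s' sb s'b; have [q1 q2] := qC s s' sb s'b.
have [p1' _] := pC s' s s'b sb; have [q1' _] := qC s' s s'b sb.
have C0 : 0 <= C by apply: le_trans p1.
have C'0 : 0 <= C' by apply: le_trans q1.
split; first by rewrite normrM (le_trans (ler_pM _ _ p1 q1))// lerDl mulr_ge0.
rewrite (_ : _ - _ = p s * (q s - q s') + (p s - p s') * q s'); last ring.
rewrite (le_trans (ler_normD _ _))// [leRHS]mulrDl !normrM lerD//.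
  by rewrite -mulrA ler_pM.
by rewrite mulrAC ler_pM.
Qed.

Lemma tame_sum (I : Type) (r : seq I) (P : pred I) (F : I -> 'rV[R]_d -> R) :
  (forall i, tame (F i)) -> tame (fun s => \sum_(i <- r | P i) F i s).
Proof.
move=> tF; elim: r => [|i r IHr].
  by rewrite (_ : (fun s => _) = fun=> 0); [exact: tame_cst|apply/funext => s; rewrite big_nil].
have [Pi|Pi] := boolP (P i).
  rewrite (_ : (fun s => _) = fun s => F i s + \sum_(i <- r | P i) F i s); first exact: tameD.
  by apply/funext => s; rewrite big_cons Pi.
by rewrite (_ : (fun s => _) = fun s => \sum_(i <- r | P i) F i s)//; apply/funext => s; rewrite big_cons (negbTE Pi).
Qed.

Lemma tame_prod (I : Type) (r : seq I) (P : pred I) (F : I -> 'rV[R]_d -> R) :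
  (forall i, tame (F i)) -> tame (fun s => \prod_(i <- r | P i) F i s).
Proof.
move=> tF; elim: r => [|i r IHr].
  by rewrite (_ : (fun s => _) = fun=> 1); [exact: tame_cst|apply/funext => s; rewrite big_nil].
have [Pi|Pi] := boolP (P i).
  rewrite (_ : (fun s => _) = fun s => F i s * \prod_(i <- r | P i) F i s); first exact: tameM.
  by apply/funext => s; rewrite big_cons Pi.
by rewrite (_ : (fun s => _) = fun s => \prod_(i <- r | P i) F i s)//; apply/funext => s; rewrite big_cons (negbTE Pi).
Qed.

Lemma shape_tame k p : shape_function k p -> tame p.
Proof.
case: k => /= [[a [b pE]]|[a pE]].
  rewrite (_ : p = fun s => a + \sum_j b j * s 0 j); last exact/funext.
  apply: tameD; first exact: tame_cst.
  by apply: tame_sum => j; apply: tameM; [exact: tame_cst|exact: tame_coord].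
rewrite (_ : p = fun s => \sum_(J : {set 'I_d}) a J * \prod_(j in J) s 0 j); last exact/funext.
apply: tame_sum => J; apply: tameM; first exact: tame_cst.
by apply: tame_prod => j; exact: tame_coord.
Qed.

Lemma shape_lin k p q (c : R) : shape_function k p -> shape_function k q ->
  shape_function k (fun s => c * p s + q s).
Proof.
case: k => /= [[a [b pE]] [a' [b' qE]]|[a pE] [a' qE]].
  exists (c * a + a'), (fun j => c * b j + b' j) => s; rewrite pE qE mulrDr mulr_sumr.
  rewrite addrACA -big_split/=; congr (_ + _); apply: eq_bigr => j _; ring.
exists (fun J => c * a J + a' J) => s; rewrite pE qE mulr_sumr -big_split/=.
by apply: eq_bigr => J _; ring.
Qed.

End shape_functions.

Lemma within_continuousP {R : realType} {d : nat} (D : set 'rV[R]_d) (f : 'rV[R]_d -> R) :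
  {within D, continuous f} <-> forall x (e : R), D x -> 0 < e ->
    exists2 r : R, 0 < r & forall y, D y -> `|y - x| < r -> `|f y - f x| < e.
Proof.
rewrite subspace_continuousP; split=> [cf x e Dx e0|cf x Dx].
  have /cvgrPdist_lt/(_ e e0) := cf x Dx.
  rewrite /within /= => /nbhs_rVP[r r0 xr].
  by exists r => // y Dy /xr/(_ Dy); rewrite distrC.
apply/cvgrPdist_lt => e e0; rewrite /within /=; apply/nbhs_rVP.
have [r r0 xr] := cf x e Dx e0; exists r => // y yx Dy.
by rewrite distrC; exact: xr.
Qed.

Section fe_functions.
Context {R : realType} {d : nat}.
Variables (Omega : set 'rV[R]_d) (k : cell_kind) (sigma h : R) (N : nat) (tau : 'I_N -> @cell R d).
Hypothesis oOmega : open Omega.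
Hypothesis bOmega : bounded_set Omega.
Hypothesis htau : triangulation k Omega sigma h tau.
Let leb : {measure set 'rV[R]_d -> \bar R} := lebesgue_rV d.
Implicit Types (u v : 'rV[R]_d -> R) (x y : 'rV[R]_d).

Lemma tau_unit i : cell_edges (tau i) \in unitmx.
Proof. by case: htau => -[/(_ i) []]. Qed.

Lemma closure_cover x : closure Omega x <-> exists i, cell_set k (tau i) x.
Proof.
case: htau => -[_ <- _] _; split=> [[i _ xi]|[i xi]]; by exists i.
Qed.

Definition mesh_interior : set 'rV[R]_d := Omega `&` \bigcup_(i in [set: 'I_N]) cell_interior k (tau i).

Lemma open_mesh_interior : open mesh_interior.
Proof. by apply: openI => //; apply: bigcup_open => i _; exact: open_cell_interior. Qed.

Lemma mesh_interior_null : leb (Omega `\` mesh_interior) = 0%E.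
Proof.
apply/negligibleP; first by apply: measurableD; apply: open_measurable_rV => //; exact: open_mesh_interior.
have Hae : {ae leb, forall x i, cell_set k (tau i) x -> cell_interior k (tau i) x}.
  apply: (@filter_forall _ _ (fun i x => cell_set k (tau i) x -> cell_interior k (tau i) x)) => i.
  exact: cell_boundary_null (tau_unit i).
apply: (negligibleS _ Hae) => x [Ox nx] /= H; apply: nx; split => //.
have [i xi] := (closure_cover x).1 (subset_closure Ox).
by exists i => //; exact: H.
Qed.

Lemma Vh_cell u i : Vh Omega k tau u -> exists C : R,
  (forall x y, cell_set k (tau i) x -> cell_set k (tau i) y ->
     `|u x| <= C /\ `|u x - u y| <= C * `|x - y|) /\
  (forall x (v : 'rV[R]_d), cell_interior k (tau i) x -> derivable u x v).
Proof.
move=> [_ /(_ i) [p /shape_tame[[C pC] dp] up]].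
have ui := tau_unit i.
have uE x : cell_set k (tau i) x -> u x = p (pull (tau i) x).
  by rewrite cell_setE//= => kx; rewrite -up// pullK.
have box x : cell_set k (tau i) x -> unit_box (pull (tau i) x).
  by rewrite cell_setE// => /ref_cell_box.
exists (`|C| + `|C| * lin_const (invmx (cell_edges (tau i)))); split=> [x y xi yi|x v xi].
  have [p1 p2] := pC _ _ (box _ xi) (box _ yi).
  have l0 : 0 <= lin_const (invmx (cell_edges (tau i))).
    by rewrite sumr_ge0// => j _; rewrite sumr_ge0.
  rewrite !uE//; split.
    by rewrite (le_trans p1)// (le_trans (ler_norm C))// lerDl mulr_ge0.
  rewrite (le_trans p2)// mulrDl (@le_trans _ _ (`|C| * `|pull (tau i) x - pull (tau i) y|))//.
    by rewrite ler_wpM2r// ler_norm.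
  rewrite (@le_trans _ _ (`|C| * (lin_const (invmx (cell_edges (tau i))) * `|x - y|)))//.
    by rewrite ler_wpM2l// pull_lip.
  by rewrite mulrA lerDr mulr_ge0.
apply: (@near_eq_derivable _ _ _ (p \o pull (tau i))).
  have := @open_cell_interior _ _ k (tau i); rewrite openE => /(_ _ xi).
  by apply: filterS => y /(cell_interior_sub ui) yi /=; rewrite uE.
apply/derivable1P; have /derivable1P := dp (pull (tau i) x) (v *m invmx (cell_edges (tau i))).
rewrite (_ : (fun t => _) = fun t : R => (p \o pull (tau i)) (t *: v + x))//.
by apply/funext => t; rewrite /= /pull scalemxAl -mulmxDl addrA.
Qed.

(** After any point of a segment, one of the finitely many cells recurs at
    arbitrarily close later points, and contains the point as it is closed: the
    Lipschitz bound of that cell is the growth condition of dini_growth. *)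
Lemma Vh_lip u : Vh Omega k tau u -> exists C : R,
  [/\ 0 <= C, forall x, closure Omega x -> `|u x| <= C,
   forall x y, (forall s : R, 0 <= s <= 1 -> closure Omega (x + s *: (y - x))) ->
     `|u y - u x| <= C * `|y - x| &
   forall x (v : 'rV[R]_d), mesh_interior x -> derivable u x v].
Proof.
move=> uV; have /choice[C CP] := fun i => Vh_cell i uV.
pose CC := \sum_i `|C i|.
have CC0 : 0 <= CC by rewrite sumr_ge0.
have CiCC i : C i <= CC.
  by rewrite (le_trans (ler_norm _))// /CC (bigD1 i)//= lerDl sumr_ge0.
exists CC; split => //.
- move=> x /closure_cover[i xi]; have [/(_ x x xi xi)[u1 _] _] := CP i.
  exact: le_trans (CiCC i).
- suff H w : (forall x e, closure Omega x -> 0 < e ->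
        exists2 r, 0 < r & forall y, closure Omega y -> `|y - x| < r -> `|w y - w x| < e) ->
      (forall i x y, cell_set k (tau i) x -> cell_set k (tau i) y -> `|w x - w y| <= CC * `|x - y|) ->
      forall x y, (forall s : R, 0 <= s <= 1 -> closure Omega (x + s *: (y - x))) ->
        w y <= w x + CC * `|y - x|.
    move=> x y xy; have [/within_continuousP cu _] := uV.
    have lu i z z' : cell_set k (tau i) z -> cell_set k (tau i) z' -> `|u z - u z'| <= CC * `|z - z'|.
      move=> zi z'i; have [/(_ z z' zi z'i)[_ u2] _] := CP i.
      by rewrite (le_trans u2)// ler_wpM2r.
    have h1 := H u cu lu x y xy.
    have h2 := H (fun z => - u z) _ _ x y xy.
    rewrite ler_norml; apply/andP; split; last lra.
    have : - u y <= - u x + CC * `|y - x|; last lra.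
    apply: h2 => [z e Oz e0|i z z' zi z'i].
      have [r r0 zr] := cu z e Oz e0; exists r => // z' Oz' zz'.
      by rewrite -opprD normrN; exact: zr.
    by rewrite -opprD normrN (lu i).
  move=> cw lw x y xy.
  pose p (t : R) := x + t *: (y - x).
  have pB (s t : R) : p s - p t = (s - t) *: (y - x) by rewrite /p opprD addrACA subrr add0r -scalerBl.
  have p0 : p 0 = x by rewrite /p scale0r addr0.
  have p1 : p 1 = y by rewrite /p scale1r addrC subrK.
  have := @dini_growth R (w \o p) (CC * `|y - x|) (w x - 1).
  rewrite /= p0 p1; apply.
  + by rewrite mulr_ge0.
  + by rewrite lerBlDr lerDl.
  + move=> t e t01 e0; have [r r0 pr] := cw _ e (xy t t01) e0.
    exists (r / (`|y - x| + 1)); first by rewrite divr_gt0// ltr_wpDl.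
    move=> s s01; rewrite ltr_pdivlMr ?ltr_wpDl// => st.
    apply: pr; first exact: xy.
    rewrite -/(p s) -/(p t) pB normrZ (le_lt_trans _ st)// ler_wpM2l// lerDl//.
  + move=> t r /andP[t0 t1] _ r0.
    have [i Hi] : exists i, forall e : R, 0 < e -> exists2 s, t < s < t + e & s <= 1 /\ cell_set k (tau i) (p s).
      apply: contrapT => /forallNP H.
      have /choice[e eP] : forall i, exists e : R, 0 < e /\ forall s, t < s < t + e -> s <= 1 -> ~ cell_set k (tau i) (p s).
        move=> i; have /existsNP[e /not_implyP[e0 He]] := H i.
        exists e; split => // s ts s1 si; apply: He; by exists s.
      pose e0 := \big[Num.min/(1 - t)]_i e i.
      have e00 : 0 < e0.
        by apply/bigmin_gtP; split; [rewrite subr_gt0|move=> i _; have [] := eP i].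
      pose s := t + e0 / 2.
      have ts : t < s by rewrite ltrDl divr_gt0.
      have se : s < t + e0 by rewrite ltrD2l ltr_pdivrMr// ltr_pMr// ltr1n.
      have s1 : s <= 1.
        rewrite (le_trans (ltW se))// -lerBrDl; exact: bigmin_le_id.
      have /closure_cover[i si] : closure Omega (p s).
        by apply: xy; rewrite s1 (le_trans t0)// ltW.
      have [_ /(_ s)] := eP i; apply => //; rewrite ts/= (lt_le_trans se)// lerD2l.
      exact: bigmin_le_cond.
    have ti : cell_set k (tau i) (p t).
      apply: contrapT => nti.
      have : open (~` cell_set k (tau i)) by apply: closed_openC; apply: closed_cell_set; exact: tau_unit.
      move=> /open_rVP/(_ nti)[e e0 He].
      have [|s /andP[ts se] [_ si]] := Hi (e / (`|y - x| + 1)); first by rewrite divr_gt0// ltr_wpDl.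
      apply: He si; rewrite pB normrZ ger0_norm ?subr_ge0 ?(ltW ts)//.
      have : (s - t) * (`|y - x| + 1) < e by rewrite -ltr_pdivlMr ?ltr_wpDl// ltrBlDl.
      by apply: le_lt_trans; rewrite ler_wpM2l ?subr_ge0 ?(ltW ts)// lerDl.
    have [s /andP[ts sr] [s1 si]] := Hi r r0.
    exists s; first by rewrite ts.
    split => //; have := lw i _ _ si ti; rewrite pB normrZ ger0_norm ?subr_ge0 ?(ltW ts)//.
    move=> /(le_trans (ler_norm _)); rewrite /p; rewrite mulrCA mulrC; lra.
- move=> x v [Ox [i _ xi]]; have [_] := CP i; exact.
Qed.

End fe_functions.

(** * Weak gradients of finite element functions *)

Section soft_threshold.
Context {R : realType}.

(** Smooth approximations of the identity that are flat at 0: the derivative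
    dsoft n vanishes there, and tends to the indicator function of s != 0. *)
Definition soft (n : nat) (s : R) : R := s * sat n s.
Definition dsoft (n : nat) (s : R) : R := sat n s * (3 - 2 * sat n s).

Lemma is_derive_soft n s : is_derive s (1 : R) (soft n) (dsoft n s).
Proof.
have D := is_deriveM (is_derive_id s 1) (is_derive_sat n s).
apply: (@is_derive_eq _ _ _ (soft n) _ _ _ _ D); rewrite /dsoft /sat /GRing.scale /=; field.
by rewrite gt_eqF// sat_den.
Qed.

Lemma continuous_sat n : continuous (@sat R n).
Proof.
move=> s; apply: differentiable_continuous; apply/derivable1_diffP.
by have [] := is_derive_sat n s.
Qed.

Lemma continuous_dsoft n : continuous (dsoft n).
Proof.
move=> s; apply: cvgM; first exact: continuous_sat.
apply: cvgB; first exact: cvg_cst.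
by apply: cvgM; [exact: cvg_cst|exact: continuous_sat].
Qed.

Lemma dsoft_bound n s : `|dsoft n s| <= 2.
Proof. by have /andP[s0 s1] := sat_bound n s; rewrite ler_norml /dsoft; apply/andP; split; nra. Qed.

Lemma soft_bound n s : `|soft n s| <= `|s|.
Proof.
rewrite /soft normrM ler_piMr//; have /andP[s0 s1] := sat_bound n s.
by rewrite ger0_norm.
Qed.

Lemma soft_lip n s t : `|soft n t - soft n s| <= 2 * `|t - s|.
Proof.
have lip a b : a <= b -> `|soft n b - soft n a| <= 2 * `|b - a|.
  move=> ab; have [||c _ ->] := @MVT_segment R (soft n) (dsoft n) a b ab.
  - by move=> x _; exact: is_derive_soft.
  - apply: derivable_within_continuous => x _.
    by have [] := is_derive_soft n x.
  - by rewrite normrM ler_wpM2r// dsoft_bound.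
have [st|/ltW ts] := leP s t; first exact: lip.
by rewrite distrC [`|t - s|]distrC; exact: lip.
Qed.

Lemma cvg_soft s : (fun n => soft n s) @ \oo --> s.
Proof.
rewrite [X in _ --> X](_ : s = s * (s != 0)%:R).
  by apply: cvgMr; exact: cvg_sat.
by have [->|] := eqVneq s 0; rewrite ?mulr0 ?mulr1.
Qed.

Lemma cvg_dsoft s : (fun n => dsoft n s) @ \oo --> ((s != 0)%:R : R).
Proof.
rewrite [X in _ --> X](_ : _ = (s != 0)%:R * (3 - 2 * (s != 0)%:R)).
  apply: cvgM; first exact: cvg_sat.
  by apply: cvgB; [exact: cvg_cst|apply: cvgMr; exact: cvg_sat].
by case: (s != 0); rewrite ?mul0r//= !mulr1; lra.
Qed.

Lemma soft0 n : soft n 0 = 0.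
Proof. by rewrite /soft mul0r. Qed.

Lemma dsoft0 n : dsoft n 0 = 0.
Proof. by rewrite /dsoft /sat expr0n /= mulr0 !mul0r. Qed.

End soft_threshold.

Section Vh_H1.
Context {R : realType} {d : nat}.
Variables (Omega : set 'rV[R]_d) (k : cell_kind) (sigma h : R) (N : nat) (tau : 'I_N -> @cell R d).
Hypothesis oOmega : open Omega.
Hypothesis bOmega : bounded_set Omega.
Hypothesis htau : triangulation k Omega sigma h tau.
Let leb : {measure set 'rV[R]_d -> \bar R} := lebesgue_rV d.
Implicit Types (u v : 'rV[R]_d -> R) (x y : 'rV[R]_d).

Lemma within_continuous_at (D : set 'rV[R]_d) u x : {within closure D, continuous u} -> open D -> D x ->
  {for x, continuous u}.
Proof.
move=> /within_continuousP cu oD Dx; apply/continuous_rVP => e e0.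
have [r r0 xr] := cu x e (subset_closure Dx) e0.
have [r' r'0 xr'] := open_rVP oD Dx.
exists (Num.min r r'); first by rewrite lt_min r0.
by move=> y; rewrite lt_min => /andP[yr yr']; apply: xr => //; apply/subset_closure/xr'.
Qed.

(** The weak gradient vanishes almost everywhere on the zero set of u, because
    it is also the limit of the gradients dsoft n (u) G of soft n (u). *)
Lemma Vh_weak_gradient u : Vh Omega k tau u -> exists G (C : R),
  [/\ is_weak_gradient Omega u G,
      forall x, Omega x -> `|u x| <= C, forall x j, Omega x -> `|G x 0 j| <= C &
      {ae leb, forall x, Omega x -> u x = 0 -> G x = 0}].
Proof.
move=> uV; have [C [C0 uC lu du]] := Vh_lip htau uV.
have cu x : Omega x -> {for x, continuous u}.
  by move=> Ox; apply: within_continuous_at oOmega Ox; case: uV.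
set U := mesh_interior Omega k tau.
have oU : open U by exact: open_mesh_interior.
have UO : U `<=` Omega by move=> x [].
have nU := mesh_interior_null oOmega htau.
have cO : Omega `<=` closure Omega by exact: subset_closure.
have segO (w : 'rV[R]_d -> R) (B : R) : (forall x y, (forall s : R, 0 <= s <= 1 -> closure Omega (x + s *: (y - x))) ->
       `|w y - w x| <= B * `|y - x|) -> 0 <= B ->
     forall (x : 'rV[R]_d) j (t : R), (forall s : R, 0 <= s <= 1 -> Omega (x + (s * t) *: unitv j)) ->
     `|w (x + t *: unitv j) - w x| <= B * `|t|.
  move=> lw B0 x j t xt.
  have xE : x + t *: unitv j - x = t *: unitv j by rewrite addrAC subrr add0r.
  have := lw x (x + t *: unitv j); rewrite xE => H.
  rewrite (le_trans (H _))//; first by move=> s s01; rewrite scalerA; apply/cO/xt.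
  by rewrite ler_wpM2l// norm_scale_unitv.
have [] := lipschitz_is_weak_gradient (C := C) oOmega bOmega oU UO nU cu
   (fun x Ox => uC x (cO _ Ox)) (segO u C lu C0) (fun x j => du x (unitv j)).
set G := fun x => _ => wG GC.
exists G, C; split => //; first by move=> x Ox; exact/uC/cO.
have wn n : is_weak_gradient Omega (soft n \o u) (fun x => dsoft n (u x) *: G x).
  have C20 : 0 <= 2 * C by rewrite mulr_ge0.
  have D x j : U x -> is_derive x (unitv j) (soft n \o u) (dsoft n (u x) * 'D_(unitv j) u x).
    by move=> Ux; apply: is_derive_comp1; [apply/derivableP; exact: du|exact: is_derive_soft].
  have [] := lipschitz_is_weak_gradient (C := 2 * C) (u := soft n \o u) oOmega bOmega oU UO nU.
  - move=> x Ox; apply: continuous_rV_comp; first exact: cu.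
    apply: differentiable_continuous; apply/derivable1_diffP.
    by have [] := is_derive_soft n (u x).
  - move=> x Ox /=; rewrite (le_trans (soft_bound _ _))// (le_trans (uC _ (cO _ Ox)))//.
    by rewrite ler_peMl// ler1n.
  - apply: segO => // x y xy; rewrite /= (le_trans (soft_lip _ _ _))// -mulrA ler_wpM2l//.
    exact: lu.
  - by move=> x j Ux; have [] := D x j Ux.
  move=> wsG _; apply: is_weak_gradient_eqG wsG => x Ox; apply/rowP => j; rewrite !mxE.
  case: ifPn => [/set_mem Ux|_]; last by rewrite mulr0.
  by have [_ ->] := D x j Ux.
have wlim : is_weak_gradient Omega u (fun x => (u x != 0)%:R *: G x).
  apply: (@is_weak_gradient_lim _ _ Omega (fun n => soft n \o u) (fun n x => dsoft n (u x) *: G x) _ _ (2 * C)) => //.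
  - move=> n; apply: continuous_measurable_rV => // x Ox; apply: continuous_rV_comp; first exact: cu.
    apply: differentiable_continuous; apply/derivable1_diffP.
    by have [] := is_derive_soft n (u x).
  - move=> n x Ox /=; rewrite (le_trans (soft_bound _ _))// (le_trans (uC _ (cO _ Ox)))//.
    by rewrite ler_peMl// ler1n.
  - by move=> n x j Ox; rewrite mxE normrM ler_pM// ?GC// dsoft_bound.
  - by move=> x Ox; exact: cvg_soft.
  - move=> x j Ox; rewrite mxE (_ : (fun n => _) = fun n => dsoft n (u x) * G x 0 j).
      by apply: cvgMl; exact: cvg_dsoft.
    by apply/funext => n; rewrite mxE.
apply: filterS (is_weak_gradient_unique oOmega bOmega wG wlim) => x GE Ox u0.
by rewrite GE// u0 eqxx scale0r.
Qed.

Lemma Vh_H1 u : Vh Omega k tau u -> H1 Omega u.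
Proof.
move=> uV; have [G [C [wG uC _ _]]] := Vh_weak_gradient uV; split; last by exists G.
apply: (bounded_L2 (C := C)) => //.
- exact: open_measurable_rV.
- exact: bounded_open_fin.
- apply: continuous_measurable_rV => // x Ox.
  by apply: within_continuous_at oOmega Ox; case: uV.
Qed.

Lemma Vh_lin u v (c : R) : Vh Omega k tau u -> Vh Omega k tau v ->
  Vh Omega k tau (fun x => c * u x + v x).
Proof.
move=> [cu uV] [cv vV]; split.
  move: cu cv => /within_continuousP cu /within_continuousP cv.
  apply/within_continuousP => x e Ox e0.
  have c0 : 0 < `|c| + 1 by rewrite ltr_wpDl.
  have [|r r0 xr] := cu x (e / 2 / (`|c| + 1)) Ox; first by rewrite !divr_gt0.
  have [|r' r'0 xr'] := cv x (e / 2) Ox; first by rewrite divr_gt0.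
  exists (Num.min r r'); first by rewrite lt_min r0.
  move=> y Oy; rewrite lt_min => /andP[/(xr y Oy) yr /(xr' y Oy) yr'].
  rewrite opprD addrACA -mulrBr (le_lt_trans (ler_normD _ _))// (splitr e) ltr_leD//; last exact: ltW.
  rewrite normrM (@le_lt_trans _ _ ((`|c| + 1) * `|u y - u x|))//.
    by rewrite ler_wpM2r// lerDl.
  by rewrite mulrC -ltr_pdivlMr.
move=> i; have [p pS pE] := uV i; have [q qS qE] := vV i.
exists (fun s => c * p s + q s); first exact: shape_lin.
by move=> s ks; rewrite pE// qE.
Qed.

End Vh_H1.

(** * Short paths in Lipschitz domains *)

Section lipschitz_domains.
Context {R : realType} {d : nat}.
Implicit Types (Omega O D : set 'rV[R]_d) (x y z p q : 'rV[R]_d).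

(** Segments are the local paths used throughout: functions are shown to be
    Lipschitz along the segments of a domain that need not be convex. *)
Definition seg_in D x y : Prop := forall s : R, 0 <= s <= 1 -> D (x + s *: (y - x)).

Lemma seg_in_l D x y : seg_in D x y -> D x.
Proof. by move=> /(_ 0); rewrite lexx ler01 scale0r addr0; apply. Qed.

Lemma seg_in_r D x y : seg_in D x y -> D y.
Proof. by move=> /(_ 1); rewrite lexx ler01 scale1r addrC subrK; apply. Qed.

Lemma seg_in_ball x y z (r : R) : `|y - x| < r -> `|z - x| < r -> seg_in [set p | `|p - x| < r] y z.
Proof.
move=> yr zr s /andP[s0 s1] /=.
rewrite (_ : y + _ - x = (1 - s) *: (y - x) + s *: (z - x)); last first.
  by rewrite scalerBl scale1r !scalerBr opprB addrACA; apply/rowP => j; rewrite !mxE; ring.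
rewrite (le_lt_trans (ler_normD _ _))// !normrZ !ger0_norm ?subr_ge0//.
have [->|s0'] := eqVneq s 0; first by rewrite mul0r addr0 subr0 mul1r.
have : s * `|z - x| < s * r by rewrite ltr_pM2l// lt_neqAle eq_sym s0'.
have : (1 - s) * `|y - x| <= (1 - s) * r by rewrite ler_wpM2l ?subr_ge0// ltW.
by move=> h1 h2; have := ler_ltD h1 h2; rewrite -mulrDl subrK mul1r.
Qed.

Lemma seg_exit O y z : open O -> O y -> ~ O z ->
  exists2 s : R, 0 <= s <= 1 & bd O (y + s *: (z - y)).
Proof.
move=> oO Oy Oz.
pose S := [set s : R | 0 <= s <= 1 /\ O (y + s *: (z - y))].
have S0 : S 0 by split; rewrite ?lexx ?ler01// scale0r addr0.
have ubS : ubound S 1 by move=> t [/andP[]].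
have supS : has_sup S by split; [exists 0|exists 1].
pose t := sup S.
have t0 : 0 <= t by apply: ub_le_sup S0; exists 1.
have t1 : t <= 1 by apply: ge_sup => //; exists 0.
exists t; first by rewrite t0.
have pB (a b : R) : y + a *: (z - y) - (y + b *: (z - y)) = (a - b) *: (z - y).
  by rewrite opprD addrACA subrr add0r -scalerBl.
have K0 : 0 < `|z - y| + 1 by rewrite ltr_wpDl.
have small (e s : R) : 0 < e -> `|s - t| < e / (`|z - y| + 1) -> `|y + s *: (z - y) - (y + t *: (z - y))| < e.
  move=> e0; rewrite ltr_pdivlMr// => st; rewrite pB normrZ (le_lt_trans _ st)//.
  by rewrite ler_wpM2l// lerDl.
split.
  move=> A /nbhs_rVP[e e0 eA].
  have [s [s01 Os] st] := sup_adherent (divr_gt0 e0 K0) supS.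
  exists (y + s *: (z - y)); split => //; apply: eA; apply: small => //.
  have st' : s <= t by apply: ub_le_sup => //; exists 1.
  by rewrite ler0_norm ?subr_le0//; rewrite -/t in st; lra.
rewrite (_ : interior O = O); last by apply/interior_id.
move=> Ot; have [e e0 He] := open_rVP oO Ot.
have t1' : t < 1.
  rewrite lt_neqAle t1 andbT; apply/eqP => tE; apply: Oz.
  by move: Ot; rewrite tE scale1r addrC subrK.
pose s := t + Num.min (1 - t) (e / (`|z - y| + 1) / 2).
have ts : t < s by rewrite ltrDl lt_min subr_gt0 t1' !divr_gt0.
have : S s.
  split; first by rewrite (le_trans t0 (ltW ts))/= /s -lerBrDl ge_min lexx.
  apply: He; apply: small => //; rewrite ger0_norm ?subr_ge0 ?(ltW ts)//.
  by rewrite /s addrC addKr gt_min orbC ltr_pdivrMr// ltr_pMr ?ltr1n// divr_gt0.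
by move=> /(ub_le_sup (ex_intro _ 1 ubS)); rewrite leNgt ts.
Qed.

Lemma enorm_ge0 x : 0 <= enorm x.
Proof. exact: sqrtr_ge0. Qed.

Lemma enorm_sqr x : enorm x ^+ 2 = \sum_(j < d) x 0 j ^+ 2.
Proof.
rewrite /enorm sqr_sqrtr; first by apply: eq_bigr => j _; rewrite expr2.
by rewrite sumr_ge0// => j _; rewrite -expr2 sqr_ge0.
Qed.

Lemma enorm_le x : enorm x <= d%:R * `|x|.
Proof.
have x0 := normr_ge0 x.
rewrite -(@ler_pXn2r _ 2)// ?nnegrE ?enorm_ge0 ?mulr_ge0//.
rewrite enorm_sqr exprMn (@le_trans _ _ (\sum_(j < d) `|x| ^+ 2))//.
  by apply: ler_sum => j _; rewrite -real_normK ?num_real// lerXn2r ?nnegrE ?coord_le_norm.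
rewrite sumr_const card_ord -[_ *+ d]mulr_natl ler_wpM2r ?sqr_ge0//.
by rewrite -natrX ler_nat; case: (d) => // n; rewrite leq_pmulr.
Qed.

Lemma coord_le_enorm x j : `|x 0 j| <= enorm x.
Proof.
rewrite -(@ler_pXn2r _ 2)// ?nnegrE ?enorm_ge0// enorm_sqr real_normK ?num_real//.
by rewrite (bigD1 j)//= lerDl sumr_ge0// => i _; rewrite sqr_ge0.
Qed.

Lemma dotpBl x y z : dotp (x - y) z = dotp x z - dotp y z.
Proof. by rewrite /dotp -sumrB; apply: eq_bigr => j _; rewrite !mxE mulrBl. Qed.

Lemma dotpDl x y z : dotp (x + y) z = dotp x z + dotp y z.
Proof. by rewrite /dotp -big_split/=; apply: eq_bigr => j _; rewrite !mxE mulrDl. Qed.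

Lemma dotpZl (c : R) x z : dotp (c *: x) z = c * dotp x z.
Proof. by rewrite /dotp mulr_sumr; apply: eq_bigr => j _; rewrite !mxE mulrA. Qed.

Lemma dotp_unit_le x y : enorm y = 1 -> `|dotp x y| <= d%:R * `|x|.
Proof.
move=> y1; rewrite (le_trans (ler_norm_sum _ _ _))//.
have -> : d%:R * `|x| = \sum_(j < d) `|x| by rewrite sumr_const card_ord mulr_natl.
apply: ler_sum => j _; rewrite normrM -[leRHS]mulr1 ler_pM// ?coord_le_norm//.
by rewrite -y1 coord_le_enorm.
Qed.

(** Near a boundary point the path goes up along the direction nu of the graph,
    across above the graph, and down again. *)
Lemma lipschitz_path Omega x (e : R) : open Omega -> lipschitz_boundary Omega ->
  closure Omega x -> 0 < e ->
  exists2 r : R, 0 < r & forall y z, Omega y -> Omega z -> `|y - x| < r -> `|z - x| < r ->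
    exists p q, let B := Omega `&` [set w | `|w - x| < e] in
      [/\ seg_in B y p, seg_in B p q & seg_in B q z].
Proof.
move=> oOmega lip cx e0.
have [Ox|Ox] := pselect (Omega x).
  have [r r0 xr] := open_rVP oOmega Ox.
  exists (Num.min r e); first by rewrite lt_min r0.
  move=> y z Oy Oz yr zr; exists y, z.
  have seg a b : `|a - x| < Num.min r e -> `|b - x| < Num.min r e ->
      seg_in (Omega `&` [set w | `|w - x| < e]) a b.
    move=> ar br s s01; have := seg_in_ball ar br s01; rewrite /= lt_min => /andP[h1 h2].
    by split => //; exact: xr.
  by split; exact: seg.
have bx : bd Omega x by split => //; rewrite (interior_id _).1.
have [nu [gam [L [r0 [nu1 r00 gamL Ograph]]]]] := lip x bx.
pose D : R := d%:R.
have D0 : 0 <= D by rewrite ler0n.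
(* The rise to the height T chosen below is at most K r. *)
pose K := 2 * D + `|L| * (D * (2 + 2 * D)).
have K0 : 0 <= K by rewrite addr_ge0 ?mulr_ge0 ?addr_ge0// mulr_ge0.
have nule : `|nu| <= 1.
  by apply: norm_le_coord => // j; rewrite -nu1 coord_le_enorm.
pose m := Num.min e (r0 / (D + 1)).
have m0 : 0 < m by rewrite lt_min e0 divr_gt0// ltr_wpDl.
pose r := m / (1 + K).
have K1 : 0 < 1 + K by rewrite ltr_pwDl.
have rpos : 0 < r by rewrite divr_gt0.
have rK : r * (1 + K) = m by rewrite divfK// gt_eqF.
exists r => // y z Oy Oz yr zr.
have near w : `|w - x| < m -> `|w - x| < e /\ enorm (w - x) < r0.
  rewrite lt_min => /andP[we wr]; split => //.
  rewrite (le_lt_trans (enorm_le _))//.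
  rewrite ltr_pdivlMr ?ltr_wpDl// in wr.
  by rewrite (le_lt_trans _ wr)// mulrC ler_wpM2l// lerDl.
have mr : r <= m by rewrite -rK ler_peMr ?(ltW rpos)// lerDl.
have Oiff w : `|w - x| < m -> (Omega w <-> gam (w - dotp w nu *: nu) < dotp w nu).
  by move=> /near[_]; exact: Ograph.
have ym : `|y - x| < m by exact: lt_le_trans mr.
have zm : `|z - x| < m by exact: lt_le_trans mr.
pose ty := dotp y nu; pose tz := dotp z nu.
pose y' := y - ty *: nu; pose z' := z - tz *: nu.
have gy : gam y' < ty by exact/(Oiff y ym).
have gz : gam z' < tz by exact/(Oiff z zm).
have nunu : dotp nu nu = 1.
  have : enorm nu ^+ 2 = 1 by rewrite nu1 expr1n.
  by rewrite enorm_sqr => <-; apply: eq_bigr => j _; rewrite expr2.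
have yz : `|z - y| <= 2 * r.
  rewrite -(subrKA x) (le_trans (ler_normD _ _))// mulr2n mulrDl mul1r lerD ?(ltW zr)//.
  by rewrite distrC ltW.
have tyz : `|tz - ty| <= D * (2 * r).
  by rewrite -dotpBl (le_trans (dotp_unit_le _ nu1))// ler_wpM2l.
have y'z' : `|z' - y'| <= (2 + 2 * D) * r.
  rewrite (_ : z' - y' = (z - y) - (tz - ty) *: nu); last first.
    by apply/rowP => j; rewrite !mxE; ring.
  rewrite (le_trans (ler_normB _ _))// mulrDl lerD//.
  rewrite normrZ -[leRHS]mulr1 ler_pM//.
  by rewrite (le_trans tyz)// mulrCA mulrA.
(* The common height at which the graph is passed. *)
pose T := Num.max ty tz + `|L| * (D * ((2 + 2 * D) * r)).
have Lpos : 0 <= `|L| * (D * ((2 + 2 * D) * r)).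
  apply: mulr_ge0 => //; apply: mulr_ge0 => //; apply: mulr_ge0; last exact: ltW.
  by rewrite addr_ge0 ?mulr_ge0.
have Ty : 0 <= T - ty <= K * r.
  rewrite subr_ge0 /T /K; move: tyz; rewrite ler_norml.
  by have [?|?] := leP ty tz; move=> /andP[? ?]; apply/andP; split; lra.
have Tz : 0 <= T - tz <= K * r.
  rewrite subr_ge0 /T /K; move: tyz; rewrite ler_norml.
  by have [?|?] := leP ty tz; move=> /andP[? ?]; apply/andP; split; lra.
pose p := y + (T - ty) *: nu; pose q := z + (T - tz) *: nu.
have up w (a b s : R) : `|w - x| < r -> 0 <= a <= K * r -> 0 <= s <= 1 -> b = s * a ->
    `|w + b *: nu - x| < m.
  move=> wr /andP[a0 aK] /andP[s0 s1] ->.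
  rewrite addrAC (le_lt_trans (ler_normD _ _))// -rK mulrDr mulr1 ltr_leD//.
  rewrite normrZ ger0_norm ?mulr_ge0// [leRHS]mulrC (le_trans _ aK)//.
  by rewrite -[leRHS]mulr1 ler_pM// ?mulr_ge0// -[leRHS]mul1r ler_wpM2r.
have shiftE w (b : R) : dotp (w + b *: nu) nu = dotp w nu + b /\
    (w + b *: nu) - dotp (w + b *: nu) nu *: nu = w - dotp w nu *: nu.
  have E : dotp (w + b *: nu) nu = dotp w nu + b by rewrite dotpDl dotpZl nunu mulr1.
  by split => //; rewrite E scalerDl opprD addrACA subrr addr0.
have vert w (a : R) : Omega w -> `|w - x| < r -> 0 <= a <= K * r ->
    seg_in (Omega `&` [set u | `|u - x| < e]) w (w + a *: nu).
  move=> Ow wr a0 s s01.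
  rewrite (_ : w + a *: nu - w = a *: nu); last by rewrite addrAC subrr add0r.
  rewrite scalerA; have wm := up w a (s * a) s wr a0 s01 erefl.
  have [we _] := near _ wm; split => //.
  apply/(Oiff _ wm); have [E1 ->] := shiftE w (s * a); rewrite E1.
  have : gam (w - dotp w nu *: nu) < dotp w nu by apply/(Oiff w (lt_le_trans wr mr)).
  move/lt_le_trans; apply; rewrite lerDl; case/andP: a0 => a0 _; case/andP: s01 => s0 _.
  by rewrite mulr_ge0.
have pm : `|p - x| < m by apply: (up y (T - ty) (T - ty) 1) => //; rewrite ?ler01 ?lexx ?mul1r.
have qm : `|q - x| < m by apply: (up z (T - tz) (T - tz) 1) => //; rewrite ?ler01 ?lexx ?mul1r.
exists p, q; split; [exact: vert| |].
  move=> s s01; set w := p + s *: (q - p).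
  have wm : `|w - x| < m by exact: (seg_in_ball pm qm s01).
  have [we _] := near _ wm; split => //.
  apply/(Oiff _ wm).
  have [pE1 pE2] := shiftE y (T - ty); have [qE1 qE2] := shiftE z (T - tz).
  have pT : dotp p nu = T by rewrite pE1 -/ty addrC subrK.
  have qT : dotp q nu = T by rewrite qE1 -/tz addrC subrK.
  have wT : dotp w nu = T by rewrite /w dotpDl dotpZl dotpBl pT qT subrr mulr0 addr0.
  have wE : w - T *: nu = y' + s *: (z' - y').
    have pE : p - T *: nu = y' by rewrite -[in LHS]pT; exact: pE2.
    have qE : q - T *: nu = z' by rewrite -[in LHS]qT; exact: qE2.
    by rewrite -pE -qE /w; apply/rowP => j; rewrite !mxE; ring.
  rewrite wT wE.
  have gw : `|gam (y' + s *: (z' - y')) - gam y'| <= `|L| * (D * ((2 + 2 * D) * r)).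
    rewrite (le_trans (gamL _ _))// (_ : y' + _ - y' = s *: (z' - y')); last by rewrite addrAC subrr add0r.
    rewrite (@le_trans _ _ (`|L| * enorm (s *: (z' - y'))))//.
      by rewrite ler_wpM2r ?enorm_ge0// ler_norm.
    rewrite ler_wpM2l// (le_trans (enorm_le _))// ler_wpM2l// normrZ.
    case/andP: s01 => s0 s1; rewrite ger0_norm// (le_trans _ y'z')//.
    by rewrite -[leRHS]mul1r ler_pM.
  move: gw; rewrite ler_norml /T => /andP[_ gw].
  have : ty <= Num.max ty tz by rewrite le_max lexx.
  lra.
have Oq := vert z (T - tz) Oz zr Tz; move=> s /andP[s0 s1].
have := Oq (1 - s); rewrite (_ : z + (1 - s) *: _ = q + s *: (z - q)); last first.
  by rewrite -/q; apply/rowP => j; rewrite !mxE; ring.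
by apply; rewrite subr_ge0 s1 lerBlDr lerDl.
Qed.

End lipschitz_domains.

(** * The energy form *)

Section quadratic_form.
Context {R : realType} {d : nat}.
Implicit Types (M : 'M[R]_d) (x y z : 'rV[R]_d).

Definition qform M x y : R := dotp (mulmv M x) y.

Lemma qformE M x y : qform M x y = \sum_(j < d) \sum_(i < d) x 0 i * M j i * y 0 j.
Proof.
apply: eq_bigr => j _; rewrite /mulmv mxE mulr_suml.
by apply: eq_bigr => i _; rewrite mxE.
Qed.

Lemma qform_linl M (c : R) x y z : qform M (c *: x + y) z = c * qform M x z + qform M y z.
Proof. by rewrite /qform /mulmv mulmxDl -scalemxAl dotpDl dotpZl. Qed.

Lemma qform_sym M x y : M^T = M -> qform M x y = qform M y x.
Proof.
move=> MT; rewrite !qformE exchange_big; apply: eq_bigr => i _; apply: eq_bigr => j _ /=.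
by rewrite -{1}MT mxE; ring.
Qed.

Lemma qform_unitv M i j : qform M (unitv i) (unitv j) = M j i.
Proof.
rewrite qformE (bigD1 j)//= (bigD1 i)//= !unitvE !eqxx mul1r mulr1.
rewrite big1 ?addr0 => [|i' i'i]; last by rewrite unitvE (negbTE i'i) !mul0r.
rewrite big1 ?addr0// => j' j'j; rewrite big1// => i' _.
by rewrite [unitv j 0 j']unitvE (negbTE j'j) mulr0.
Qed.

Lemma qform0 M x : qform M 0 x = 0.
Proof. by rewrite qformE big1// => j _; rewrite big1// => i _; rewrite mxE !mul0r. Qed.

(** Evaluate the form at the sums and differences of two coordinate vectors. *)
Lemma qform_entry_bound M (alpha beta : R) : 0 <= alpha -> M^T = M ->
  (forall x, alpha * enorm x ^+ 2 <= qform M x x <= beta * enorm x ^+ 2) ->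
  forall i j, `|M i j| <= beta.
Proof.
move=> a0 MT Mab i j.
have diag l : M l l <= beta.
  have /andP[_] := Mab (unitv l); rewrite qform_unitv enorm_sqr (bigD1 l)//= unitvE eqxx.
  rewrite big1 ?addr0 ?expr1n ?mulr1// => l' l'l.
  by rewrite unitvE (negbTE l'l) expr0n.
have Q x : 0 <= qform M x x.
  by have /andP[+ _] := Mab x; apply: le_trans; rewrite mulr_ge0// sqr_ge0.
have E (c : R) : qform M (c *: unitv i + unitv j) (c *: unitv i + unitv j) =
    c * (c * M i i + M i j) + (c * M i j + M j j).
  rewrite qform_linl (qform_sym (unitv i))// (qform_sym (unitv j))// !qform_linl !qform_unitv.
  by rewrite -[in M j i]MT mxE.
have := Q (1 *: unitv i + unitv j); have := Q ((-1) *: unitv i + unitv j); rewrite !E.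
have := diag i; have := diag j; rewrite ler_norml => h1 h2 h3 h4.
apply/andP; split; lra.
Qed.

End quadratic_form.

Section semi_inner_products.
Context {R : realType} {T : Type}.
Implicit Types (V : set (T -> R)) (a : (T -> R) -> (T -> R) -> R) (u v w : T -> R) (c : R).

Definition lin_closed V : Prop :=
  V (fun=> 0) /\ forall c u v, V u -> V v -> V (fun x => c * u x + v x).

Definition semi_inner V a : Prop :=
  [/\ forall c u v w, V u -> V v -> V w -> a (fun x => c * u x + v x) w = c * a u w + a v w,
      forall u v, V u -> V v -> a u v = a v u &
      forall u, V u -> 0 <= a u u].

Lemma semi_innerS V V' a : V' `<=` V -> semi_inner V a -> semi_inner V' a.
Proof.
by move=> V'V [al asym a0]; split=> *; [apply: al|apply: asym|apply: a0]; exact: V'V.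
Qed.

Lemma quadratic_discriminant (p q r : R) : 0 <= p ->
  (forall c, 0 <= c ^+ 2 * p + 2 * c * q + r) -> q ^+ 2 <= p * r.
Proof.
move=> p0 Q; have [p0'|p0'] := eqVneq p 0.
  have [->|q0] := eqVneq q 0; first by rewrite p0' mul0r expr0n.
  have := Q (- (r + 1) / (2 * q)).
  rewrite p0' mulr0 add0r (_ : 2 * _ * q = - (r + 1)); first lra.
  by field.
have pp : 0 < p by rewrite lt_neqAle eq_sym p0'.
have := Q (- q / p); rewrite (_ : _ + r = (p * r - q ^+ 2) / p); last by field.
by rewrite pmulr_lge0 ?invr_gt0// subr_ge0.
Qed.

Section with_form.
Variables (V : set (T -> R)) (a : (T -> R) -> (T -> R) -> R).
Hypotheses (VL : lin_closed V) (aV : semi_inner V a).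

Lemma lin_closedD u v : V u -> V v -> V (fun x => u x + v x).
Proof.
move=> Vu Vv; rewrite (_ : (fun x => _) = (fun x => 1 * u x + v x)); first exact: VL.2.
by apply/funext => x; rewrite mul1r.
Qed.

Lemma lin_closedB u v : V u -> V v -> V (fun x => u x - v x).
Proof.
move=> Vu Vv; rewrite (_ : (fun x => _) = (fun x => (- 1) * v x + u x)); first exact: VL.2.
by apply/funext => x; rewrite mulN1r addrC.
Qed.

Lemma lin_closedZ c u : V u -> V (fun x => c * u x).
Proof.
move=> Vu; rewrite (_ : (fun x => _) = (fun x => c * u x + 0)).
  by apply: VL.2 => //; exact: VL.1.
by apply/funext => x; rewrite addr0.
Qed.

Lemma lin_closed_sum (I : Type) (r : seq I) (P : pred I) (F : I -> T -> R) :
  (forall i, P i -> V (F i)) -> V (fun x => \sum_(i <- r | P i) F i x).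
Proof.
move=> VF; elim: r => [|i r IHr].
  by rewrite (_ : (fun x => _) = fun=> 0); [exact: VL.1|apply/funext => s; rewrite big_nil].
have [Pi|Pi] := boolP (P i).
  rewrite (_ : (fun s => _) = fun s => F i s + \sum_(i <- r | P i) F i s).
    by apply: lin_closedD => //; exact: VF.
  by apply/funext => s; rewrite big_cons Pi.
by rewrite (_ : (fun s => _) = fun s => \sum_(i <- r | P i) F i s)//; apply/funext => s; rewrite big_cons (negbTE Pi).
Qed.

Lemma form_linl c u v w : V u -> V v -> V w ->
  a (fun x => c * u x + v x) w = c * a u w + a v w.
Proof. by case: aV => + _ _; apply. Qed.

Lemma form_sym u v : V u -> V v -> a u v = a v u.
Proof. by case: aV => _ + _; apply. Qed.

Lemma form_ge0 u : V u -> 0 <= a u u.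
Proof. by case: aV => _ _; apply. Qed.

Lemma form_linr c u v w : V u -> V v -> V w ->
  a w (fun x => c * u x + v x) = c * a w u + a w v.
Proof.
move=> Vu Vv Vw; have Vuv := VL.2 c _ _ Vu Vv.
by rewrite form_sym// form_linl// (form_sym Vu Vw) (form_sym Vv Vw).
Qed.

Lemma form0l u : V u -> a (fun=> 0) u = 0.
Proof.
move=> Vu; have := form_linl (-1) VL.1 VL.1 Vu.
have -> : (fun=> -1 * 0 + 0) = (fun=> 0) :> (T -> R) by apply/funext => x; rewrite mulr0 addr0.
by rewrite mulN1r addNr.
Qed.

Lemma formZl c u w : V u -> V w -> a (fun x => c * u x) w = c * a u w.
Proof.
move=> Vu Vw; rewrite (_ : (fun x => _) = (fun x => c * u x + 0)).
  by rewrite form_linl ?form0l ?addr0//; exact: VL.1.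
by apply/funext => x; rewrite addr0.
Qed.

Lemma formDl u v w : V u -> V v -> V w -> a (fun x => u x + v x) w = a u w + a v w.
Proof.
move=> Vu Vv Vw; rewrite (_ : (fun x => _) = (fun x => 1 * u x + v x)).
  by rewrite form_linl// mul1r.
by apply/funext => x; rewrite mul1r.
Qed.

Lemma formBl u v w : V u -> V v -> V w -> a (fun x => u x - v x) w = a u w - a v w.
Proof.
move=> Vu Vv Vw; rewrite (_ : (fun x => _) = (fun x => (- 1) * v x + u x)).
  by rewrite form_linl// mulN1r addrC.
by apply/funext => x; rewrite mulN1r addrC.
Qed.

Lemma form_suml (I : Type) (r : seq I) (P : pred I) (F : I -> T -> R) w :
  (forall i, P i -> V (F i)) -> V w ->
  a (fun x => \sum_(i <- r | P i) F i x) w = \sum_(i <- r | P i) a (F i) w.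
Proof.
move=> VF Vw; elim: r => [|i r IHr].
  rewrite big_nil (_ : (fun x => _) = fun=> 0) ?form0l//.
  by apply/funext => s; rewrite big_nil.
rewrite big_cons -IHr; have [Pi|Pi] := boolP (P i).
  rewrite (_ : (fun s => _) = fun s => F i s + \sum_(i <- r | P i) F i s).
    by rewrite formDl//; [exact: VF|exact: lin_closed_sum].
  by apply/funext => s; rewrite big_cons Pi.
congr (a _ _); apply/funext => s; by rewrite big_cons (negbTE Pi).
Qed.

Lemma form_quad c u v : V u -> V v ->
  a (fun x => c * u x + v x) (fun x => c * u x + v x) =
  c ^+ 2 * a u u + 2 * c * a u v + a v v.
Proof.
move=> Vu Vv; have Vuv := VL.2 c _ _ Vu Vv.
by rewrite form_linl// !form_linr// (form_sym Vv Vu); ring.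
Qed.

Lemma form_cauchy u v : V u -> V v -> a u v ^+ 2 <= a u u * a v v.
Proof.
move=> Vu Vv; apply: quadratic_discriminant => [|c]; first exact: form_ge0.
by rewrite -form_quad//; apply: form_ge0; exact: VL.2.
Qed.

Lemma form_triangle u v : V u -> V v ->
  Num.sqrt (a (fun x => u x + v x) (fun x => u x + v x)) <= Num.sqrt (a u u) + Num.sqrt (a v v).
Proof.
move=> Vu Vv.
rewrite (_ : (fun x => u x + v x) = (fun x => 1 * u x + v x)); last first.
  by apply/funext => x; rewrite mul1r.
rewrite form_quad//.
have := form_cauchy Vu Vv; have := form_ge0 Vu; have := form_ge0 Vv.
move: (a u u) (a u v) (a v v) => p q r r0 p0 qpr.
rewrite -[leRHS]ger0_norm ?addr_ge0 ?sqrtr_ge0// -sqrtr_sqr ler_wsqrtr//.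
rewrite sqrrD !sqr_sqrtr// expr1n mul1r mulr1 lerD2r lerD2l -[leRHS]mulr_natl ler_wpM2l//.
by rewrite -sqrtrM// (le_trans (ler_norm _))// -sqrtr_sqr ler_wsqrtr.
Qed.

End with_form.
End semi_inner_products.

Section energy.
Context {R : realType} {d : nat}.
Variables (Omega : set 'rV[R]_d) (A : 'rV[R]_d -> 'M[R]_d) (alpha beta : R).
Hypothesis oOmega : open Omega.
Hypothesis bOmega : bounded_set Omega.
Hypothesis hA : coefficient Omega A alpha beta.
Let leb : {measure set 'rV[R]_d -> \bar R} := lebesgue_rV d.
Implicit Types (O : set 'rV[R]_d) (u v w : 'rV[R]_d -> R) (x : 'rV[R]_d).
Implicit Types (G H : 'rV[R]_d -> 'rV[R]_d).

Lemma bounded_sub O : O `<=` Omega -> bounded_set O.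
Proof. by move=> OO; apply: sub_boundedr bOmega => x Ax; exact: subset_trans OO Ax. Qed.

Lemma coefficient_sym O x y z : O `<=` Omega -> O x -> qform (A x) y z = qform (A x) z y.
Proof. by move=> OO Ox; apply: qform_sym; case: hA => _ _ + _; apply; exact: OO. Qed.

Lemma coefficient_ge0 O x y : O `<=` Omega -> O x -> 0 <= qform (A x) y y.
Proof.
move=> OO Ox; case: hA => /andP[a0 _] _ _ /(_ _ (OO _ Ox) y)/andP[+ _].
by apply: le_trans; rewrite mulr_ge0 ?sqr_ge0// ltW.
Qed.

Lemma qform_integrable O G H : open O -> O `<=` Omega ->
  (forall j, L2 O (fun x => G x 0 j)) -> (forall j, L2 O (fun x => H x 0 j)) ->
  leb.-integrable O (EFin \o (fun x => qform (A x) (G x) (H x))).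
Proof.
move=> oO OO G2 H2; have mO := open_measurable_rV oO.
case: hA => /andP[a0 _] Am At Ab.
have int j i : leb.-integrable O (EFin \o (fun x => G x 0 i * A x j i * H x 0 j)).
  apply: L2_mul_integrable => //.
  rewrite (_ : (fun x => _) = fun x => A x j i * G x 0 i); last by apply/funext => x; rewrite mulrC.
  apply: (L2_bounded_mul (C := beta)) => //.
    by have [mA _] := Am j i; apply: (measurable_funS _ OO mA); exact: open_measurable_rV.
  by move=> x /OO Ox; apply: (qform_entry_bound (ltW a0) (At x Ox) (Ab x Ox)).
have := @integrable_sum _ _ _ leb O mO _ (index_enum 'I_d) xpredT
  (fun j x => \sum_(i <- index_enum 'I_d | xpredT i) (G x 0 i * A x j i * H x 0 j)%:E)%E.
rewrite (_ : (fun x => _) = EFin \o (fun x => qform (A x) (G x) (H x))); last first.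
  apply/funext => x /=; rewrite qformE -sumEFin; apply: eq_bigr => j _; by rewrite -sumEFin.
apply=> j _.
by apply: integrable_sum => // i _; exact: int.
Qed.

Lemma aformE O u v G H : open O -> O `<=` Omega ->
  is_weak_gradient O u G -> is_weak_gradient O v H ->
  aform A O u v = \int[leb]_(x in O) qform (A x) (G x) (H x).
Proof.
move=> oO OO uG vH; have mO := open_measurable_rV oO.
have wuG : is_weak_gradient O u (wgrad O u).
  by rewrite /wgrad; case: xgetP => [? -> //|/(_ G)].
have wvH : is_weak_gradient O v (wgrad O v).
  by rewrite /wgrad; case: xgetP => [? -> //|/(_ H)].
have bO := bounded_sub OO.
apply: ae_eq_Rintegral => //.
- by apply/measurable_EFinP; case/integrableP: (qform_integrable oO OO wuG.1 wvH.1).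
- by apply/measurable_EFinP; case/integrableP: (qform_integrable oO OO uG.1 vH.1).
- have := is_weak_gradient_unique oO bO wuG uG; have := is_weak_gradient_unique oO bO wvH vH.
  by apply: filterS2 => x eH eG Ox; rewrite -eH// -eG.
Qed.

Lemma aform_eq O u u' v v' : {in O, u =1 u'} -> {in O, v =1 v'} -> aform A O u v = aform A O u' v'.
Proof. by move=> uu' vv'; rewrite /aform (wgrad_eq uu') (wgrad_eq vv'). Qed.

Lemma aform_sym O u v : O `<=` Omega -> aform A O u v = aform A O v u.
Proof.
move=> OO; apply: eq_Rintegral => x /set_mem Ox; exact: (coefficient_sym _ _ OO).
Qed.

Lemma aform_ge0 O u : O `<=` Omega -> 0 <= aform A O u u.
Proof. by move=> OO; apply: Rintegral_ge0 => x Ox; exact: (coefficient_ge0 _ OO). Qed.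

Lemma aform_linl O (c : R) u v w : open O -> O `<=` Omega -> H1 O u -> H1 O v -> H1 O w ->
  aform A O (fun x => c * u x + v x) w = c * aform A O u w + aform A O v w.
Proof.
move=> oO OO uH vH wH; have mO := open_measurable_rV oO; have bO := bounded_sub OO.
have [gu gv gw] := And3 (wgradP uH) (wgradP vH) (wgradP wH).
rewrite (aformE oO OO (is_weak_gradient_lin c oO bO uH.1 vH.1 gu gv) gw).
have int f g : is_weak_gradient O f (wgrad O f) -> is_weak_gradient O g (wgrad O g) ->
   leb.-integrable O (EFin \o (fun x => qform (A x) (wgrad O f x) (wgrad O g x))).
  by move=> gf gg; exact: qform_integrable oO OO gf.1 gg.1.
rewrite -RintegralZl//; last exact: int.
rewrite -RintegralD//.
- by apply: eq_Rintegral => x _; rewrite qform_linl.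
- rewrite (_ : EFin \o _ = (fun x => c%:E * (EFin \o (fun x => qform (A x) (wgrad O u x) (wgrad O w x))) x)%E)//.
  by apply: integrableZl => //; exact: int.
- exact: int.
Qed.

Lemma H1_lin_closed O : open O -> O `<=` Omega -> lin_closed (@H1 R d O).
Proof.
move=> oO OO; have mO := open_measurable_rV oO; have bO := bounded_sub OO.
have L0 : L2 O (fun=> 0).
  by apply: (bounded_L2 (C := 0)) => //; [exact: bounded_open_fin|move=> x _; rewrite normr0].
split; last by move=> c u v; exact: H1_lin.
split=> //; exists (fun=> 0); split=> [j|f _ j].
  by apply: L2_eq L0 => x _; rewrite mxE.
rewrite [X in - X](_ : _ = 0) ?oppr0.
  by under eq_Rintegral do rewrite mul0r; rewrite Rintegral_cst// mul0r.
by under eq_Rintegral do rewrite mxE mul0r; rewrite Rintegral_cst// mul0r.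
Qed.

Lemma aform_semi_inner O : open O -> O `<=` Omega -> semi_inner (@H1 R d O) (aform A O).
Proof.
move=> oO OO; split=> [c u v w uH vH wH|u v _ _|u _]; first exact: aform_linl.
  exact: aform_sym.
exact: aform_ge0.
Qed.

End energy.

(** * Extension by zero *)

Section zero_extension.
Context {R : realType} {d : nat}.
Variables (Omega GamD GamN : set 'rV[R]_d) (k : cell_kind) (sigma h : R) (N : nat) (tau : 'I_N -> @cell R d).
Variables (A : 'rV[R]_d -> 'M[R]_d) (alpha beta : R).
Hypothesis oOmega : open Omega.
Hypothesis bOmega : bounded_set Omega.
Hypothesis lOmega : lipschitz_boundary Omega.
Hypothesis htau : triangulation k Omega sigma h tau.
Hypothesis hDN : closure GamD `|` closure GamN = bd Omega.
Hypothesis hA : coefficient Omega A alpha beta.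
Let leb : {measure set 'rV[R]_d -> \bar R} := lebesgue_rV d.
Implicit Types (u v w : 'rV[R]_d -> R) (x y z : 'rV[R]_d) (O : set 'rV[R]_d).

Lemma closure_rVP O x : closure O x <-> forall r : R, 0 < r -> exists2 y, O y & `|y - x| < r.
Proof.
split=> [cx r r0|H B /nbhs_rVP[r r0 rB]].
  have [|y [Oy /= yr]] := cx [set y | `|y - x| < r]; last by exists y.
  by apply/nbhs_rVP; exists r.
by have [y Oy yr] := H r r0; exists y; split => //; exact: rB.
Qed.

Lemma GamD_bd x : GamD x -> bd Omega x.
Proof. by move=> Gx; rewrite -hDN; left; exact: subset_closure. Qed.

Lemma GamD_notin x : GamD x -> ~ Omega x.
Proof. by move=> /GamD_bd[_]; rewrite (interior_id _).1. Qed.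

(** A short path in the domain from O to the outside of its closure crosses the
    boundary of O. *)
Lemma bd_near O x (e : R) : open O -> O `<=` Omega -> closure O x ->
  (forall r : R, 0 < r -> exists y, [/\ closure Omega y, ~ closure O y & `|y - x| < r]) ->
  0 < e -> exists p, [/\ bd O p, Omega p & `|p - x| < e].
Proof.
move=> oO OO cx nx e0.
have cOx : closure Omega x by exact: closureS OO _ cx.
have [r r0 H] := lipschitz_path oOmega lOmega cOx e0.
have [z Oz zr] := (closure_rVP O x).1 cx r r0.
have [y0 [cy0 ny0 y0r]] := nx r r0.
have [r' r'0 y0r'] : exists2 r' : R, 0 < r' & forall y, `|y - y0| < r' -> ~ closure O y.
  have := closed_openC (@closed_closure _ O); move=> /open_rVP/(_ ny0) [r' r'0 Hr'].
  by exists r' => // y /Hr'.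
have m0 : 0 < Num.min r' (r - `|y0 - x|) by rewrite lt_min r'0 subr_gt0.
have [y Oy] := (closure_rVP Omega y0).1 cy0 _ m0.
rewrite lt_min => /andP[/y0r' ny yy0].
have yr : `|y - x| < r by rewrite -(subrKA y0) (le_lt_trans (ler_normD _ _))// -ltrBrDr.
have nOy : ~ O y by move=> /subset_closure.
have [p [q [s1 s2 s3]]] := H z y (OO _ Oz) Oy zr yr.
suff [a [b [sab Oa Ob]]] : exists a b, [/\ seg_in (Omega `&` [set w | `|w - x| < e]) a b, O a & ~ O b].
  by have [s s01 bs] := seg_exit oO Oa Ob; have [Op pe] := sab s s01; eexists; split; [exact: bs| |].
have [Op|nOp] := pselect (O p); last by exists z, p.
have [Oq|nOq] := pselect (O q); last by exists p, q.
by exists q, y.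
Qed.

(** The interiors are disjoint, and the interior of a cell is dense in it. *)
Lemma cell_interior_disj i j x : i != j -> cell_interior k (tau i) x -> ~ cell_set k (tau j) x.
Proof.
move=> ij xi xj; have [ui uj] := (tau_unit htau i, tau_unit htau j).
have [r r0 xr] := open_rVP (@open_cell_interior _ _ k (tau i)) xi.
have [y yj yx] := cell_interior_dense uj xj r0.
have sub l z : cell_interior k (tau l) z -> interior (cell_set k (tau l)) z.
  move=> zl; have := @open_cell_interior _ _ k (tau l); rewrite openE => /(_ _ zl).
  by apply: filterS; apply: cell_interior_sub; exact: tau_unit htau l.
case: htau => -[_ _ /(_ i j ij) /= [ij0 _]] _.
have : (interior (cell_set k (tau i)) `&` interior (cell_set k (tau j))) y.
  by split; apply: sub => //; exact: xr.
by rewrite ij0.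
Qed.

Section resolved_subdomain.
Variable O : set 'rV[R]_d.
Hypotheses (oO : open O) (OO : O `<=` Omega) (hO : resolved k tau O).

Lemma VhDI_zero v x : VhDI Omega GamD k tau O v -> closure O x ->
  (forall r : R, 0 < r -> exists y, [/\ closure Omega y, ~ closure O y & `|y - x| < r]) ->
  v x = 0.
Proof.
move=> [[w [/within_continuousP cw _] vw] v0] cx nx; rewrite vw//.
have cOx : closure Omega x by exact: closureS OO _ cx.
apply/eqP/negPn/negP => wx.
have [|r r0 H] := cw x `|w x| cOx; first by rewrite normr_gt0.
have [p [bp Op pr]] := bd_near oO OO cx nx r0.
have := H p (subset_closure Op) pr.
by rewrite -vw ?v0 ?sub0r ?normrN ?ltxx//; [right|case: bp].
Qed.

(** Continuity is at stake only at the points of the closure of O that the rest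
    of the domain approaches, and there v vanishes.  A cell outside of O has its
    interior outside of O, so that all of its points in the closure of O are of
    this kind. *)
Lemma ext0_Vh v : VhDI Omega GamD k tau O v -> Vh Omega k tau (ext0 O v).
Proof.
move=> vDI; have [[w [cw wV] vw] v0] := vDI.
have zin x : closure O x -> ext0 O v x = v x by move=> cx; rewrite /ext0 mem_set.
have zout x : ~ closure O x -> ext0 O v x = 0 by move=> cx; rewrite /ext0 memNset.
split.
  move: cw => /within_continuousP cw; apply/within_continuousP => x e cOx e0.
  have [cx|ncx] := pselect (closure O x); last first.
    have := closed_openC (@closed_closure _ O); move=> /open_rVP/(_ ncx)[r r0 Hr].
    by exists r => // y _ /Hr nyx; rewrite !zout// subrr normr0.
  have [r r0 Hr] := cw x e cOx e0.
  have [nx|] := pselect (forall r : R, 0 < r -> exists y, [/\ closure Omega y, ~ closure O y & `|y - x| < r]).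
    have vx := VhDI_zero vDI cx nx.
    exists r => // y cy yr; rewrite (zin x)// vx subr0.
    have [cOy|ncy] := pselect (closure O y); last by rewrite zout ?normr0.
    have := Hr y cy yr; by rewrite -!vw// vx subr0 zin.
  move=> /existsNP[r' /not_implyP[r'0 Hr']].
  exists (Num.min r r'); first by rewrite lt_min r0.
  move=> y cy; rewrite lt_min => /andP[yr yr'].
  have [cOy|ncy] := pselect (closure O y); last by case: Hr'; exists y.
  by rewrite !zin// !vw//; exact: Hr.
move=> i; have [S cS] := hO.
have [p pS pE] := wV i.
have [Si|nSi] := pselect (S i).
  exists p => // s ks; have cx : closure O (cell_map (tau i) s) by rewrite cS; exists i => //; exists s.
  by rewrite zin// vw// pE.
exists (fun s => (-1) * p s + p s); first exact: shape_lin.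
move=> s ks; rewrite mulN1r addNr; set x := cell_map _ s.
have xi : cell_set k (tau i) x by exists s.
have [cx|] := pselect (closure O x); last exact: zout.
rewrite zin//; apply: VhDI_zero => // r r0.
have [y yi yr] := cell_interior_dense (tau_unit htau i) xi r0.
exists y; split => //.
  by apply/(closure_cover htau); exists i; exact: (cell_interior_sub (tau_unit htau i)).
rewrite cS => -[j Sj]; apply: (@cell_interior_disj i j) => //.
by apply/eqP => ij; apply: nSi; rewrite ij.
Qed.

Lemma ext0_GamD v x : VhDI Omega GamD k tau O v -> GamD x -> ext0 O v x = 0.
Proof.
move=> [_ v0] Gx; rewrite /ext0; case: ifPn => // /set_mem cx.
apply: v0; last by left.
split=> //; rewrite (interior_id _).1// => /OO; exact: GamD_notin.
Qed.

Lemma ext0_out v x : VhDI Omega GamD k tau O v -> Omega x -> ~ O x -> ext0 O v x = 0.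
Proof.
move=> [_ v0] Ox nx; rewrite /ext0; case: ifPn => // /set_mem cx.
apply: v0; last by right.
by split=> //; rewrite (interior_id _).1.
Qed.

Lemma ext0_in v : {in O, ext0 O v =1 v}.
Proof. by move=> x /set_mem Ox; rewrite /ext0 mem_set//; exact: subset_closure. Qed.

Lemma load_ext0 f g v : VhDI Omega GamD k tau O v ->
  load Omega GamN f g Omega (ext0 O v) = load Omega GamN f g O v.
Proof.
move=> vDI.
have E1 : ext0 Omega (ext0 O v) = ext0 O v.
  apply/funext => x; rewrite {1}/ext0; case: ifPn => // /negP nx.
  rewrite /ext0 memNset// => cx; apply: nx; exact/mem_set/(closureS OO).
have E2 : \int[leb]_(x in Omega) (f x * ext0 O v x) = \int[leb]_(x in O) (f x * v x).
  rewrite (@Rintegral_support _ _ _ leb Omega O)//; last first.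
    by move=> x Ox nx; rewrite ext0_out// mulr0.
  by apply: eq_Rintegral => x Ox; rewrite ext0_in.
by rewrite /load E1 E2.
Qed.

(** The extension has zero gradient almost everywhere outside of O, as it is
    zero there; the boundary of O may have positive measure. *)
Lemma aform_ext0 u v : H1 Omega u -> VhDI Omega GamD k tau O v ->
  aform A Omega u (ext0 O v) = aform A O u v.
Proof.
move=> uH vDI; have zV := ext0_Vh vDI; have zH := Vh_H1 oOmega bOmega htau zV.
have [G [C [wG _ _ G0]]] := Vh_weak_gradient oOmega bOmega htau zV.
have gu := wgradP uH.
have [mO mOmega] := (open_measurable_rV oO, open_measurable_rV oOmega).
rewrite (aformE oOmega bOmega hA oOmega (@subset_refl _ Omega) gu wG).
pose F x := qform (A x) (wgrad Omega u x) (G x).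
have gz := is_weak_gradient_sub oOmega oO OO wG.
have gz' : is_weak_gradient O v G.
  by apply: is_weak_gradient_eq gz; exact: ext0_in.
have gu' := is_weak_gradient_sub oOmega oO OO gu.
rewrite (aformE oOmega bOmega hA oO OO gu' gz').
have intO := qform_integrable oOmega hA oO OO gu'.1 gz.1.
have intOm := qform_integrable oOmega hA oOmega (@subset_refl _ Omega) gu.1 wG.1.
have mF : measurable_fun Omega (F \_ O).
  have := iffLR (integrable_mkcond _ mO) intO; rewrite restrict_EFin => /integrableP[/measurable_EFinP mF _].
  exact: measurable_funS mF.
transitivity (\int[leb]_(x in Omega) (F \_ O) x).
  apply: ae_eq_Rintegral => //; first by apply/measurable_EFinP; case/integrableP: intOm.
  apply: filterS G0 => x G0 Ox; rewrite patchE; case: ifPn => // /negP nx.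
  rewrite G0 ?ext0_out//; last by move=> Ox'; apply: nx; exact: mem_set.
  by rewrite (coefficient_sym hA _ _ (@subset_refl _ Omega) Ox) qform0.
rewrite (@Rintegral_support _ _ _ leb Omega O)//; last by move=> x Ox nx; rewrite patchE memNset.
by apply: eq_Rintegral => x xO; rewrite patchE xO.
Qed.

End resolved_subdomain.
End zero_extension.

(** * Regularity of the partition of unity *)

Section partition_of_unity_regularity.
Context {R : realType} {d : nat}.
Variables (Omega : set 'rV[R]_d) (M : nat) (omega : 'I_M -> set 'rV[R]_d) (C1 : R).
Variable chi : 'I_M -> 'rV[R]_d -> R.
Hypothesis oOmega : open Omega.
Hypothesis bOmega : bounded_set Omega.
Hypothesis homega : open_cover Omega omega.
Hypothesis hchi : partition_of_unity Omega omega C1 chi.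
Let leb : {measure set 'rV[R]_d -> \bar R} := lebesgue_rV d.
Implicit Types (u v w : 'rV[R]_d -> R) (x y z : 'rV[R]_d).

Lemma omega_sub i : omega i `<=` Omega.
Proof. by case: homega => _ <- x ix; exists i. Qed.

Lemma omega_open i : open (omega i).
Proof. by case: homega => + _; apply. Qed.

Lemma chi_ge0 i x : Omega x -> 0 <= chi i x <= 1.
Proof. by case: hchi => + _ _ _ _; apply. Qed.

Lemma chi_out i x : Omega x -> ~ omega i x -> chi i x = 0.
Proof. by case: hchi => _ _ + _ _; apply. Qed.

Lemma chi_C1 i : C1_on (omega i) (chi i).
Proof. by case: hchi => _ _ _ + _; apply. Qed.

Definition chi_grad i : R := `|C1 / diam (omega i)|.

Lemma chi_grad_ge0 i : 0 <= chi_grad i.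
Proof. exact: normr_ge0. Qed.

Lemma chi_grad_le i x j : omega i x -> `|'D_(unitv j) (chi i) x| <= chi_grad i.
Proof.
move=> ix; rewrite -gradientE (le_trans (coord_le_enorm _ _))//.
case: hchi => _ _ _ _ /(_ i x ix)/le_trans; apply; exact: ler_norm.
Qed.

Lemma continuous_rV_sum (I : Type) (r : seq I) (P : pred I) (F : I -> 'rV[R]_d -> R) x :
  (forall i, P i -> {for x, continuous (F i)}) ->
  {for x, continuous (fun y => \sum_(i <- r | P i) F i y)}.
Proof.
move=> cF; elim: r => [|i r IHr].
  by rewrite (_ : (fun y => _) = fun=> 0); [exact: continuous_rV_cst|apply/funext => s; rewrite big_nil].
have [Pi|Pi] := boolP (P i).
  rewrite (_ : (fun s => _) = fun s => F i s + \sum_(i <- r | P i) F i s).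
    by apply: continuous_rVD => //; exact: cF.
  by apply/funext => s; rewrite big_cons Pi.
by rewrite (_ : (fun s => _) = fun s => \sum_(i <- r | P i) F i s)//; apply/funext => s; rewrite big_cons (negbTE Pi).
Qed.

(** At a point outside omega_i, the functions of the other patches through
    that point are continuous and already sum to 1, which leaves nothing for
    chi_i. *)
Lemma chi_continuous i x : Omega x -> {for x, continuous (chi i)}.
Proof.
move=> Ox; have [ix|nix] := pselect (omega i x).
  exact: (C1_on_continuous (@omega_open i) (@chi_C1 i) ix).
pose P := [pred j | x \in omega j].
have cS : {for x, continuous (fun y => \sum_(j | P j) chi j y)}.
  apply: continuous_rV_sum => j /set_mem jx.
  exact: (C1_on_continuous (@omega_open j) (@chi_C1 j) jx).
have Sx : \sum_(j | P j) chi j x = 1.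
  have <- : \sum_(j < M) chi j x = 1 by case: hchi => _ + _ _ _; apply.
  rewrite [RHS](bigID P)/= [X in _ + X]big1 ?addr0// => j /negP nj.
  by apply: chi_out => // jx; apply: nj; exact: mem_set.
apply/continuous_rVP => e e0.
have /continuous_rVP/(_ e e0)[r r0 xr] := cS.
have [r' r'0 xr'] := open_rVP oOmega Ox.
exists (Num.min r r'); first by rewrite lt_min r0.
move=> y; rewrite lt_min => /andP[/xr yr /xr' Oy].
rewrite (chi_out Ox nix) subr0; have /andP[c0 _] := chi_ge0 i Oy; rewrite ger0_norm//.
move: yr; rewrite Sx ltr_norml => /andP[yr _].
have Sy : \sum_(j < M) chi j y = 1 by case: hchi => _ + _ _ _; apply.
have : chi i y + \sum_(j | P j) chi j y <= 1.
  rewrite -Sy [leRHS](bigID P)/= [leRHS]addrC lerD2r.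
  rewrite (bigD1 i)/=; last by apply/negP => /set_mem.
  by rewrite lerDl sumr_ge0// => j _; have /andP[] := chi_ge0 j Oy.
lra.
Qed.

Definition chi_lip i : R := d%:R * chi_grad i.

Lemma chi_lip_ge0 i : 0 <= chi_lip i.
Proof. by rewrite mulr_ge0// chi_grad_ge0. Qed.

(** Where chi_i is positive, a neighbourhood lies in omega_i and the gradient
    bound applies; nothing is required where chi_i vanishes. *)
Lemma chi_seg_lip i x y : seg_in Omega x y -> `|chi i y - chi i x| <= chi_lip i * `|y - x|.
Proof.
suff H a b : seg_in Omega a b -> chi i b <= chi i a + chi_lip i * `|b - a|.
  move=> xy; have yx : seg_in Omega y x.
    move=> s /andP[s0 s1]; have := xy (1 - s).
    rewrite (_ : x + (1 - s) *: _ = y + s *: (x - y)); last by apply/rowP => j; rewrite !mxE; ring.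
    by apply; rewrite subr_ge0 s1 lerBlDr lerDl.
  have h1 := H x y xy; have := H y x yx; rewrite distrC => h2.
  rewrite ler_norml; apply/andP; split; lra.
move=> ab.
pose p (t : R) := a + t *: (b - a).
have pB (s t : R) : p s - p t = (s - t) *: (b - a) by rewrite /p opprD addrACA subrr add0r -scalerBl.
have p0 : p 0 = a by rewrite /p scale0r addr0.
have p1 : p 1 = b by rewrite /p scale1r addrC subrK.
have := @dini_growth R (chi i \o p) (chi_lip i * `|b - a|) 0.
rewrite /= p0 p1; apply.
- by rewrite mulr_ge0// chi_lip_ge0.
- by have /andP[] := chi_ge0 i (seg_in_l ab).
- move=> t e t01 e0.
  have /continuous_rVP/(_ e e0)[r r0 pr] := @chi_continuous i _ (ab t t01).
  exists (r / (`|b - a| + 1)); first by rewrite divr_gt0// ltr_wpDl.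
  move=> s s01; rewrite ltr_pdivlMr ?ltr_wpDl// => st.
  apply: pr; rewrite -/(p s) -/(p t) pB normrZ (le_lt_trans _ st)// ler_wpM2l// lerDl//.
- move=> t r /andP[t0 t1] ht r0.
  have Ot : Omega (p t) by apply: ab; rewrite t0 ltW.
  have it : omega i (p t).
    by apply: contrapT => nit; move: ht; rewrite (chi_out Ot nit) ltxx.
  have [e e0 pe] := open_rVP (@omega_open i) it.
  pose s := t + Num.min (Num.min (1 - t) (r / 2)) (e / (`|b - a| + 1) / 2).
  have K0 : 0 < `|b - a| + 1 by rewrite ltr_wpDl.
  have ts : t < s by rewrite ltrDl !lt_min subr_gt0 t1 !divr_gt0.
  have sr : s < t + r.
    by rewrite ltrD2l !gt_min (ltr_pdivrMr _ _ (ltr0n _ 2))// ltr_pMr// ltr1n orbT.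
  have s1 : s <= 1 by rewrite -lerBrDl !ge_min lexx.
  have se : (s - t) * (`|b - a| + 1) < e.
    rewrite -ltr_pdivlMr// /s addrC addKr gt_min; apply/orP; right.
    by rewrite ltr_pdivrMr// ltr_pMr ?divr_gt0// ltr1n.
  exists s; first by rewrite ts.
  split => //; rewrite -/(p s) -/(p t).
  have st : `|p s - p t| < e.
    rewrite pB normrZ ger0_norm ?subr_ge0 ?(ltW ts)//; apply: le_lt_trans se.
    by rewrite ler_wpM2l ?subr_ge0 ?(ltW ts)// lerDl.
  have := @partials_lip R d (chi i) (p t) e (chi_grad i) (normr_ge0 _) _ (p t) (p s).
  rewrite -ball_normE /= subrr normr0 distrC st => H.
  have {}H : `|chi i (p s) - chi i (p t)| <= d%:R * chi_grad i * `|p s - p t|.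
    apply: H => // z; rewrite distrC => /pe iz j.
    by split; [have [] := @chi_C1 i z iz j|exact: chi_grad_le].
  move: H; rewrite pB normrZ ger0_norm ?subr_ge0 ?(ltW ts)//.
  move=> /(le_trans (ler_norm _)); rewrite lerBlDl => /le_trans; apply.
  by rewrite lerD2l -/(chi_lip i) mulrCA mulrC.
Qed.

(** Near a point outside of omega_i, chi_i is at most linear in the distance to
    the point, hence soft n (chi_i) of third order. *)
Lemma soft_chi_derive n i x j : Omega x ->
  is_derive x (unitv j) (soft n \o chi i)
    (if x \in omega i then dsoft n (chi i x) * 'D_(unitv j) (chi i) x else 0).
Proof.
move=> Ox; case: ifPn => [/set_mem ix|nix].
  apply: is_derive_comp1; last exact: is_derive_soft.
  by apply/derivableP; have [] := @chi_C1 i x ix j.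
have {}nix : ~ omega i x by move=> /mem_set; exact/negP.
have [r r0 xr] := open_rVP oOmega Ox.
rewrite -[x]addr0 -(scale0r (unitv j)); apply/is_derive_line.
pose g (t : R) := soft n (chi i (x + t *: unitv j)).
pose g' (t : R) := if `|t| < r then g t else 0.
apply: (@near_eq_is_derive _ _ _ g').
  apply/nbhs_ballP; exists r => //= t; rewrite /ball /= sub0r normrN => tr.
  by rewrite /g' tr.
have L0 := chi_lip_ge0 i.
apply: (@is_derive_quad _ _ _ _ (n%:R * chi_lip i ^+ 3 * r)) => t.
have g0 : g' 0 = 0 by rewrite /g' normr0 r0 /g scale0r addr0 (chi_out Ox nix) soft0.
rewrite add0r g0 mul0r !subr0 /g'; case: ifPn => [tr|_]; last first.
  rewrite normr0; apply: mulr_ge0; last exact: sqr_ge0.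
  by apply: mulr_ge0; [apply: mulr_ge0 => //; exact: exprn_ge0|exact: ltW].
have lipt : `|chi i (x + t *: unitv j)| <= chi_lip i * `|t|.
  have := @chi_seg_lip i x (x + t *: unitv j).
  have -> : x + t *: unitv j - x = t *: unitv j by rewrite addrAC subrr add0r.
  rewrite (chi_out Ox nix) subr0 => H; rewrite (le_trans (H _))//; last first.
    by rewrite ler_wpM2l// norm_scale_unitv.
  move=> s /andP[s0 s1]; apply: xr.
  rewrite (_ : _ - x = s *: (t *: unitv j)); last by apply/rowP => l; rewrite !mxE; ring.
  rewrite scalerA (le_lt_trans (norm_scale_unitv _ _))// normrM ger0_norm//.
  by rewrite (le_lt_trans _ tr)// ler_piMl.
rewrite /g /soft normrM.
have softle (s : R) : `|sat n s| <= n%:R * `|s| ^+ 2.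
  have /andP[s0 _] := sat_bound n s; rewrite ger0_norm// real_normK ?num_real//.
  rewrite /sat ler_pdivrMr ?sat_den// ler_peMr//.
    by apply: mulr_ge0 => //; exact: sqr_ge0.
  by rewrite lerDl; apply: mulr_ge0 => //; exact: sqr_ge0.
rewrite (@le_trans _ _ ((chi_lip i * `|t|) * (n%:R * (chi_lip i * `|t|) ^+ 2)))//.
  rewrite ler_pM// (le_trans (softle _))// ler_wpM2l// lerXn2r// nnegrE// mulr_ge0//.
rewrite (_ : _ * _ = n%:R * chi_lip i ^+ 3 * `|t| * `|t| ^+ 2); last ring.
rewrite real_normK ?num_real// ler_wpM2r ?sqr_ge0// ler_wpM2l ?(ltW tr)//.
by rewrite mulr_ge0 ?exprn_ge0.
Qed.

Lemma soft_chi_C1 n i : C1_on Omega (soft n \o chi i).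
Proof.
apply: (C1_on_intro oOmega (fun x j => @soft_chi_derive n i x j)) => x j Ox.
have [ix|nix] := pselect (omega i x).
  have cD : {for x, continuous (fun y => dsoft n (chi i y) * 'D_(unitv j) (chi i) y)}.
    apply: continuous_rVM; last by have [] := @chi_C1 i x ix j.
    by apply: continuous_rV_comp; [exact: chi_continuous|exact: continuous_dsoft].
  apply/continuous_rVP => e e0; have /continuous_rVP/(_ e e0)[r r0 xr] := cD.
  have [r' r'0 xr'] := open_rVP (@omega_open i) ix.
  exists (Num.min r r'); first by rewrite lt_min r0.
  move=> y; rewrite lt_min => /andP[/xr yr /xr' iy].
  by rewrite !mem_set.
have cd : {for x, continuous (fun y => dsoft n (chi i y))}.
  by apply: continuous_rV_comp; [exact: chi_continuous|exact: continuous_dsoft].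
apply/continuous_rVP => e e0.
have K0 : 0 < chi_grad i + 1 by rewrite ltr_wpDl// chi_grad_ge0.
have /continuous_rVP/(_ _ (divr_gt0 e0 K0))[r r0 xr] := cd.
exists r => // y /xr; rewrite (chi_out Ox nix) dsoft0 subr0 (memNset nix) subr0 => yr.
case: ifPn => [/set_mem iy|_]; last by rewrite normr0.
rewrite ltr_pdivlMr// in yr; rewrite normrM (le_lt_trans _ yr)// ler_wpM2l//.
by rewrite (le_trans (chi_grad_le j iy))// lerDl.
Qed.

(** chi_i u has a weak gradient on the whole domain, although chi_i may fail
    to be differentiable at the points of the boundary of omega_i: it is the
    limit of the products of u with the C^1 functions soft n (chi_i). *)
Lemma chi_mul_weak_gradient i u G (C : R) :
  (forall x, Omega x -> {for x, continuous u}) ->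
  is_weak_gradient Omega u G -> (forall x, Omega x -> `|u x| <= C) ->
  (forall x j, Omega x -> `|G x 0 j| <= C) ->
  is_weak_gradient Omega (fun x => chi i x * u x) (fun x => chi i x *: G x +
     u x *: (if x \in omega i then (chi i x != 0)%:R *: gradient (chi i) x else 0)).
Proof.
move=> cu wG uC GC; pose L := chi_grad i; have L0 := chi_grad_ge0 i.
have mOmega := open_measurable_rV oOmega.
have mu_ := continuous_measurable_rV oOmega cu.
have u2 : L2 Omega u by apply: (bounded_L2 (C := C)) => //; exact: bounded_open_fin.
have gradE n x j : Omega x -> gradient (soft n \o chi i) x 0 j =
    if x \in omega i then dsoft n (chi i x) * 'D_(unitv j) (chi i) x else 0.
  by move=> Ox; rewrite gradientE; have [_ ->] := soft_chi_derive n i j Ox.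
have gradB n x j : Omega x -> `|gradient (soft n \o chi i) x 0 j| <= 2 * L.
  move=> Ox; rewrite gradE//; case: ifPn => [/set_mem ix|_]; last by rewrite normr0 mulr_ge0// chi_grad_ge0.
  by rewrite normrM ler_pM ?dsoft_bound ?chi_grad_le.
have softB n x : Omega x -> `|soft n (chi i x)| <= 1.
  move=> Ox; rewrite (le_trans (soft_bound _ _))//; have /andP[c0 c1] := chi_ge0 i Ox.
  by rewrite ger0_norm.
have cs n x : Omega x -> {for x, continuous (fun y => soft n (chi i y))}.
  move=> Ox; apply: continuous_rV_comp; first exact: chi_continuous.
  apply: differentiable_continuous; apply/derivable1_diffP.
  by have [] := is_derive_soft n (chi i x).
apply: (@is_weak_gradient_lim _ _ Omega (fun n x => soft n (chi i x) * u x)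
  (fun n x => soft n (chi i x) *: G x + u x *: gradient (soft n \o chi i) x) _ _ (`|C| + `|C| * (2 * L))) => //.
- by move=> n; apply: continuous_measurable_rV => // x Ox; apply: continuous_rVM; [exact: cs|exact: cu].
- move=> n x Ox; rewrite normrM (@le_trans _ _ (1 * `|C|))//.
    by rewrite ler_pM ?softB// (le_trans (uC x Ox))// ler_norm.
  by rewrite mul1r lerDl !mulr_ge0.
- move=> n x j Ox; rewrite !mxE (le_trans (ler_normD _ _))//; apply: lerD; rewrite normrM.
    by rewrite -[leRHS]mul1r ler_pM ?softB// (le_trans (GC x j Ox))// ler_norm.
  apply: ler_pM => //; first by rewrite (le_trans (uC x Ox))// ler_norm.
  by have := gradB n x j Ox; rewrite mxE.
- move=> n; apply: (is_weak_gradientM (C := 1 + 2 * L)) => //; first exact: soft_chi_C1.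
  move=> x Ox; split=> [|j]; first by rewrite (le_trans (softB n x Ox))// lerDl mulr_ge0.
  by rewrite (le_trans (gradB n x j Ox))// lerDr.
- by move=> x Ox; apply: cvgMl; exact: cvg_soft.
- move=> x j Ox.
  rewrite (_ : (fun n => _) = fun n => soft n (chi i x) * G x 0 j + u x *
     (if x \in omega i then dsoft n (chi i x) * 'D_(unitv j) (chi i) x else 0)); last first.
    by apply/funext => n; rewrite !mxE -gradE// gradientE.
  rewrite !mxE; apply: cvgD; first by apply: cvgMl; exact: cvg_soft.
  apply: cvgMr; case: ifPn => [_|_]; last by rewrite mxE; exact: cvg_cst.
  by rewrite !mxE; apply: cvgMl; exact: cvg_dsoft.
Qed.

Lemma chi_mul_H1 i u G (C : R) :
  (forall x, Omega x -> {for x, continuous u}) ->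
  is_weak_gradient Omega u G -> (forall x, Omega x -> `|u x| <= C) ->
  (forall x j, Omega x -> `|G x 0 j| <= C) ->
  H1 Omega (fun x => chi i x * u x).
Proof.
move=> cu wG uC GC; split; last by eexists; exact: chi_mul_weak_gradient cu wG uC GC.
apply: (bounded_L2 (C := `|C|)) => //; [exact: open_measurable_rV|exact: bounded_open_fin| |].
  by apply: continuous_measurable_rV => // x Ox; apply: continuous_rVM; [exact: chi_continuous|exact: cu].
move=> x Ox; have /andP[c0 c1] := chi_ge0 i Ox.
rewrite normrM -[leRHS]mul1r ler_pM// ?(ger0_norm c0)//.
by rewrite (le_trans (uC x Ox))// ler_norm.
Qed.

End partition_of_unity_regularity.

(** * Traces *)

Section integral_set_function.
Import HBNNSimple.
(** The set function mu need not be a measure on the sigma-algebra of T, as for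
    the surface measure in the definition of traces. *)
Lemma integral_zero (d : measure_display) (T : measurableType d) (R : realType) (mu : set T -> \bar R)
  (D : set T) (f : T -> \bar R) : mu set0 = 0%E ->
  (forall x, D x -> f x = 0%E) -> (\int[mu]_(x in D) f x = 0)%E.
Proof.
move=> mu0 f0.
have s0 (h : T -> R) : (forall x, h x = 0) -> sintegral mu h = 0%E.
  move=> h0; rewrite /sintegral fsbig1// => r _.
  have [->|r0] := eqVneq r 0; first by rewrite mul0e.
  rewrite (_ : _ @^-1` _ = set0) ?mu0 ?mule0//.
  by apply/seteqP; split => // x /= hx; move: r0; rewrite -hx h0 eqxx.
have nn0 : ereal_sup [set sintegral mu h | h in [set h : {nnsfun T >-> R} | forall x, ((h x)%:E <= 0)%E]] = 0%E.
  apply/eqP; rewrite eq_le; apply/andP; split.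
    apply: ge_ereal_sup => _ [h h0 <-]; rewrite s0// => x.
    by apply/eqP; rewrite eq_le fun_ge0 andbT -lee_fin.
  apply: ereal_sup_ubound; exists (cst_nnsfun T 0%:nng) => //=.
  exact: s0.
rewrite /integral.
have E : f \_ D = cst 0%E by apply/funext => x; rewrite patchE; case: ifPn => // /set_mem /f0.
have EP : (f \_ D)^\+%E = (fun=> 0%E) by rewrite E; apply/funext => x; rewrite funepos.unlock maxxx.
have EN : (f \_ D)^\-%E = (fun=> 0%E) by rewrite E; apply/funext => x; rewrite funeneg.unlock oppe0 maxxx.
by rewrite [X in (X - _)%E](_ : _ = 0%E) ?[X in (_ - X)%E](_ : _ = 0%E) ?sube0// -nn0 ?EP ?EN.
Qed.
End integral_set_function.

Section traces.
Context {R : realType} {d : nat}.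
Variables (Omega : set 'rV[R]_d).
Hypothesis oOmega : open Omega.
Hypothesis bOmega : bounded_set Omega.
Hypothesis lOmega : lipschitz_boundary Omega.
Let leb : {measure set 'rV[R]_d -> \bar R} := lebesgue_rV d.
Implicit Types (u v w f : 'rV[R]_d -> R) (x y z : 'rV[R]_d) (O : set 'rV[R]_d).

Definition seg_lip f (L : R) : Prop := forall x y, seg_in Omega x y -> `|f y - f x| <= L * `|y - x|.

(** Short paths make f Cauchy at every boundary point. *)
Lemma seg_lip_limit f (L : R) x : 0 <= L -> seg_lip f L -> closure Omega x ->
  exists l : R, forall e : R, 0 < e ->
    exists2 r : R, 0 < r & forall y, Omega y -> `|y - x| < r -> `|f y - l| < e.
Proof.
move=> L0 fL cx; have PF := within_nbhs_proper cx.
have : cvg (f @ within Omega (nbhs x)).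
  apply/cauchy_cvgP; apply/cauchy_exP => e e0.
  have K0 : 0 < 6 * L + 1 by rewrite ltr_wpDl ?mulr_ge0.
  have [r r0 H] := lipschitz_path oOmega lOmega cx (divr_gt0 e0 K0).
  have [y Oy yr] := (closure_rVP Omega x).1 cx r r0.
  exists (f y); rewrite /nbhs /= /within /=; apply/nbhs_rVP; exists r => // z zr Oz.
  have [p [q [s1 s2 s3]]] := H y z Oy Oz yr zr.
  rewrite -ball_normE /= distrC.
  have lip a b : seg_in (Omega `&` [set w | `|w - x| < e / (6 * L + 1)]) a b ->
      `|f b - f a| <= L * (2 * (e / (6 * L + 1))).
    move=> ab; rewrite (le_trans (fL a b _))//; first by move=> s /ab[].
    have [_ ae] := seg_in_l ab; have [_ be] := seg_in_r ab.
    rewrite ler_wpM2l// -(subrKA x) (le_trans (ler_normD _ _))// mulr2n mulrDl mul1r lerD ?(ltW be)//.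
    by rewrite distrC ltW.
  have h1 := lip _ _ s1; have h2 := lip _ _ s2; have h3 := lip _ _ s3.
  rewrite (_ : f z - f y = (f z - f q) + (f q - f p) + (f p - f y)); last ring.
  rewrite (le_lt_trans (ler_normD _ _))//.
  have h4 := ler_normD (f z - f q) (f q - f p).
  have h5 : 3 * (L * (2 * (e / (6 * L + 1)))) < e.
    rewrite (_ : _ * _ = (6 * L) * e / (6 * L + 1)); last ring.
    by rewrite ltr_pdivrMr// [ltRHS]mulrC ltr_pM2r// ltrDl.
  lra.
move=> /cvg_ex[l fl]; exists l => e e0.
have /cvgrPdist_lt/(_ e e0) := fl; rewrite /nbhs /= /within /= => /nbhs_rVP[r r0 xr].
by exists r => // y Oy yr; rewrite distrC; exact: xr.
Qed.

Lemma seg_lip_extend f (L : R) : 0 <= L -> seg_lip f L ->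
  exists p, [/\ {within closure Omega, continuous p}, {in Omega, p =1 f} &
    forall x (e : R), closure Omega x -> 0 < e ->
      exists2 r : R, 0 < r & forall y, Omega y -> `|y - x| < r -> `|f y - p x| < e].
Proof.
move=> L0 fL.
have /choice[p pP] : forall x, exists l : R, closure Omega x -> forall e : R, 0 < e ->
    exists2 r : R, 0 < r & forall y, Omega y -> `|y - x| < r -> `|f y - l| < e.
  move=> x; have [cx|ncx] := pselect (closure Omega x); last by exists 0.
  by have [l lP] := seg_lip_limit L0 fL cx; exists l.
exists p; split.
- apply/within_continuousP => x e cx e0.
  have e2 : 0 < e / 2 by rewrite divr_gt0.
  have [r r0 Hr] := pP x cx _ e2; exists r => // y cy yr.
  have [r' r'0 Hr'] := pP y cy _ e2.
  have m0 : 0 < Num.min r' (r - `|y - x|) by rewrite lt_min r'0 subr_gt0.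
  have [z Oz] := (closure_rVP Omega y).1 cy _ m0; rewrite lt_min => /andP[zr' zr].
  have zx : `|z - x| < r by rewrite -(subrKA y) (le_lt_trans (ler_normD _ _))// -ltrBrDr.
  rewrite (_ : p y - p x = (f z - p x) - (f z - p y)); last ring.
  by rewrite (le_lt_trans (ler_normB _ _))// [e]splitr ltrD ?Hr ?Hr'.
- move=> x /set_mem Ox; apply/eqP; rewrite -subr_eq0 -normr_le0; apply/ler_addgt0Pl => e e0.
  have [r r0 Hr] := pP x (subset_closure Ox) e e0.
  by rewrite addr0 distrC ltW// Hr// subrr normr0.
- by move=> x e cx e0; exact: pP.
Qed.

Lemma H1norm_zero u : {in Omega, u =1 (fun=> 0)} -> H1norm Omega u = 0.
Proof.
move=> u0; have mO := open_measurable_rV oOmega.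
have [L0 _] := H1_lin_closed bOmega oOmega (@subset_refl _ Omega).
have wu : is_weak_gradient Omega u (wgrad Omega u).
  by apply: wgradP; apply: H1_eq L0 => x Ox; rewrite u0.
have w0 : is_weak_gradient Omega u (fun=> 0).
  have [_ [G wG]] := L0.
  have := is_weak_gradient_lin (-1) oOmega bOmega L0.1 L0.1 wG wG.
  move=> /(@is_weak_gradient_eq _ _ _ _ u) H.
  apply: is_weak_gradient_eqG (H _) => x Ox; first by rewrite scaleN1r addNr.
  by rewrite mulN1r oppr0 add0r u0.
rewrite /H1norm [X in X + _](_ : _ = 0) ?add0r; last first.
  transitivity (\int[leb]_(x in Omega) (0 : R)); last by rewrite Rintegral_cst// mul0r.
  by apply: eq_Rintegral => x Ox; rewrite u0// expr0n.
have m2 : measurable_fun Omega (fun x => enorm (wgrad Omega u x) ^+ 2).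
  rewrite (_ : (fun x => _) = fun x => \sum_(j < d) wgrad Omega u x 0 j ^+ 2).
    apply: measurable_sum => j; apply: measurable_funX; by have [] := wu.1 j.
  by apply/funext => x; rewrite enorm_sqr.
rewrite (@ae_eq_Rintegral _ _ _ leb _ _ (fun=> 0)) ?Rintegral_cst ?mul0r ?sqrtr0//.
apply: filterS (is_weak_gradient_unique oOmega bOmega wu w0) => x E Ox.
by rewrite E// enorm_sqr big1// => j _; rewrite mxE expr0n.
Qed.

(** The constant sequence p converges to u. *)
Lemma continuous_has_trace0 GamD u p : H1 Omega u -> {within closure Omega, continuous p} ->
  {in Omega, p =1 u} -> (forall x, GamD x -> p x = 0) -> has_trace Omega GamD u (fun=> 0).
Proof.
move=> uH cp pu p0; split; first exact: measurable_cst.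
exists (fun=> p); split.
- by move=> n; split => //; apply: H1_eq uH => x Ox; rewrite pu.
- rewrite (_ : (fun n : nat => _) = fun=> 0); first exact: cvg_cst.
  by apply/funext => n; apply: H1norm_zero => x Ox; rewrite pu// subrr.
- rewrite (_ : (fun n : nat => _) = fun=> 0%E); first exact: cvg_cst.
  apply/funext => n; apply: integral_zero => [|x Gx]; first exact: outer_measure0.
  by rewrite p0// subrr expr0n.
Qed.

End traces.

Section pou_traces.
Context {R : realType} {d : nat}.
Variables (Omega GamD : set 'rV[R]_d) (M : nat) (omega : 'I_M -> set 'rV[R]_d) (C1 : R).
Variable chi : 'I_M -> 'rV[R]_d -> R.
Variables (k : cell_kind) (sigma h : R) (N : nat) (tau : 'I_N -> @cell R d).
Hypothesis oOmega : open Omega.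
Hypothesis bOmega : bounded_set Omega.
Hypothesis lOmega : lipschitz_boundary Omega.
Hypothesis htau : triangulation k Omega sigma h tau.
Hypothesis homega : open_cover Omega omega.
Hypothesis hchi : partition_of_unity Omega omega C1 chi.
Hypothesis GamD_cl : GamD `<=` closure Omega.
Implicit Types (u v w f : 'rV[R]_d -> R) (x y z : 'rV[R]_d).

Lemma chi_Vh_weak_gradient i u : Vh Omega k tau u ->
  exists2 G, is_weak_gradient Omega (fun x => chi i x * u x) G &
    forall x, Omega x -> ~ omega i x -> G x = 0.
Proof.
move=> uV; have [G [C [wG uC GC _]]] := Vh_weak_gradient oOmega bOmega htau uV.
have cu x : Omega x -> {for x, continuous u}.
  by move=> Ox; apply: within_continuous_at oOmega Ox; case: uV.
eexists; first exact: (chi_mul_weak_gradient oOmega bOmega homega hchi i cu wG uC GC).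
by move=> x Ox nx /=; rewrite memNset// (chi_out hchi Ox nx) scale0r scaler0 addr0.
Qed.

Lemma chi_Vh_H1 i u : Vh Omega k tau u -> H1 Omega (fun x => chi i x * u x).
Proof.
move=> uV; have [G [C [wG uC GC _]]] := Vh_weak_gradient oOmega bOmega htau uV.
have cu x : Omega x -> {for x, continuous u}.
  by move=> Ox; apply: within_continuous_at oOmega Ox; case: uV.
exact: (chi_mul_H1 oOmega bOmega homega hchi i cu wG uC GC).
Qed.

Lemma pou_H1 (W : 'I_M -> 'rV[R]_d -> R) v : (forall i, Vh Omega k tau (W i)) ->
  (forall x, Omega x -> v x = \sum_i chi i x * W i x) -> H1 Omega v.
Proof.
move=> WV vE; have L := H1_lin_closed bOmega oOmega (@subset_refl _ Omega).
apply: (@H1_eq _ _ _ (fun x => \sum_i chi i x * W i x)).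
  by move=> x /set_mem Ox; rewrite vE.
by apply: (lin_closed_sum L) => i _; exact: chi_Vh_H1.
Qed.

(** Near a point x of the Dirichlet boundary, only the patches with x in their
    closure contribute, and the local functions of those vanish at x. *)
Lemma pou_H1D (W : 'I_M -> 'rV[R]_d -> R) v : (forall i, Vh Omega k tau (W i)) ->
  (forall i x, GamD x -> closure (omega i) x -> W i x = 0) ->
  (forall x, Omega x -> v x = \sum_i chi i x * W i x) -> H1D Omega GamD v.
Proof.
move=> WV W0 vE; have vH := pou_H1 WV vE; split => //.
have chiO i x : Omega x -> 0 <= chi i x <= 1 by move=> Ox; exact: (chi_ge0 hchi).
have /choice[C CP] := fun i => Vh_lip htau (WV i).
pose L := \sum_i (C i * chi_lip omega C1 i + C i).
have C0 i : 0 <= C i by case: (CP i).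
have L0 : 0 <= L.
  by apply: sumr_ge0 => i _; rewrite addr_ge0// mulr_ge0//; exact: chi_lip_ge0.
have vL : seg_lip Omega v L.
  move=> x y xy; have Ox := seg_in_l xy; have Oy := seg_in_r xy.
  rewrite !vE// -sumrB (le_trans (ler_norm_sum _ _ _))// /L mulr_suml.
  apply: ler_sum => i _; have [_ WC WL _] := CP i.
  rewrite (_ : _ - _ = W i y * (chi i y - chi i x) + chi i x * (W i y - W i x)); last ring.
  rewrite (le_trans (ler_normD _ _))// mulrDl; apply: lerD; rewrite normrM.
    rewrite -mulrA; apply: ler_pM => //; first by apply: WC; exact: subset_closure.
    exact: (chi_seg_lip oOmega homega hchi).
  rewrite -[leRHS]mul1r; apply: ler_pM => //.
    by have /andP[c0 c1] := chiO i x Ox; rewrite ger0_norm.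
  by apply: WL => s /xy; exact: subset_closure.
have [p [cp pv plim]] := seg_lip_extend oOmega lOmega L0 vL.
apply: (continuous_has_trace0 oOmega bOmega vH cp pv) => x Gx.
have cx := GamD_cl Gx.
apply/eqP; rewrite -normr_le0; apply/ler_addgt0Pl => e e0; rewrite addr0.
pose e' := e / 2 / (M%:R + 1).
have M0 : 0 < M%:R + 1 :> R by rewrite ltr_wpDl.
have e'0 : 0 < e' by rewrite !divr_gt0.
have [r r0 Hr] := plim x (e / 2) cx (divr_gt0 e0 (ltr0n _ 2)).
have /choice[s sP] : forall i, exists s : R, 0 < s /\
    forall y, Omega y -> `|y - x| < s -> `|chi i y * W i y| <= e'.
  move=> i; have [ci|nci] := pselect (closure (omega i) x).
    have [/within_continuousP/(_ x e' cx e'0)[s s0 Hs] _] := WV i.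
    exists s; split=> // y Oy ys; rewrite normrM -[leRHS]mul1r; apply: ler_pM => //.
      by have /andP[c0 c1] := chiO i y Oy; rewrite ger0_norm.
    by have := Hs y (subset_closure Oy) ys; rewrite (W0 i x)// subr0 => /ltW.
  have := closed_openC (@closed_closure _ (omega i)); move=> /open_rVP/(_ nci)[s s0 Hs].
  exists s; split=> // y Oy /Hs ny.
  rewrite (chi_out hchi Oy) ?mul0r ?normr0 ?(ltW e'0)//.
  by move=> iy; apply: ny; exact: subset_closure.
pose s0 := \big[Num.min/r]_i s i.
have s00 : 0 < s0 by apply/bigmin_gtP; split => // i _; have [] := sP i.
have [y Oy ys] := (closure_rVP Omega x).1 cx _ s00.
have yr : `|y - x| < r by rewrite (lt_le_trans ys)// bigmin_le_id.
have vy : `|v y| <= e / 2.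
  rewrite vE// (le_trans (ler_norm_sum _ _ _))// (@le_trans _ _ (\sum_(i < M) e'))//.
    apply: ler_sum => i _; have [_ Hs] := sP i; apply: Hs => //.
    by rewrite (lt_le_trans ys)// bigmin_le_cond.
  rewrite sumr_const card_ord -[_ *+ M]mulr_natr /e' -mulrA ler_piMr ?divr_ge0 ?ltW//.
  by rewrite mulrC ltr_pdivrMr// mul1r ltrDl.
have := Hr y Oy yr; rewrite distrC => h1.
rewrite -(subrK (v y) (p x)) (le_trans (ler_normD _ _))// [e]splitr lerD//.
exact: ltW.
Qed.

End pou_traces.

(** * Spectral approximation *)

Section spectral_estimate.
Context {R : realType} {T : Type}.
Implicit Types (V W : set (T -> R)) (O : set T) (u v w : T -> R).
Implicit Types (b q : (T -> R) -> (T -> R) -> R).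

Definition comb (n : nat) (c : nat -> R) (phi : nat -> T -> R) : T -> R :=
  fun x => \sum_(j < n) c j * phi j x.

Lemma comb_closed V n c phi : lin_closed V -> (forall j, (j < n)%N -> V (phi j)) -> V (comb n c phi).
Proof.
move=> VL Vphi; apply: (lin_closed_sum VL) => j _; apply: (lin_closedZ VL); exact: Vphi.
Qed.

Lemma form_combl V b n c phi w : lin_closed V -> semi_inner V b ->
  (forall j, (j < n)%N -> V (phi j)) -> V w ->
  b (comb n c phi) w = \sum_(j < n) c j * b (phi j) w.
Proof.
move=> VL bV Vphi Vw; rewrite (form_suml VL bV)//; last first.
  by move=> j _; apply: (lin_closedZ VL); exact: Vphi.
by apply: eq_bigr => j _; rewrite (formZl VL bV)//; exact: Vphi.
Qed.

Lemma form_combr V b n c phi w : lin_closed V -> semi_inner V b ->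
  (forall j, (j < n)%N -> V (phi j)) -> V w ->
  b w (comb n c phi) = \sum_(j < n) c j * b w (phi j).
Proof.
move=> VL bV Vphi Vw; rewrite (form_sym bV) ?(form_combl _ VL bV)//; last exact: comb_closed.
by apply: eq_bigr => j _; rewrite (form_sym bV)//; exact: Vphi.
Qed.

(** Gram-Schmidt works for a degenerate form as well, as a vector of zero length
    is orthogonal to everything by Cauchy-Schwarz. *)
Lemma form_projection V b n phi w : lin_closed V -> semi_inner V b ->
  (forall j, (j < n)%N -> V (phi j)) -> V w ->
  exists c, forall j, (j < n)%N -> b (fun x => w x - comb n c phi x) (phi j) = 0.
Proof.
move=> VL bV; elim: n w => [|n IHn] w Vphi Vw; first by exists (fun=> 0).
have Vphi' j : (j < n)%N -> V (phi j) by move=> jn; apply: Vphi; rewrite ltnS ltnW.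
have Vn : V (phi n) by exact: Vphi.
have [c cP] := IHn w Vphi' Vw; have [c' c'P] := IHn (phi n) Vphi' Vn.
pose e x := w x - comb n c phi x; pose psi x := phi n x - comb n c' phi x.
have Ve : V e by apply: (lin_closedB VL) => //; exact: comb_closed.
have Vpsi : V psi by apply: (lin_closedB VL) => //; exact: comb_closed.
pose t := b e psi / b psi psi.
exists (fun j => if (j < n)%N then c j - t * c' j else t).
have -> : (fun x => w x - comb n.+1 (fun j => if (j < n)%N then c j - t * c' j else t) phi x) =
    (fun x => (- t) * psi x + e x).
  apply/funext => x; rewrite /comb big_ord_recr/= ltnn /e /psi /comb.
  rewrite [X in X + t * _](eq_bigr (fun j : 'I_n => c j * phi j x - t * (c' j * phi j x))).
    by rewrite sumrB -mulr_sumr; ring.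
  by move=> j _; rewrite ltn_ord; ring.
have bj j : (j < n)%N -> b (fun x => (- t) * psi x + e x) (phi j) = 0.
  move=> jn; rewrite (form_linl bV)//; last exact: Vphi'.
  by rewrite c'P// cP// mulr0 addr0.
move=> j; rewrite ltnS leq_eqVlt => /predU1P[->|jn]; last exact: bj.
have Vte : V (fun x => (- t) * psi x + e x) by apply: VL.2.
have -> : phi n = (fun x => psi x + comb n c' phi x).
  by apply/funext => x; rewrite /psi subrK.
rewrite (form_sym bV)//; last by apply: (lin_closedD VL) => //; exact: comb_closed.
rewrite (formDl bV)//; last exact: comb_closed.
rewrite (form_combl _ VL bV)// [X in _ + X]big1 ?addr0; last first.
  by move=> i _; rewrite (form_sym bV) ?bj ?mulr0//; exact: Vphi'.
rewrite (form_sym bV)// (form_linl bV)// /t.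
have [p0|p0] := eqVneq (b psi psi) 0; last by field.
have := form_cauchy VL bV Ve Vpsi; rewrite p0 mulr0 => ep.
have -> : b e psi = 0 by apply/eqP; rewrite -sqrf_eq0 eq_le ep sqr_ge0.
by rewrite !mul0r oppr0 mul0r add0r.
Qed.

(** Functions are compared on O only. *)
Definition indep_on O r (u : 'I_r -> T -> R) : Prop :=
  forall c : 'I_r -> R, (forall x, O x -> \sum_k c k * u k x = 0) -> forall k, c k = 0.

Lemma indep_le O K (F : 'I_K -> T -> R) r (u : 'I_r -> T -> R) :
  (forall k, exists c : 'I_K -> R, forall x, O x -> u k x = \sum_l c l * F l x) ->
  indep_on O u -> (r <= K)%N.
Proof.
move=> /choice[C CP] ui; rewrite leqNgt; apply/negP => Kr.
pose M : 'M[R]_(r, K) := \matrix_(k, l) C k l.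
have /rowV0Pn[v /sub_kermxP vM v0] : kermx M != 0.
  rewrite kermx_eq0 /row_free; apply/eqP => rM.
  by have := rank_leq_col M; rewrite rM leqNgt Kr.
case/negP: v0; apply/eqP/rowP => k; rewrite mxE; move: k; apply: ui => x Ox.
rewrite (eq_bigr (fun k => \sum_l v 0 k * C k l * F l x)); last first.
  by move=> k _; rewrite CP// mulr_sumr; apply: eq_bigr => l _; rewrite mulrA.
rewrite exchange_big big1// => l _; rewrite -mulr_suml.
have := congr1 (fun N : 'rV[R]_K => N 0 l) vM; rewrite !mxE => vMl.
rewrite [X in X * _](_ : _ = 0) ?mul0r// -[RHS]vMl; apply: eq_bigr => k _; by rewrite mxE.
Qed.

(** Take a maximal independent family. *)
Lemma finite_basis V O K (F : 'I_K -> T -> R) : 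
  (forall w, V w -> exists c : 'I_K -> R, forall x, O x -> w x = \sum_l c l * F l x) ->
  exists r (u : 'I_r -> T -> R), [/\ forall k, V (u k), indep_on O u &
    forall w, V w -> exists c : 'I_r -> R, forall x, O x -> w x = \sum_k c k * u k x].
Proof.
move=> VF.
pose P r := `[< exists u : 'I_r -> T -> R, (forall k, V (u k)) /\ indep_on O u >].
have P0 : exists r, P r.
  exists 0%N; apply/asboolP; exists (fun _ _ => 0); split; first by case.
  by move=> c _ [].
have PK r : P r -> (r <= K)%N.
  by move=> /asboolP[u [uV ui]]; apply: (indep_le (O := O) (u := u) (F := F)) => // k; apply: VF; exact: uV.
case: (ex_maxnP P0 PK) => r /asboolP[u [uV ui]] rmax.
exists r, u; split => // w Vw.
apply: contrapT => nspan; have := rmax r.+1; rewrite ltnn => H; suff : false by []; apply: H.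
apply/asboolP; exists (fun k => if unlift ord0 k is Some j then u j else w); split.
  by move=> k; case: (unlift ord0 k).
move=> c c0.
have {}c0 x : O x -> c ord0 * w x + \sum_k c (lift ord0 k) * u k x = 0.
  move=> Ox; rewrite -[RHS](c0 x Ox) big_ord_recl unlift_none; congr (_ + _).
  by apply: eq_bigr => k _; rewrite liftK.
have c00 : c ord0 = 0.
  apply/eqP/negPn/negP => cn0; apply: nspan; exists (fun k => - c (lift ord0 k) / c ord0) => x Ox.
  have := c0 x Ox => /eqP; rewrite addr_eq0 => /eqP E.
  apply: (mulfI cn0); rewrite E mulr_sumr -sumrN; apply: eq_bigr => k _.
  by field.
move=> k; case: (unliftP ord0 k) => [j ->|->//].
apply: (ui (fun k => c (lift ord0 k))) => x Ox.
by have := c0 x Ox; rewrite c00 mul0r add0r.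
Qed.

(** The unit sphere of the coordinate space is compact. *)
Lemma rayleigh_max V O b q r (u : 'I_r -> T -> R) : lin_closed V -> semi_inner V b -> semi_inner V q ->
  (forall v w, (forall x, O x -> v x = w x) -> b v v = b w w /\ q v v = q w w) ->
  (forall w, V w -> q w w = 0 -> forall x, O x -> w x = 0) ->
  (forall k, V (u k)) -> indep_on O u ->
  (forall w, V w -> exists c : 'I_r -> R, forall x, O x -> w x = \sum_k c k * u k x) ->
  exists rho e, [/\ 0 <= rho, V e, b e e = rho * q e e, (0 < rho -> 0 < q e e) &
    forall w, V w -> b w w <= rho * q w w].
Proof.
move=> VL bV qV loc qpos uV ui uspan.
pose E (c : 'rV[R]_r) : T -> R := fun x => \sum_k c 0 k * u k x.
have VE c : V (E c) by apply: (lin_closed_sum VL) => k _; exact: lin_closedZ.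
have EZ t c : E (t *: c) = fun x => t * E c x.
  by apply/funext => x; rewrite /E mulr_sumr; apply: eq_bigr => k _; rewrite mxE mulrA.
have wE w : V w -> exists c : 'rV[R]_r, forall x, O x -> w x = E c x.
  move=> /uspan[c cP]; exists (\row_k c k) => x Ox; rewrite cP//.
  by apply: eq_bigr => k _; rewrite mxE.
have formE s c : semi_inner V s -> s (E c) (E c) = \sum_k c 0 k * \sum_l c 0 l * s (u l) (u k).
  move=> sV; rewrite (form_suml VL sV)//; last by move=> k _; exact: lin_closedZ.
  apply: eq_bigr => k _; rewrite (formZl VL sV)//; congr (_ * _).
  rewrite (form_sym sV)// (form_suml VL sV)//; last by move=> l _; exact: lin_closedZ.
  by apply: eq_bigr => l _; rewrite (formZl VL sV).
have cform s c : semi_inner V s -> {for c, continuous (fun c => s (E c) (E c))}.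
  move=> sV.
  have -> : (fun c => s (E c) (E c)) = (fun c : 'rV[R]_r => \sum_k c 0 k * \sum_l c 0 l * s (u l) (u k)).
    by apply/funext => c'; exact: formE.
  have cc k : {for c, continuous (fun c : 'rV[R]_r => c 0 k)}.
    by apply: (@lip_continuous_at _ _ _ _ 1 1) => // y _; rewrite mul1r; have := coord_le_norm (y - c) k; rewrite !mxE.
  apply: continuous_rV_sum => k _; apply: continuous_rVM; first exact: cc.
  apply: continuous_rV_sum => l _; apply: continuous_rVM; first exact: cc.
  exact: continuous_rV_cst.
case: r => [|r] in u E uV ui uspan VE EZ wE formE cform *.
  exists 0, (fun=> 0); split; rewrite ?ltxx//; first exact: VL.1.
    by rewrite (form0l VL bV) ?mul0r//; exact: VL.1.
  move=> w Vw; have [c wc] := wE w Vw.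
  have w0 x : O x -> w x = 0 by move=> Ox; rewrite wc// /E big_ord0.
  by have [-> _] := loc w (fun=> 0) w0; rewrite (form0l VL bV) ?mul0r//; exact: VL.1.
pose S := [set c : 'rV[R]_r.+1 | `|c| = 1].
have qS c : S c -> 0 < q (E c) (E c).
  move=> c1; rewrite lt_neqAle (form_ge0 qV)// andbT eq_sym; apply/eqP => q0.
  have c0 : c = 0.
    apply/rowP => k; rewrite mxE; apply: (ui (fun k => c 0 k)) => x Ox.
    exact: (qpos _ (VE c) q0).
  by move/eqP: c1; rewrite c0 normr0 eq_sym oner_eq0.
have [|||c /set_mem Sc cmax] := @EVT_max_rV R r.+1 (fun c => b (E c) (E c) / q (E c) (E c)) S.
- exists (unitv ord0); apply/eqP; rewrite eq_le norm_unitv/=.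
  by have := coord_le_norm (unitv ord0 : 'rV[R]_r.+1) ord0; rewrite unitvE eqxx normr1.
- apply: bounded_closed_compact.
    by exists 1; split => // x x1 c /= ->; exact: ltW.
  rewrite -[S]setCK; apply: open_closedC; rewrite openE => c /= Sc.
  apply/nbhs_rVP; exists (`| `|c| - 1 |); first by rewrite normr_gt0 subr_eq0; apply/eqP.
  move=> y + Sy; rewrite -{1}Sy => yc.
  by have := le_lt_trans (ler_dist_dist c y) (eq_ind_r (fun t => t < _) yc (distrC c y)); rewrite ltxx.
- apply/within_continuousP => c e Sc e0.
  have cq : {for c, continuous (fun c => b (E c) (E c) / q (E c) (E c))}.
    apply: continuous_rVM; first exact: cform.
    apply: (@continuous_rV_comp _ _ (fun c => q (E c) (E c)) (fun s => s^-1)); first exact: cform.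
    by apply: inv_continuous; rewrite gt_eqF ?qS.
  by have /continuous_rVP/(_ e e0)[s s0 cs] := cq; exists s => // y _; exact: cs.
have qc := qS c Sc.
exists (b (E c) (E c) / q (E c) (E c)), (E c); split => //.
- by rewrite divr_ge0 ?(form_ge0 bV)// ltW.
- by rewrite divfK// gt_eqF.
move=> w Vw; have [c' wc'] := wE w Vw; have [-> ->] := loc _ _ wc'.
have [->|c'0] := eqVneq c' 0.
  have -> : E 0 = fun=> 0 by apply/funext => x; rewrite /E big1// => k _; rewrite mxE mul0r.
  by rewrite (form0l VL bV) ?(form0l VL qV) ?mulr0//; exact: VL.1.
pose c1 := `|c'|^-1 *: c'.
have n0 : 0 < `|c'| by rewrite normr_gt0.
have Sc1 : S c1 by rewrite /S /= normrZ ger0_norm ?invr_ge0// mulVf// gt_eqF.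
have -> : c' = `|c'| *: c1 by rewrite scalerA divff ?scale1r// gt_eqF.
have sc s : semi_inner V s -> s (E (`|c'| *: c1)) (E (`|c'| *: c1)) = `|c'| ^+ 2 * s (E c1) (E c1).
  move=> sV; rewrite EZ (formZl VL sV)//; last exact: lin_closedZ.
  by rewrite (form_sym sV) ?(formZl VL sV)//; [ring|exact: lin_closedZ].
rewrite !sc// mulrCA ler_wpM2l ?sqr_ge0// -ler_pdivrMr ?qS//.
by apply: cmax; exact: mem_set.
Qed.

Lemma semi_innerD V b q : semi_inner V b -> semi_inner V q ->
  semi_inner V (fun u v => b u v + q u v).
Proof.
move=> [bl bs b0] [ql qs q0]; split=> [c u v w Vu Vv Vw|u v Vu Vv|u Vu].
- by rewrite bl// ql//; ring.
- by rewrite bs// qs.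
- by rewrite addr_ge0 ?b0 ?q0.
Qed.

Lemma form_null V b u v : lin_closed V -> semi_inner V b -> V u -> V v -> b u u = 0 -> b u v = 0.
Proof.
move=> VL bV Vu Vv u0; have := form_cauchy VL bV Vu Vv; rewrite u0 mul0r => uv.
by apply/eqP; rewrite -sqrf_eq0 eq_le uv sqr_ge0.
Qed.

End spectral_estimate.

Section eigenfunctions.
Context {R : realType} {d : nat}.
Let T := 'rV[R]_d.
Implicit Types (u v w e : T -> R).
Variables (O : set T) (W : set (T -> R)) (a b : (T -> R) -> (T -> R) -> R).
Variables (m : nat) (lam : nat -> R) (phi : nat -> T -> R) (n : nat).
Hypotheses (WL : lin_closed W) (aW : semi_inner W a) (bW : semi_inner W b).
Hypothesis aO : forall v v' w w', (forall x, O x -> v x = v' x) -> (forall x, O x -> w x = w' x) ->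
  a v w = a v' w'.
Hypothesis bO : forall v v' w w', (forall x, O x -> v x = v' x) -> (forall x, O x -> w x = w' x) ->
  b v w = b v' w'.
Variables (K : nat) (F : 'I_K -> T -> R).
Hypothesis WF : forall w, W w -> exists c : 'I_K -> R, forall x, O x -> w x = \sum_l c l * F l x.
Hypotheses (eig : eigensystem O W a b m lam phi) (nm : (n < m)%N).

Let V : set (T -> R) := [set w | W w /\ forall j, (j < n)%N -> b w (phi j) = 0].

Let Wphi j : (j < m)%N -> W (phi j).
Proof. by case: eig => + _ _ _ => /(_ j) H /H[]. Qed.

Let Wphin j : (j < n)%N -> W (phi j).
Proof. by move=> jn; apply: Wphi; exact: ltn_trans nm. Qed.

Let VL : lin_closed V.
Proof.
split; first by split=> [|j jn]; [exact: WL.1|rewrite (form0l WL bW)//; exact: Wphin].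
move=> c u v [Wu u0] [Wv v0]; split=> [|j jn]; first exact: WL.2.
by rewrite (form_linl bW) ?u0 ?v0 ?mulr0 ?addr0//; exact: Wphin.
Qed.

Let VW : V `<=` W.
Proof. by move=> w []. Qed.

Let a_phi e j : V e -> (j < n)%N -> a e (phi j) = 0.
Proof.
move=> [We e0] jn; case: eig => /(_ j (ltn_trans jn nm))[Wj ej] _ _ _.
by rewrite (form_sym aW)// ej// (form_sym bW)// e0// mulr0.
Qed.

(** A common null vector of both forms would be an eigenfunction for every
    number, hence for one outside of the finite spectrum. *)
Lemma eigensystem_definite w : W w -> a w w + b w w = 0 -> forall x, O x -> w x = 0.
Proof.
move=> Ww w0.
have a0 := form_ge0 aW Ww; have b0 := form_ge0 bW Ww.
have aw : a w w = 0 by lra.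
have bw : b w w = 0 by lra.
pose mu := 1 + \sum_(j < m) `|lam j|.
have [c wc] : exists c : nat -> R, forall x, O x -> w x = \sum_(j < m | lam j == mu) c j * phi j x.
  case: eig => _ _ _; apply => // v Wv.
  by rewrite (form_null WL aW)// (form_null WL bW)// mulr0.
move=> x Ox; rewrite wc// big1// => j /eqP jmu.
have : lam j < mu.
  rewrite (le_lt_trans (ler_norm _))// /mu (bigD1 j)//= addrCA.
  by rewrite ltrDl ltr_wpDr// sumr_ge0.
by rewrite jmu ltxx.
Qed.

(** Rayleigh principle: the maximum rho of b / (a + b) over the b-orthogonal
    complement of the first n eigenfunctions makes mu = (1 - rho) / rho an
    eigenvalue, with a maximizer as eigenfunction.  It is not one of the
    eigenvalues below lam n, whose eigenfunctions are all among the first n.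
    The denominator a + b is definite, unlike a and b. *)
Lemma rayleigh_lower_bound e : V e -> lam n * b e e <= a e e.
Proof.
pose q u v := a u v + b u v.
have qW : semi_inner W q by exact: semi_innerD.
have [qV bV] := (semi_innerS VW qW, semi_innerS VW bW).
have [r [u [uV ui uspan]]] : exists r (u : 'I_r -> T -> R), [/\ forall k, V (u k), indep_on O u &
    forall w, V w -> exists c : 'I_r -> R, forall x, O x -> w x = \sum_k c k * u k x].
  by apply: (finite_basis (F := F)) => w /VW; exact: WF.
have [|w Vw w0|rho [f [rho0 Vf bf qf fmax]]] := rayleigh_max VL bV qV _ _ uV ui uspan.
- by move=> v w vw; rewrite /q (bO vw vw) (aO vw vw).
- by apply: eigensystem_definite w0; exact: VW.
move=> Ve; have [be qe] := (form_ge0 bW (VW Ve), fmax e Ve).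
have ae := form_ge0 aW (VW Ve).
have [rho00|rhon0] := eqVneq rho 0.
  rewrite rho00 mul0r in qe.
  by rewrite (_ : b e e = 0) ?mulr0//; apply/eqP; rewrite eq_le qe.
have rhop : 0 < rho by rewrite lt_neqAle eq_sym rhon0.
pose s u v := rho * q u v - b u v.
have sV : semi_inner V s.
  split=> [c u1 v w Vu Vv Vw|u1 v Vu Vv|u1 Vu].
  - by rewrite /s (form_linl qV)// (form_linl bV)//; ring.
  - by rewrite /s (form_sym qV)// (form_sym bV).
  - by rewrite subr_ge0 fmax.
have sf : s f f = 0 by rewrite /s -bf subrr.
pose mu := (1 - rho) / rho.
have fV v : V v -> a f v = mu * b f v.
  move=> Vv; have := form_null VL sV Vf Vv sf; rewrite /s /q /mu => E.
  have {}E : a f v = (b f v - rho * b f v) / rho.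
    apply: (mulfI rhon0); rewrite mulrCA divff// mulr1; lra.
  by rewrite E; ring.
have fW v : W v -> a f v = mu * b f v.
  move=> Wv; have [c cP] := form_projection WL bW Wphin Wv.
  have Wc : W (comb n c phi) by exact: comb_closed.
  have Vvc : V (fun x => v x - comb n c phi x).
    by split; [exact: lin_closedB|exact: cP].
  have -> : v = (fun x => 1 * (v x - comb n c phi x) + comb n c phi x).
    by apply/funext => x; rewrite mul1r subrK.
  rewrite (form_linr WL aW)//; [|exact: VW|exact: VW].
  rewrite (form_linr WL bW)//; [|exact: VW|exact: VW].
  rewrite !mul1r fV// (form_combr _ WL aW)//; last exact: VW.
  rewrite (form_combr _ WL bW)//; last exact: VW.
  rewrite !big1 ?addr0// => j _; first by case: Vf => _ ->; rewrite ?mulr0.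
  by rewrite a_phi ?mulr0.
have mulam : lam n <= mu.
  rewrite leNgt; apply/negP => mulam.
  case: (eig) => _ lam_mono _ /(_ mu f (VW Vf) fW)[c fc].
  have : b f f = 0.
    rewrite (bO fc (fun x _ => erefl (f x))) (form_suml WL bW) ?big1//; last exact: VW.
      move=> j /eqP jmu; rewrite (formZl WL bW)//; [|exact: Wphi|exact: VW].
      have jn : (j < n)%N.
        rewrite ltnNge; apply/negP => nj; move: mulam; rewrite -jmu ltNge => /negP; apply.
        by apply: lam_mono; rewrite nj ltn_ord.
      by rewrite (form_sym bW (Wphi (ltn_ord j)) (VW Vf)); case: Vf => _ ->; rewrite ?mulr0.
    by move=> j _; apply: (lin_closedZ WL); exact: Wphi.
  rewrite bf => /eqP; rewrite mulf_eq0 (negbTE rhon0)/= => /eqP q0.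
  by have := qf rhop; rewrite q0 ltxx.
rewrite (@le_trans _ _ (mu * b e e))//; first by rewrite ler_wpM2r.
rewrite /mu mulrAC ler_pdivrMr// mulrBl mul1r; move: qe; rewrite /q; lra.
Qed.

(** The b-projection on the first n eigenfunctions is an a-projection too. *)
Lemma eigenfunction_approximation w : 0 < lam n -> W w ->
  exists c, let e := fun x => w x - comb n c phi x in b e e <= (lam n)^-1 * a w w.
Proof.
move=> lam0 Ww; have [c cP] := form_projection WL bW Wphin Ww.
exists c => /=; set e := (fun x => _).
have Wc : W (comb n c phi) by exact: comb_closed.
have Ve : V e by split; [exact: lin_closedB|exact: cP].
have We := VW Ve.
rewrite mulrC ler_pdivlMr// mulrC (le_trans (rayleigh_lower_bound Ve))//.
have -> : w = (fun x => 1 * e x + comb n c phi x) by apply/funext => x; rewrite mul1r subrK.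
rewrite (form_quad WL aW)// expr1n mul1r mulr1 (form_combr _ WL aW)//.
rewrite [X in 2 * X]big1 ?mulr0 ?addr0; first by rewrite lerDl (form_ge0 aW).
by move=> j _; rewrite a_phi ?mulr0.
Qed.

End eigenfunctions.

(** * Finite dimensionality of the local spaces *)

Section finite_dimension.
Context {R : realType} {d : nat}.
Variables (Omega GamD : set 'rV[R]_d) (k : cell_kind) (sigma h : R) (N : nat) (tau : 'I_N -> @cell R d).
Variables (A : 'rV[R]_d -> 'M[R]_d) (alpha beta : R).
Hypothesis oOmega : open Omega.
Hypothesis bOmega : bounded_set Omega.
Hypothesis htau : triangulation k Omega sigma h tau.
Hypothesis hA : coefficient Omega A alpha beta.
Implicit Types (u v w p : 'rV[R]_d -> R) (x y s : 'rV[R]_d) (O : set 'rV[R]_d).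

(** Both kinds of shape functions in one form: b is zero for boxes, and only the
    constant term of a is used for simplices. *)
Lemma shape_monomials p : shape_function k p ->
  exists (a : {set 'I_d} -> R) (b : 'I_d -> R), forall s,
    p s = \sum_J a J * \prod_(j in J) s 0 j + \sum_j b j * s 0 j.
Proof.
case: k => /= [[a [b pE]]|[a pE]].
  exists (fun J => if J == finset.set0 then a else 0), b => s; rewrite pE; congr (_ + _).
  rewrite (bigD1 finset.set0)//= eqxx big_set0 mulr1 big1 ?addr0// => J /negbTE ->.
  by rewrite mul0r.
exists a, (fun=> 0) => s; rewrite pE [X in _ + X]big1 ?addr0// => j _.
by rewrite mul0r.
Qed.

(** The span of the monomials on each cell, when each point is assigned to just
    one of the cells that contain it. *)
Lemma Vh_loc_span O : O `<=` Omega -> exists K (F : 'I_K -> 'rV[R]_d -> R),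
  forall w, Vh_loc Omega k tau O w ->
    exists c : 'I_K -> R, forall x, O x -> w x = \sum_l c l * F l x.
Proof.
move=> OO.
pose sel x := [pick i | `[< cell_set k (tau i) x >]].
pose I : finType := ('I_N * ({set 'I_d} + 'I_d))%type.
pose F (l : I) x : R := if sel x == Some l.1 then
  match l.2 with inl J => \prod_(j in J) pull (tau l.1) x 0 j | inr j => pull (tau l.1) x 0 j end else 0.
exists #|I|, (fun l => F (enum_val l)) => w [W [_ WV] wW].
have /choice[p pP] : forall i, exists p, shape_function k p /\ forall s, ref_cell k s -> W (cell_map (tau i) s) = p s.
  by move=> i; have [p pS pE] := WV i; exists p.
have /choice[a aP] := fun i => shape_monomials (pP i).1.
have {aP}/choice[b bP] := aP.
pose c (l : I) := match l.2 with inl J => a l.1 J | inr j => b l.1 j end.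
exists (fun l => c (enum_val l)) => x Ox.
have cx : closure Omega x by apply: subset_closure; exact: OO.
rewrite wW; last exact: subset_closure.
transitivity (\sum_(l : I) c l * F l x); last first.
  by rewrite (big_enum_val (A := I) (fun l => c l * F l x)).
rewrite -(pair_bigA _ (fun i l => c (i, l) * F (i, l) x))/=.
have [i0 seli xi] : exists2 i, sel x = Some i & cell_set k (tau i) x.
  rewrite /sel; case: pickP => [i /asboolP xi|none]; first by exists i.
  by have [i xi] := (closure_cover htau x).1 cx; have := none i; rewrite asboolT.
rewrite (bigD1 i0)//= [X in _ + X]big1 ?addr0 => [|i ii0]; last first.
  rewrite big1// => l _; rewrite /F/= seli (_ : Some _ == Some _ = false) ?mulr0//.
  by apply/negbTE; apply: contra ii0 => /eqP[->].
rewrite big_sumType/= /c /F/= seli eqxx.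
have ui := tau_unit htau i0.
have := xi; rewrite cell_setE//= => kx.
by rewrite -bP -(pP i0).2// pullK.
Qed.

Lemma shape_zero : shape_function k (fun _ : 'rV[R]_d => 0).
Proof.
case: k => /=; first by exists 0, (fun=> 0) => s; rewrite big1 ?addr0// => j _; rewrite mul0r.
by exists (fun=> 0) => s; rewrite big1// => j _; rewrite mul0r.
Qed.

Lemma Vh_lin_closed : lin_closed (Vh Omega k tau).
Proof.
split; last by move=> c u v; exact: Vh_lin.
split; last by move=> i; exists (fun=> 0) => //; exact: shape_zero.
by apply/within_continuousP => x e _ e0; exists 1 => // y _ _; rewrite subrr normr0.
Qed.

Lemma Vh_loc_lin_closed O : lin_closed (Vh_loc Omega k tau O).
Proof.
have [V0 VL] := Vh_lin_closed; split; first by exists (fun=> 0).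
move=> c u v [u' uV uE] [v' vV vE]; exists (fun x => c * u' x + v' x); first exact: VL.
by move=> x cx; rewrite uE// vE.
Qed.

Lemma VhD_lin_closed O : lin_closed (VhD Omega GamD k tau O).
Proof.
have [V0 VL] := Vh_loc_lin_closed O; split; first by split.
move=> c u v [uV u0] [vV v0]; split; first exact: VL.
by move=> x bx Gx; rewrite u0// v0// mulr0 addr0.
Qed.

Lemma Vh_loc_H1 O u : open O -> O `<=` Omega -> Vh_loc Omega k tau O u -> H1 O u.
Proof.
move=> oO OO [u' uV uE]; apply: (@H1_eq _ _ _ u').
  by move=> x /set_mem Ox; rewrite uE//; exact: subset_closure.
by apply: (H1_sub oOmega) => //; exact: (Vh_H1 oOmega bOmega htau).
Qed.

Lemma Wh_lin_closed O : open O -> O `<=` Omega -> lin_closed (Wh Omega GamD A k tau O).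
Proof.
move=> oO OO; have [D0 DL] := VhD_lin_closed O.
have HL := H1_lin_closed bOmega oO OO.
have aO := aform_semi_inner oOmega bOmega hA oO OO.
have VH u : Vh_loc Omega k tau O u -> H1 O u by exact: Vh_loc_H1.
split; first by split=> // v [vV _]; rewrite (form0l HL aO)//; exact: VH.
move=> c u v [uD u0] [vD v0]; split; first exact: DL.
move=> w wDI; have [wV _] := wDI; have [[uV _] [vV _]] := (uD, vD).
by rewrite (form_linl aO)//; [rewrite u0// v0// mulr0 addr0|exact: VH..].
Qed.

End finite_dimension.

(** * Finite overlaps *)

Section overlaps.
Context {R : realType} {d : nat}.
Variables (Omega : set 'rV[R]_d) (A : 'rV[R]_d -> 'M[R]_d) (alpha beta : R).
Hypothesis oOmega : open Omega.
Hypothesis bOmega : bounded_set Omega.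
Hypothesis hA : coefficient Omega A alpha beta.
Let leb : {measure set 'rV[R]_d -> \bar R} := lebesgue_rV d.
Implicit Types (u v w : 'rV[R]_d -> R) (x y : 'rV[R]_d).

Lemma Rintegral_sum (D : set 'rV[R]_d) (I : Type) (r : seq I) (f : I -> 'rV[R]_d -> R) : measurable D ->
  (forall i, leb.-integrable D (EFin \o f i)) ->
  leb.-integrable D (EFin \o (fun x => \sum_(i <- r) f i x)) /\
  \int[leb]_(x in D) (\sum_(i <- r) f i x) = \sum_(i <- r) \int[leb]_(x in D) f i x.
Proof.
move=> mD fi; elim: r => [|i r [IH1 IH2]].
  split; last by under eq_Rintegral do rewrite big_nil; rewrite Rintegral_cst// mul0r big_nil.
  rewrite (_ : _ \o _ = cst 0%E); first exact: integrable0.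
  by apply/funext => x; rewrite /= big_nil.
have E : (fun x => \sum_(j <- i :: r) f j x) = (fun x => f i x + \sum_(j <- r) f j x).
  by apply/funext => x; rewrite big_cons.
rewrite E big_cons -IH2; split; last exact: RintegralD.
have := @integrableD _ _ _ leb D mD _ _ (fi i) IH1.
by rewrite (_ : (fun x => _) = EFin \o (fun x => f i x + \sum_(j <- r) f j x)).
Qed.

Lemma qform_suml M (I : Type) (r : seq I) (P : pred I) (g : I -> 'rV[R]_d) y :
  qform M (\sum_(i <- r | P i) g i) y = \sum_(i <- r | P i) qform M (g i) y.
Proof.
elim/big_rec2: _ => [|i s x _ <-]; first exact: qform0.
by rewrite -[g i in LHS]scale1r qform_linl mul1r.
Qed.

(** Jensen's inequality, from 2 Q(x, y) <= Q(x, x) + Q(y, y). *)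
Lemma qform_convex (M : 'M[R]_d) (I : finType) (J : {set I}) (g : I -> 'rV[R]_d) : M^T = M ->
  (forall x, 0 <= qform M x x) ->
  qform M (\sum_(i in J) g i) (\sum_(i in J) g i) <= #|J|%:R * \sum_(i in J) qform M (g i) (g i).
Proof.
move=> MT M0; pose Q i := qform M (g i) (g i).
have qle i j : qform M (g i) (g j) <= Q i / 2 + Q j / 2.
  have := M0 ((-1) *: g i + g j); rewrite qform_linl (qform_sym (g i))// (qform_sym (g j))// !qform_linl.
  by rewrite (qform_sym (g j) (g i))// /Q; lra.
rewrite qform_suml (@le_trans _ _ (\sum_(i in J) \sum_(j in J) (Q i / 2 + Q j / 2)))//.
  by apply: ler_sum => i _; rewrite qform_sym// qform_suml; apply: ler_sum => j _; rewrite addrC.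
under eq_bigr do rewrite big_split sumr_const/=.
rewrite big_split/= sumr_const sumrMnl -mulrnDl -mulr_suml -splitr mulr_natl.
exact: lexx.
Qed.

Variables (M : nat) (O : 'I_M -> set 'rV[R]_d) (kappa : nat).
Hypothesis oO : forall i, open (O i).
Hypothesis OO : forall i, O i `<=` Omega.
Hypothesis hkappa : overlap_le O Omega kappa.

(** At each point at most kappa of the fields G i are nonzero, so that the
    convexity of the form gives the factor kappa. *)
Lemma overlap_sum_energy (u : 'I_M -> 'rV[R]_d -> R) (G : 'I_M -> 'rV[R]_d -> 'rV[R]_d) w :
  (forall i, H1 Omega (u i)) -> (forall i, is_weak_gradient Omega (u i) (G i)) ->
  (forall i x, Omega x -> ~ O i x -> G i x = 0) ->
  {in Omega, w =1 (fun x => \sum_i u i x)} ->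
  aform A Omega w w <= kappa%:R * \sum_i aform A (O i) (u i) (u i).
Proof.
move=> uH uG G0 wE; have mOmega := open_measurable_rV oOmega.
have OOmega := @subset_refl _ Omega.
have wG : is_weak_gradient Omega w (fun x => \sum_i G i x).
  apply: (@is_weak_gradient_eq _ _ _ (fun x => \sum_i u i x)).
    by move=> x Ox; rewrite wE.
  suff [] : H1 Omega (fun x => \sum_i u i x) /\ is_weak_gradient Omega (fun x => \sum_i u i x) (fun x => \sum_i G i x) by [].
  elim: (index_enum _) => [|i r [IH1 IH2]].
    have [L0 _] := H1_lin_closed bOmega oOmega OOmega.
    rewrite (_ : (fun x => _) = fun=> 0); last by apply/funext => x; rewrite big_nil.
    split => //; have gi := wgradP L0.
    have := is_weak_gradient_lin (-1) oOmega bOmega L0.1 L0.1 gi gi.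
    move=> /(@is_weak_gradient_eq _ _ _ _ (fun=> 0)) H.
    apply: is_weak_gradient_eqG (H _) => x _; first by rewrite big_nil scaleN1r addNr.
    by rewrite mulr0 addr0.
  have -> : (fun x => \sum_(j <- i :: r) u j x) = (fun x => 1 * u i x + \sum_(j <- r) u j x).
    by apply/funext => x; rewrite big_cons mul1r.
  have -> : (fun x => \sum_(j <- i :: r) G j x) = (fun x => 1 *: G i x + \sum_(j <- r) G j x).
    by apply/funext => x; rewrite big_cons scale1r.
  by split; [exact: H1_lin|apply: is_weak_gradient_lin => //; [exact: (uH i).1|exact: IH1.1]].
have intG i : leb.-integrable Omega (EFin \o (fun x => qform (A x) (G i x) (G i x))).
  exact: (qform_integrable oOmega hA oOmega OOmega (uG i).1 (uG i).1).
rewrite (aformE oOmega bOmega hA oOmega OOmega wG wG).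
have aE i : aform A (O i) (u i) (u i) = \int[leb]_(x in Omega) qform (A x) (G i x) (G i x).
  have gi := is_weak_gradient_sub oOmega (@oO i) (@OO i) (uG i).
  rewrite (aformE oOmega bOmega hA (@oO i) (@OO i) gi gi); apply/esym; apply: Rintegral_support => //.
  by move=> x Ox nx; rewrite G0// qform0.
under eq_bigr do rewrite aE.
have [intS <-] := Rintegral_sum (index_enum 'I_M) mOmega intG.
rewrite -RintegralZl//; apply: le_Rintegral => //.
- exact: (qform_integrable oOmega hA oOmega OOmega wG.1 wG.1).
- rewrite (_ : EFin \o _ = (fun x => kappa%:R%:E * (EFin \o (fun x => (\sum_i qform (A x) (G i x) (G i x))%R)) x)%E)//.
  by apply: integrableZl.
- move=> x Ox; pose J := [set i | x \in O i]%SET.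
  have GJ i : i \notin J -> G i x = 0.
    by rewrite inE => /negP nx; apply: G0 => // ix; apply: nx; exact: mem_set.
  have A0 y : 0 <= qform (A x) y y by exact: (coefficient_ge0 hA y OOmega Ox).
  have AT : (A x)^T = A x by case: hA => _ _ + _; apply.
  rewrite (bigID [in J])/= [X in _ + X]big1 ?addr0 => [|i iJ]; last exact: GJ.
  rewrite (le_trans (qform_convex J (G^~ x) AT A0))// ler_pM ?sumr_ge0//.
    by rewrite ler_nat; exact: hkappa.
  by rewrite [leRHS](bigID [in J])/= lerDl sumr_ge0.
Qed.

Lemma overlap_restrict_energy u : H1 Omega u ->
  \sum_i aform A (O i) u u <= kappa%:R * aform A Omega u u.
Proof.
move=> uH; have mOmega := open_measurable_rV oOmega.
have OOmega := @subset_refl _ Omega.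
have gu := wgradP uH.
rewrite (aformE oOmega bOmega hA oOmega OOmega gu gu).
pose F x := qform (A x) (wgrad Omega u x) (wgrad Omega u x).
have intF := qform_integrable oOmega hA oOmega OOmega gu.1 gu.1.
have intFi i : leb.-integrable Omega (EFin \o (F \_ (O i))).
  have mO := open_measurable_rV (@oO i).
  rewrite -restrict_EFin; apply: (integrableS measurableT mOmega) => //.
  by apply: (iffLR (integrable_mkcond _ mO)); exact: (integrableS mOmega mO).
have aE i : aform A (O i) u u = \int[leb]_(x in Omega) (F \_ (O i)) x.
  have gi := is_weak_gradient_sub oOmega (@oO i) (@OO i) gu.
  rewrite (aformE oOmega bOmega hA (@oO i) (@OO i) gi gi); apply/esym.
  rewrite (@Rintegral_support _ _ _ leb Omega (O i))//.
    by apply: eq_Rintegral => x xO; rewrite patchE xO.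
  by move=> x Ox nx; rewrite patchE memNset.
under eq_bigr do rewrite aE.
have [intS <-] := Rintegral_sum (index_enum 'I_M) mOmega intFi.
rewrite -RintegralZl//; apply: le_Rintegral => //.
- rewrite (_ : EFin \o _ = (fun x => kappa%:R%:E * (EFin \o F) x)%E)//.
  by apply: integrableZl.
- move=> x Ox; have A0 : 0 <= F x by exact: (coefficient_ge0 hA _ OOmega Ox).
  pose J := [set i | x \in O i]%SET.
  rewrite (bigID [in J])/= [X in _ + X]big1 ?addr0 => [|i]; last first.
    by rewrite inE patchE => /negbTE ->.
  rewrite (eq_bigr (fun=> F x)); last by move=> i; rewrite inE patchE => ->.
  by rewrite sumr_const -[leLHS]mulr_natl ler_wpM2r// ler_nat; exact: hkappa.
Qed.

End overlaps.

(** * The local problems *)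

Section local_problem.
Context {R : realType} {d : nat}.
Variables (Omega GamD GamN : set 'rV[R]_d) (k : cell_kind) (sigma h : R) (N : nat) (tau : 'I_N -> @cell R d).
Variables (A : 'rV[R]_d -> 'M[R]_d) (alpha beta : R).
Variables (M : nat) (omega : 'I_M -> set 'rV[R]_d) (C1 : R) (chi : 'I_M -> 'rV[R]_d -> R).
Hypothesis oOmega : open Omega.
Hypothesis bOmega : bounded_set Omega.
Hypothesis lOmega : lipschitz_boundary Omega.
Hypothesis htau : triangulation k Omega sigma h tau.
Hypothesis hDN : closure GamD `|` closure GamN = bd Omega.
Hypothesis hA : coefficient Omega A alpha beta.
Hypothesis homega : open_cover Omega omega.
Hypothesis hchi : partition_of_unity Omega omega C1 chi.
Implicit Types (u v w p : 'rV[R]_d -> R) (x y s : 'rV[R]_d).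
Variables (i : 'I_M) (O : set 'rV[R]_d).
Hypotheses (oO : open O) (iO : omega i `<=` O) (OO : O `<=` Omega) (hO : resolved k tau O).

Let aO := aform A O.
Let b u v := aform A (omega i) (fun x => chi i x * u x) (fun x => chi i x * v x).

Let oi : open (omega i).
Proof. exact: (omega_open homega). Qed.

Let iOmega : omega i `<=` Omega.
Proof. exact: subset_trans OO. Qed.

Lemma chi_Vh_loc_H1 u : Vh_loc Omega k tau O u -> H1 (omega i) (fun x => chi i x * u x).
Proof.
move=> [u' uV uE]; apply: (@H1_eq _ _ _ (fun x => chi i x * u' x)).
  by move=> x /set_mem ix; rewrite uE//; apply: subset_closure; exact: iO.
by apply: (H1_sub oOmega) => //; exact: (chi_Vh_H1 oOmega bOmega htau homega hchi).
Qed.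

Lemma chi_form_semi_inner : semi_inner (Vh_loc Omega k tau O) b.
Proof.
have bH := aform_semi_inner oOmega bOmega hA oi iOmega.
have cH u : Vh_loc Omega k tau O u -> H1 (omega i) (fun x => chi i x * u x) by exact: chi_Vh_loc_H1.
split=> [c u v w uV vV wV|u v uV vV|u uV].
- have E : (fun x => chi i x * (c * u x + v x)) = (fun x => c * (chi i x * u x) + chi i x * v x).
    by apply/funext => x; ring.
  by rewrite /b E; exact: (form_linl bH c (cH _ uV) (cH _ vV) (cH _ wV)).
- exact: (form_sym bH (cH _ uV) (cH _ vV)).
- exact: (form_ge0 bH (cH _ uV)).
Qed.

Variables (m n : nat) (lam : nat -> R) (phi : nat -> 'rV[R]_d -> R).
Hypothesis eig : eigensystem O [set u | Wh Omega GamD A k tau O u] aO b m lam phi.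
Hypotheses (nm : (n < m)%N) (lam0 : 0 < lam n).

(** The abstract approximation result for the form b that is weighted with the
    partition of unity. *)
Lemma Wh_approximation w : Wh Omega GamD A k tau O w ->
  exists c, let e := fun x => w x - comb n c phi x in b e e <= (lam n)^-1 * aO w w.
Proof.
move=> wW; have [K [F FP]] := Vh_loc_span htau OO.
have WV u : Wh Omega GamD A k tau O u -> Vh_loc Omega k tau O u by case=> -[].
have HL : lin_closed [set u | Wh Omega GamD A k tau O u].
  exact: (Wh_lin_closed _ oOmega bOmega htau hA oO OO).
apply: (eigenfunction_approximation HL _ _ _ _ (fun u uW => FP u (WV u uW)) eig nm lam0 wW).
- apply: semi_innerS (aform_semi_inner oOmega bOmega hA oO OO) => u /WV.
  exact: (Vh_loc_H1 oOmega bOmega htau oO OO).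
- by apply: semi_innerS chi_form_semi_inner => u /WV.
- by move=> v v' w1 w1' vE wE; apply: aform_eq => x /set_mem Ox; rewrite ?vE ?wE.
- move=> v v' w1 w1' vE wE.
  by apply: aform_eq => x /set_mem /iO Ox; rewrite ?vE ?wE.
Qed.

Variables (f : 'rV[R]_d -> R) (g : ('rV[R]_d -> R) -> R) (q uhe psir psid : 'rV[R]_d -> R).
Hypothesis uheV : Vh Omega k tau uhe.
Hypothesis uheq : forall x, GamD x -> uhe x = q x.
Hypothesis uheF : forall v, Vh Omega k tau v -> (forall x, GamD x -> v x = 0) ->
       aform A Omega uhe v = load Omega GamN f g Omega v.
Hypothesis psirV : VhDI Omega GamD k tau O psir.
Hypothesis psirF : forall v, VhDI Omega GamD k tau O v -> aO psir v = load Omega GamN f g O v.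
Hypothesis psidV : Vh_loc Omega k tau O psid.
Hypothesis psidq : forall x, bd O x -> GamD x -> psid x = q x.
Hypothesis psid0 : forall v, VhD Omega GamD k tau O v -> aO psid v = 0.

Let w x := uhe x - psir x - psid x.

Let uheL : Vh_loc Omega k tau O uhe.
Proof. by exists uhe. Qed.

Let LL : lin_closed (Vh_loc Omega k tau O).
Proof. exact: Vh_loc_lin_closed. Qed.

Let aL : semi_inner (Vh_loc Omega k tau O) aO.
Proof.
apply: semi_innerS (aform_semi_inner oOmega bOmega hA oO OO) => u.
exact: (Vh_loc_H1 oOmega bOmega htau oO OO).
Qed.

Let psirL : Vh_loc Omega k tau O psir.
Proof. by case: psirV. Qed.

Let VhDI_D v : VhDI Omega GamD k tau O v -> VhD Omega GamD k tau O v.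
Proof. by case=> vV v0; split => // x bx Gx; apply: v0 => //; left. Qed.

(** Testing the global problem with zero extensions shows that the fine-scale
    solution and the particular functions solve the same local equations. *)
Lemma remainder_Wh : Wh Omega GamD A k tau O w.
Proof.
have wL : Vh_loc Omega k tau O w by apply: lin_closedB => //; exact: lin_closedB.
split; first split=> //.
  move=> x bx Gx; have [_ psir0] := psirV.
  by rewrite /w uheq// psidq// psir0 ?subr0 ?subrr//; left.
move=> v vDI; have [vL _] := vDI.
change (aO (fun x => uhe x - psir x - psid x) v = 0).
rewrite (formBl aL)//; last exact: lin_closedB.
rewrite (formBl aL)// psirF// psid0 ?subr0; last exact: VhDI_D.
apply/eqP; rewrite subr_eq0; apply/eqP.
rewrite -(load_ext0 GamN oO OO f g vDI) -uheF.
- by rewrite (aform_ext0 oOmega bOmega lOmega htau hA oO OO hO (Vh_H1 oOmega bOmega htau uheV) vDI).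
- exact: (ext0_Vh oOmega lOmega htau oO OO hO vDI).
- by move=> x Gx; exact: (ext0_GamD oOmega hDN oO OO vDI Gx).
Qed.

(** Pythagoras: uhe = w + psir + psid is an orthogonal sum.  For w is
    orthogonal to VhDI, which contains psir, and psid to VhD, which contains
    both. *)
Lemma remainder_energy : aO w w <= aO uhe uhe.
Proof.
have [wD w0] := remainder_Wh; have [wL _] := wD.
have {}w0 : aO w psir = 0 by exact: w0.
have pL : Vh_loc Omega k tau O (fun x => 1 * psir x + psid x) by exact: LL.2.
have -> : uhe = (fun x => 1 * w x + (1 * psir x + psid x)).
  by apply/funext => x; rewrite /w; ring.
rewrite (form_quad LL aL)// (form_quad LL aL)// (form_linr LL aL)//.
rewrite w0 (form_sym aL wL psidV) (psid0 wD) (form_sym aL psirL psidV) (psid0 (VhDI_D psirV)).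
have := form_ge0 aL psirL; have := form_ge0 aL psidV.
move: (aO w w) (aO psir psir) (aO psid psid) => p r s s0 r0; rewrite expr1n; lra.
Qed.

Lemma local_approximation :
  exists c, let e := fun x => uhe x - psir x - psid x - comb n c phi x in
    Vh_loc Omega k tau O (comb n c phi) /\ b e e <= (lam n)^-1 * aO uhe uhe.
Proof.
have [c cP] := Wh_approximation remainder_Wh; exists c; split.
  apply: (comb_closed _ LL) => j jn.
  by have [/(_ j (ltn_trans jn nm))[[[]]]] := eig.
have lam_ge0 : 0 <= (lam n)^-1 by rewrite invr_ge0 ltW.
exact: le_trans cP (ler_wpM2l lam_ge0 remainder_energy).
Qed.

End local_problem.

(** * The global estimate *)

Lemma form_orthogonal_le {R : realType} {T : Type} (V : set (T -> R)) a u v :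
  lin_closed V -> semi_inner V a -> V u -> V v -> a u v = 0 ->
  a u u <= a (fun x => 1 * u x + v x) (fun x => 1 * u x + v x).
Proof.
move=> VL aV Vu Vv uv; rewrite (form_quad VL aV)// uv mulr0 addr0 expr1n mul1r lerDl.
exact: (form_ge0 aV).
Qed.

Section global_space.
Context {R : realType} {d : nat}.
Variables (Omega GamD GamN : set 'rV[R]_d) (k : cell_kind) (sigma h : R) (N : nat) (tau : 'I_N -> @cell R d).
Variables (A : 'rV[R]_d -> 'M[R]_d).
Variables (M : nat) (omega omegas : 'I_M -> set 'rV[R]_d) (C1 : R) (chi : 'I_M -> 'rV[R]_d -> R).
Hypothesis oOmega : open Omega.
Hypothesis bOmega : bounded_set Omega.
Hypothesis lOmega : lipschitz_boundary Omega.
Hypothesis htau : triangulation k Omega sigma h tau.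
Hypothesis hDN : closure GamD `|` closure GamN = bd Omega.
Hypothesis homega : open_cover Omega omega.
Hypothesis hchi : partition_of_unity Omega omega C1 chi.
Hypothesis homegas : forall i, [/\ open (omegas i), omega i `<=` omegas i & omegas i `<=` Omega].
Implicit Types (u v w p : 'rV[R]_d -> R) (x y s : 'rV[R]_d).

(** Outside of omega_i the factor chi_i vanishes, so that a locally supported
    finite element function may be replaced by a global one. *)
Lemma pou_sum_Vh (u W : 'I_M -> 'rV[R]_d -> R) x :
  (forall i y, closure (omegas i) y -> u i y = W i y) ->
  Omega x -> pou_sum chi u x = \sum_i chi i x * W i x.
Proof.
move=> uW Ox; apply: eq_bigr => i _.
have [ix|nix] := pselect (omega i x); last by rewrite (chi_out hchi Ox nix) !mul0r.
have [_ iO _] := homegas i.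
by rewrite uW//; apply: subset_closure; exact: iO.
Qed.

Lemma pou_sum_H1 (u : 'I_M -> 'rV[R]_d -> R) v : (forall i, Vh_loc Omega k tau (omegas i) (u i)) ->
  (forall x, Omega x -> v x = pou_sum chi u x) -> H1 Omega v.
Proof.
move=> uL vu.
have /choice[W WP] : forall i, exists W, Vh Omega k tau W /\ forall y, closure (omegas i) y -> u i y = W y.
  by move=> i; have [W WV uW] := uL i; exists W.
apply: (pou_H1 oOmega bOmega htau homega hchi (fun i => (WP i).1)) => x Ox.
by rewrite vu// (pou_sum_Vh (fun i => (WP i).2)).
Qed.

(** Near the Dirichlet boundary only patches that touch it matter, and their
    eigenfunctions vanish there. *)
Lemma Sh_H1D n m lam phi v :
  (forall i, eigensystem (omegas i) [set u | Wh Omega GamD A k tau (omegas i) u]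
     (aform A (omegas i))
     (fun u v => aform A (omega i) (fun x => chi i x * u x) (fun x => chi i x * v x))
     (m i) (lam i) (phi i)) ->
  (forall i, (n i < m i)%N) -> Sh Omega omega chi n phi v -> H1D Omega GamD v.
Proof.
move=> heig hn [w [wspan vE]]; have /choice[c cP] := wspan.
have combD i : VhD Omega GamD k tau (omegas i) (comb (n i) (c i) (phi i)).
  apply: (comb_closed _ (VhD_lin_closed _ _ _ _ _)) => j jn.
  by have [/(_ j (ltn_trans jn (hn i)))[[]]] := heig i.
have /choice[W WP] : forall i, exists W, Vh Omega k tau W /\
    forall y, closure (omegas i) y -> comb (n i) (c i) (phi i) y = W y.
  by move=> i; have [[W WV uW] _] := combD i; exists W.
have GamD_cl : GamD `<=` closure Omega by move=> x /(GamD_bd hDN)[].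
apply: (pou_H1D oOmega bOmega lOmega htau homega hchi GamD_cl (fun i => (WP i).1)).
  move=> i x Gx cx; have [oi iO OO] := homegas i.
  have cx' := closureS iO cx.
  rewrite -(WP i).2//; have [_] := combD i; apply => //.
  by split=> //; rewrite (interior_id _).1// => /OO; exact: (GamD_notin oOmega hDN).
move=> x Ox; rewrite vE// -(pou_sum_Vh (fun i => (WP i).2))//.
apply: eq_bigr => i _.
have [ix|nix] := pselect (omega i x); first by rewrite cP.
by rewrite (chi_out hchi Ox nix) !mul0r.
Qed.

End global_space.

Theorem theorem3p4 (R : realType) (d : nat) (hd : d = 2%N \/ d = 3%N)
  (* domain and boundary parts *)
  (Omega GamD GamN : set 'rV[R]_d)
  (hOmega : polytopal_lipschitz_domain Omega)
  (hDN0 : GamD `&` GamN = set0)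
  (hDN : closure GamD `|` closure GamN = bd Omega)
  (* data *)
  (A : 'rV[R]_d -> 'M[R]_d) (alpha beta : R)
  (hA : coefficient Omega A alpha beta)
  (f : 'rV[R]_d -> R) (hf : L2 Omega f)
  (g : ('rV[R]_d -> R) -> R) (hg : H_minus_half Omega GamD GamN g)
  (q : 'rV[R]_d -> R) (hq : H_half Omega GamD q)
  (* the weak solution, unique *)
  (ue : 'rV[R]_d -> R)
  (hue : weak_solution Omega GamD GamN A f g q ue)
  (hunique : forall w, weak_solution Omega GamD GamN A f g q w ->
     {ae lebesgue_rV d, forall x, Omega x -> w x = ue x})
  (* cover, partition of unity, oversampling domains *)
  (M : nat) (omega : 'I_M -> set 'rV[R]_d) (homega : open_cover Omega omega)
  (kappa : nat) (hkappa : overlap_le omega Omega kappa)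
  (C1 : R) (chi : 'I_M -> 'rV[R]_d -> R)
  (hchi : partition_of_unity Omega omega C1 chi)
  (omegas : 'I_M -> set 'rV[R]_d)
  (homegas : forall i, [/\ open (omegas i), omega i `<=` omegas i &
                           omegas i `<=` Omega])
  (kappas : nat) (hkappas : overlap_le omegas Omega kappas)
  (* mesh and finite element solution *)
  (k : cell_kind) (sigma h : R) (N : nat) (tau : 'I_N -> cell)
  (htau : triangulation k Omega sigma h tau)
  (hres : forall i, resolved k tau (omegas i))
  (hqh : exists2 w, Vh Omega k tau w & forall x, GamD x -> w x = q x)
  (uhe : 'rV[R]_d -> R)
  (huhe : [/\ Vh Omega k tau uhe, forall x, GamD x -> uhe x = q x &
     forall v, Vh Omega k tau v -> (forall x, GamD x -> v x = 0) ->
       aform A Omega uhe v = load Omega GamN f g Omega v])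
  (* local particular functions *)
  (psir psid : 'I_M -> 'rV[R]_d -> R)
  (hpsir : forall i, VhDI Omega GamD k tau (omegas i) (psir i) /\
     forall v, VhDI Omega GamD k tau (omegas i) v ->
       aform A (omegas i) (psir i) v = load Omega GamN f g (omegas i) v)
  (hpsid : forall i, [/\ Vh_loc Omega k tau (omegas i) (psid i),
     forall x, bd (omegas i) x -> GamD x -> psid i x = q x,
     forall v, VhD Omega GamD k tau (omegas i) v ->
       aform A (omegas i) (psid i) v = 0 &
     bd (omegas i) `&` GamD = set0 ->
       forall x, closure (omegas i) x -> psid i x = 0])
  (* local eigenproblems; n i eigenfunctions are kept, and lam i (n i) is the
     (n i + 1)-th eigenvalue *)
  (m n : 'I_M -> nat) (lam : 'I_M -> nat -> R) (phi : 'I_M -> nat -> 'rV[R]_d -> R)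
  (heig : forall i,
     eigensystem (omegas i) [set u | Wh Omega GamD A k tau (omegas i) u]
       (aform A (omegas i))
       (fun u v => aform A (omega i) (fun x => chi i x * u x)
                                     (fun x => chi i x * v x))
       (m i) (lam i) (phi i))
  (hn : forall i, (n i < m i)%N)
  (hlam : forall i, 0 < lam i (n i))
  (* the discrete MS-GFEM approximation *)
  (uhp uhs : 'rV[R]_d -> R)
  (huhp : uhp = pou_sum chi (fun i x => psir i x + psid i x))
  (huhs : Sh Omega omega chi n phi uhs /\
     forall v, Sh Omega omega chi n phi v ->
       aform A Omega uhs v = load Omega GamN f g Omega v - aform A Omega uhp v) :
  anorm A Omega (fun x => ue x - (uhp x + uhs x)) <=
    anorm A Omega (fun x => ue x - uhe x) +
    Num.sqrt ((kappa * kappas)%:R) *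
    (\big[Num.max/0]_(i < M) (Num.sqrt (lam i (n i)))^-1) *
    anorm A Omega uhe.
Proof.
have [[oOmega _ _] [bOmega _ lOmega]] := hOmega.
have [uheV uheq uheF] := huhe; have [ueH _ ueF] := hue.
have OO := @subset_refl _ Omega.
have HL := H1_lin_closed bOmega oOmega OO.
have aH := aform_semi_inner oOmega bOmega hA oOmega OO.
have /choice[c cP] : forall i, exists c : nat -> R,
    let e := fun x => uhe x - psir i x - psid i x - comb (n i) c (phi i) x in
    Vh_loc Omega k tau (omegas i) (comb (n i) c (phi i)) /\
    aform A (omega i) (fun x => chi i x * e x) (fun x => chi i x * e x) <=
      (lam i (n i))^-1 * aform A (omegas i) uhe uhe.
  move=> i; have [oi iO iOmega] := homegas i; have [psirV psirF] := hpsir i.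
  have [psidV psidq psid0 _] := hpsid i.
  exact: (local_approximation oOmega bOmega lOmega htau hDN hA homega hchi oi iO iOmega (hres i)
    (heig i) (hn i) (hlam i) uheV uheq uheF psirV psirF psidV psidq psid0).
pose e i x := uhe x - psir i x - psid i x - comb (n i) (c i) (phi i) x.
have LL i := Vh_loc_lin_closed Omega k tau (omegas i).
have pL i : Vh_loc Omega k tau (omegas i) (fun x => psir i x + psid i x).
  have [[psirV _] _] := hpsir i; have [psidV _ _ _] := hpsid i.
  exact: (lin_closedD (LL i)).
have eL i : Vh_loc Omega k tau (omegas i) (e i).
  have [[psirV _] _] := hpsir i; have [psidV _ _ _] := hpsid i; have [combV _] := cP i.
  by do 3 (apply: (lin_closedB (LL i)) => //); exists uhe.
(* The competitor of uhs. *)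
pose vs := pou_sum chi (fun i => comb (n i) (c i) (phi i)).
have vsS : Sh Omega omega chi n phi vs.
  by exists (fun i => comb (n i) (c i) (phi i)); split => // i; exists (c i).
have ShH v : Sh Omega omega chi n phi v -> H1D Omega GamD v.
  exact: (Sh_H1D oOmega bOmega lOmega htau hDN homega hchi homegas heig hn).
have [uhsS uhsF] := huhs.
have uhpH : H1 Omega uhp.
  by apply: (pou_sum_H1 oOmega bOmega htau homega hchi homegas pL) => x _; rewrite huhp.
have uhsH := (ShH _ uhsS).1; have vsH := (ShH _ vsS).1.
have uheH := Vh_H1 oOmega bOmega htau uheV.
pose z x := uhs x - vs x.
have zS : Sh Omega omega chi n phi z.
  have [w1 [w1s w1E]] := uhsS.
  exists (fun i x => w1 i x - comb (n i) (c i) (phi i) x); split=> [i|x Ox].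
    have [c1 c1P] := w1s i; exists (fun j => c1 j - c i j) => x ix.
    by rewrite c1P// /comb -sumrB; apply: eq_bigr => j _; rewrite mulrBl.
  by rewrite /z w1E// /vs /pou_sum -sumrB; apply: eq_bigr => i _; rewrite mulrBr.
have zH : H1 Omega z by exact: lin_closedB.
pose d1 x := ue x - (uhp x + uhs x).
have d1H : H1 Omega d1 by apply: (lin_closedB HL) => //; exact: lin_closedD.
(* Test both the global and the discrete problem with z. *)
have d1z : aform A Omega d1 z = 0.
  rewrite (formBl aH ueH (lin_closedD HL uhpH uhsH) zH) (formDl aH uhpH uhsH zH).
  by rewrite (ueF z (ShH z zS)) (uhsF z zS) [X in _ - X]addrC subrK subrr.
pose r x := uhe x - uhp x - vs x.
have rH : H1 Omega r by do 2 apply: (lin_closedB HL) => //.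
have dH : H1 Omega (fun x => ue x - uhe x) by exact: lin_closedB.
have d1E : (fun x => 1 * d1 x + z x) = (fun x => (ue x - uhe x) + r x).
  by apply/funext => x; rewrite /d1 /z /r; ring.
have tri : anorm A Omega d1 <= anorm A Omega (fun x => ue x - uhe x) + anorm A Omega r.
  apply: le_trans (form_triangle HL aH dH rH).
  by apply: ler_wsqrtr; rewrite -d1E; exact: (form_orthogonal_le HL aH d1H zH d1z).
apply: (le_trans tri); rewrite lerD2l.
have /choice[E EP] : forall i, exists E, Vh Omega k tau E /\
    forall y, closure (omegas i) y -> e i y = E y.
  by move=> i; have [E EV eE] := eL i; exists E.
have rE : {in Omega, r =1 (fun x => \sum_i chi i x * E i x)}.
  move=> x /set_mem Ox.
  have chi1 : \sum_(i < M) chi i x = 1 by case: hchi => _ + _ _ _; apply.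
  rewrite -(pou_sum_Vh hchi homegas (fun i => (EP i).2) Ox) /pou_sum /r huhp /vs /pou_sum.
  rewrite -[uhe x]mul1r -chi1 mulr_suml -!sumrB; apply: eq_bigr => i _.
  by rewrite /e; ring.
have /choice[G GP] : forall i, exists G, is_weak_gradient Omega (fun x => chi i x * E i x) G /\
    forall x, Omega x -> ~ omega i x -> G x = 0.
  by move=> i; have [G ? ?] := chi_Vh_weak_gradient oOmega bOmega htau homega hchi i (EP i).1; exists G.
have ener := overlap_sum_energy oOmega bOmega hA (omega_open homega) (omega_sub homega) hkappa
  (fun i => chi_Vh_H1 oOmega bOmega htau homega hchi i (EP i).1)
  (fun i => (GP i).1) (fun i => (GP i).2) rE.
pose Lam : R := \big[Num.max/0]_(i < M) (Num.sqrt (lam i (n i)))^-1.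
have Lam0 : 0 <= Lam by exact: bigmax_ge_id.
have lamLe i : (lam i (n i))^-1 <= Lam ^+ 2.
  have -> : (lam i (n i))^-1 = (Num.sqrt (lam i (n i)))^-1 ^+ 2.
    by rewrite exprVn sqr_sqrtr// ltW.
  apply: lerXn2r; rewrite ?nnegrE ?invr_ge0 ?sqrtr_ge0//.
  exact: (le_bigmax 0 (fun i => (Num.sqrt (lam i (n i)))^-1) i).
have loc i : aform A (omega i) (fun x => chi i x * E i x) (fun x => chi i x * E i x) <=
    Lam ^+ 2 * aform A (omegas i) uhe uhe.
  have [oi iO iOmega] := homegas i; have [_ ci] := cP i.
  have eE : {in omega i, (fun x => chi i x * E i x) =1 (fun x => chi i x * e i x)}.
    by move=> x /set_mem ix; rewrite (EP i).2//; apply: subset_closure; exact: iO.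
  rewrite (aform_eq A eE eE); apply: (le_trans ci).
  by apply: ler_wpM2r (lamLe i); exact: (aform_ge0 hA _ iOmega).
have over : \sum_i aform A (omegas i) uhe uhe <= kappas%:R * aform A Omega uhe uhe.
  apply: (overlap_restrict_energy oOmega bOmega hA _ _ hkappas uheH) => i; by have [] := homegas i.
have bound : aform A Omega r r <= (kappa * kappas)%:R * Lam ^+ 2 * aform A Omega uhe uhe.
  have ac (p1 p2 p3 p4 : R) : p1 * p2 * p3 * p4 = p1 * (p3 * (p2 * p4)) by ring.
  apply: (le_trans ener); rewrite natrM ac; apply: ler_wpM2l => //.
  apply: (@le_trans _ _ (Lam ^+ 2 * \sum_i aform A (omegas i) uhe uhe)).
    by rewrite mulr_sumr; apply: ler_sum => i _; exact: loc.
  by apply: ler_wpM2l over; exact: sqr_ge0.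
have K0 : 0 <= (kappa * kappas)%:R * Lam ^+ 2 by apply: mulr_ge0 => //; exact: sqr_ge0.
have := ler_wsqrtr bound.
by rewrite (sqrtrM _ K0) (sqrtrM _ (ler0n _ (kappa * kappas))) sqrtr_sqr (ger0_norm Lam0).
Qed.
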